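(* Assume that $\mathbb{E}[L^\alpha+R^\alpha]=1$ holds with $\alpha=1$, i.e. $\mathbb{E}[L+R]=1$, and that $\mathcal{S}(\gamma)<0$ for some $\gamma>0$. If the initial condition possesses a finite first moment $m_0=\mathbb{E}[X_0]$, then $V_t$ converges in distribution, as $t\to+\infty$, to $V_\infty:=m_0M_\infty^{(1)}$. In particular, $V_\infty$ is non-degenerate if $\gamma>1$ and $m_0\neq0$, whereas $V_\infty=0$ if $\gamma<1$. Moreover, if $L+R=1$ a.s., then $V_\infty=m_0$ a.s. Finally, if $V_\infty$ is non-degenerate and $p>1$, then $\mathbb{E}[|V_\infty|^p]<+\infty$ if and only if $\mathcal{S}(p)<0$.
   Context: $(L,R)$ is a fixed random vector with $L,R\ge 0$. For $s\ge0$, $\mathcal{S}(s)=\mathbb{E}[L^s+R^s]-1\in[-1,\infty]$ (with $0^0=0$). The initial condition $X_0$ is a real random variable with distribution function $F_0$ and characteristic function $\phi_0$. On a sufficiently large probability space $(\Omega,\mathcal{F},P)$ let the following stochastically independent families be given: i.i.d. random variables $(X_n)_{n\ge1}$ with distribution function $F_0$; i.i.d. random vectors $(L_n,R_n)_{n\ge1}$ distributed as $(L,R)$; independent random variables $(I_n)_{n\ge1}$ with $I_n$ uniform on $\{1,\dots,n\}$; a process $(\nu_t)_{t\ge0}$ with values in the positive integers and $P\{\nu_t=n\}=e^{-t}(1-e^{-t})^{n-1}$. Define $\beta_{1,1}=1$, $(\beta_{1,2},\beta_{2,2})=(L_1,R_1)$ and, for $n\ge2$, $$(\beta_{1,n+1},\dots,\beta_{n+1,n+1})=(\beta_{1,n},\dots,\beta_{I_n-1,n},L_n\beta_{I_n,n},R_n\beta_{I_n,n},\beta_{I_n+1,n},\dots,\beta_{n,n}).$$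 Put $W_n=\sum_{j=1}^n\beta_{j,n}X_j$ and $V_t=W_{\nu_t}=\sum_{j=1}^{\nu_t}\beta_{j,\nu_t}X_j$. (The characteristic function $\phi(t;\cdot)$ of $V_t$ is the unique solution of $\partial_t\phi(t;\xi)+\phi(t;\xi)=\mathbb{E}[\phi(t;L\xi)\phi(t;R\xi)]$, $\phi(0;\cdot)=\phi_0$.) $M_n^{(1)}=\sum_{j=1}^n\beta_{j,n}$, and $M_\infty^{(1)}\ge0$ is its almost sure limit as $n\to\infty$ (which exists when $\mathbb{E}[L+R]=1$). *)

(* Defs.v *)
From HB Require Import structures.
From mathcomp Require Import all_boot all_order all_algebra.
From mathcomp Require Import all_classical all_reals all_analysis.
Import Order.TTheory GRing.Theory Num.Theory.
Import numFieldNormedType.Exports.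

Set Implicit Arguments.
Unset Strict Implicit.
Unset Printing Implicit Defensive.

Local Open Scope classical_set_scope.
Local Open Scope ring_scope.

Section Independence.
Context d (T : measurableType d) (R : realType) (P : probability T R).

(* Mutual independence of the set systems F i, i in D: the product rule holds
   for every finite subfamily. *)
Definition mutually_independent (I : eqType) (D : set I)
    (F : I -> set (set T)) : Prop :=
  forall (J : seq I) (A : I -> set T), uniq J ->
    (forall i, i \in J -> D i /\ F i (A i)) ->
    P (\bigcap_(i in [set` J]) A i) = (\prod_(i <- J) P (A i))%E.

Context d' (T' : measurableType d').

Definition sigma_rv (X : {RV P >-> T'}) : set (set T) :=
  preimage_set_system [set: T] X measurable.

Definition sigma_family (I : Type) (D : set I) (X : I -> {RV P >-> T'}) :
    set (set T) :=
  <<s \bigcup_(i in D) sigma_rv (X i) >>.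

Definition independent_rvs (I : eqType) (D : set I) (X : I -> {RV P >-> T'}) :
    Prop :=
  mutually_independent D (fun i => sigma_rv (X i)).

End Independence.

Definition same_law d1 (T1 : measurableType d1) d2 (T2 : measurableType d2)
    (R : realType) (P1 : probability T1 R) (P2 : probability T2 R)
    d' (T' : measurableType d') (X : {RV P1 >-> T'}) (Y : {RV P2 >-> T'}) :
    Prop :=
  forall A : set T', measurable A -> distribution P1 X A = distribution P2 Y A.

Section RandomVariables.
Context d (T : measurableType d) (R : realType) (P : probability T R).

(* Weak convergence of the laws of V t to the law of Y as t -> +oo. *)
Definition cvg_in_distribution (V : R -> T -> R) (Y : T -> R) : Prop :=
  forall f : R -> R, continuous f -> (exists M, forall x, `|f x| <= M) ->
    ('E_P[f \o V t])%E @[t --> +oo] --> ('E_P[f \o Y])%E.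

(* "Non-degenerate" means that the law is not the Dirac mass at 0, and not
   that it is not any Dirac mass: when L = R = 1/2, say, the limit is the
   constant m_0, which still counts as non-degenerate if m_0 != 0. *)
Definition nondegenerate_rv (Y : T -> R) : Prop :=
  ~ {ae P, forall w, Y w = 0}.

(* powR has 0 `^ 0 = 1, whereas the convention here is 0^0 = 0. *)
Definition pow00 (x s : R) : R := if x == 0 then 0 else x `^ s.

Definition calS (LR : T -> R * R) (s : R) : \bar R :=
  ('E_P[fun w => (pow00 (LR w).1 s + pow00 (LR w).2 s)%R] - 1)%E.

End RandomVariables.

(* beta_coef lr i n j is beta_{j,n} for 1 <= j <= n, where lr k = (L_k, R_k) and
   i k = I_k for k >= 1; the other values of n and j are irrelevant. *)
Fixpoint beta_coef (R : realType) (lr : nat -> R * R) (i : nat -> nat)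
    (n j : nat) {struct n} : R :=
  match n with
  | 0 => 0
  | 1 => if j == 1%N then 1 else 0
  | 2 => if j == 1%N then (lr 1%N).1 else if j == 2%N then (lr 1%N).2 else 0
  | (_.+2 as m).+1 =>
      if (j < i m)%N then beta_coef lr i m j
      else if j == i m then (lr m).1 * beta_coef lr i m (i m)
      else if j == (i m).+1 then (lr m).2 * beta_coef lr i m (i m)
      else beta_coef lr i m j.-1
  end.

Section Process.
Context (T : Type) (R : realType).
Variables (LR : nat -> T -> R * R) (I : nat -> T -> nat).

Definition rbeta (n j : nat) (w : T) : R :=
  beta_coef (LR ^~ w) (I ^~ w) n j.

Definition M1 (n : nat) (w : T) : R := \sum_(1 <= j < n.+1) rbeta n j w.

Definition W (X : nat -> T -> R) (n : nat) (w : T) : R :=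
  \sum_(1 <= j < n.+1) rbeta n j w * X j w.

Definition V (X : nat -> T -> R) (nu : R -> T -> nat) (t : R) (w : T) : R :=
  W X (nu t w) w.

End Process.

(* Main.v *)
Require Import Defs.
From HB Require Import structures.
From mathcomp Require Import all_boot all_order all_algebra.
From mathcomp Require Import all_classical all_reals all_analysis.
From mathcomp Require Import measurable_realfun.
From mathcomp Require Import ring lra zify.
Import Order.TTheory GRing.Theory Num.Theory.
Import numFieldNormedType.Exports.

Set Implicit Arguments.
Unset Strict Implicit.
Unset Printing Implicit Defensive.

Local Open Scope classical_set_scope.
Local Open Scope ring_scope.

(** Write b_1, ..., b_n for the weights beta_{j,n}, M_n for their sum, M for
    the limit of M_n, and S_n(s) for the sum of the b_j^s.

    Weights and law of large numbers.  The n-th fragmentation picks one of n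
    pieces uniformly and multiplies it by the independent pair (L, R), so it
    changes the mean of S_n(s) by the factor 1 + S(s)/n.  For s = 1 the factor
    is 1, and M_n is a nonnegative martingale of mean 1 ([martingale]).  If
    S(s) < 0 the mean of S_n(s) is at most a product of factors 1 - c/k, which
    tends to 0 since the harmonic series diverges ([weight_power_decay],
    [decay_cvg0]).  With s = gamma this says that in probability no single
    weight stays large.  The X_j are independent of the weights, so a law of
    large numbers for the weighted sum W_n holds: W_n - m0 M_n tends to 0 in
    probability ([weighted_sum_concentration]).  As only a first moment of X_0
    is available, the X_j are clipped at a high level; the clipped centred
    variables give an orthogonal sum whose second moment is bounded by the
    largest weight, and the rest is small in mean.  Hence E[f(W_n)] tends to
    E[f(m0 M)] for bounded continuous f.  The index nu_t is independent of all
    the rest and takes each value with probability at most exp(-t), so the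
    finitely many bad indices become negligible ([mean_at_nu_le]).

    Degenerate and conservative cases.  If gamma < 1, then M_n^gamma is at
    most S_n(gamma) by subadditivity, and Fatou gives E[M^gamma] = 0.  The
    value gamma = 1 cannot occur, because S(1) = 0.  If L + R = 1, every
    fragmentation preserves M_n = 1.

    Finite moments when S(p) < 0.  A fragmentation replaces M_n by
    M_n + b (L + R - 1), where b is the chosen weight.  In the expansion of the
    p-th power the first-order term has mean 0, and [fragmentation_powR] bounds
    the remainder by y^k M_n^(p-1) b + y^(k-1) b^p up to a factor depending
    only on (L, R), for every y in (0, 1].  The mean of the first term over the
    choice of the piece is y^k M_n^p / n, that of the second
    y^(k-1) S_n(p) / n.  Taking for y the bound y_n on the mean of S_n(p)
    makes both of size y_n^k / n times E[M_n^p] + 1.  These factors have a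
    finite sum, which telescopes ([powR_decay_telescope]), so M_n is bounded
    in L^p ([total_weight_moment_bounded]).  For p = gamma > 1 this makes the
    martingale uniformly integrable, whence E[M] is at least 1 and the limit
    is non-degenerate; for general p Fatou gives E[M^p] finite.

    Converse.  A non-degenerate limit forces gamma > 1, so M_n is bounded by
    the conditional mean of M, and by convexity the mean of M_n^p over an event
    A of the past is at most that of M^p ([limit_mass_dominates]).
    If S(p) >= 0, the mean of S_n(p) stays at least 1 ([weight_power_ge1]).
    But S_n(p) is at most (max b_j)^(p-1) M_n, hence at most M_n / 4 where the
    weights are small, and at most M_n^p on the complementary event, whose
    probability tends to 0.  If M^p were integrable, the mean of S_n(p) would
    eventually be less than 1 ([finite_moment_subcritical]). *)

(** * Inequalities between powers *)

Section PowerInequalities.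
Context {R : realType}.
Implicit Types a b p q r s t x y : R.

(** Young's inequality for the exponents [p] and [p / (p - 1)]: the graph of
    the convex function [x `^ p] lies above its tangent at [b]. *)
Lemma powR_tangent p a b : 1 < p -> 0 <= a -> 0 <= b ->
  p * a * b `^ (p - 1) <= a `^ p + (p - 1) * b `^ p.
Proof.
move=> p1 a0 b0; have p0 : 0 < p by lra.
have pn0 : p != 0 by lra.
have p1n0 : p - 1 != 0 by lra.
have H := @conjugate_powR R a (b `^ (p - 1)) p (p / (p - 1)) a0 (powR_ge0 _ _) p0.
have /H : 0 < p / (p - 1) by rewrite divr_gt0// subr_gt0.
have -> : p^-1 + (p / (p - 1))^-1 = 1 by field; exact/andP.
move=> /(_ erefl); rewrite -powRrM.
have -> : (p - 1) * (p / (p - 1)) = p by field.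
rewrite -(ler_pM2l p0) mulrA => /le_trans; apply.
by rewrite le_eqVlt; apply/orP; left; apply/eqP; field; exact/andP.
Qed.

Lemma powR_mulB1 a p : 0 <= a -> 1 < p -> a * a `^ (p - 1) = a `^ p.
Proof. by move=> a0 p1; rewrite mulr_powRB1//; lra. Qed.

Lemma powR_subadditive q a b : 0 < q <= 1 -> 0 <= a -> 0 <= b ->
  (a + b) `^ q <= a `^ q + b `^ q.
Proof.
move=> /andP[q0 q1] a0 b0.
have [ab0|] := ltP 0 (a + b); last first.
  move=> ab; have -> : a = 0 by lra.
  have -> : b = 0 by lra.
  by rewrite addr0 powR0 ?gt_eqF// addr0.
have aux c : 0 <= c -> c <= a + b -> c * (a + b) `^ (q - 1) <= c `^ q.
  rewrite le_eqVlt => /predU1P[<- _|c0 cab].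
    by rewrite mul0r powR_ge0.
  rewrite -(mulr_powRB1 (ltW c0) q0) ler_pM2l//.
  have -> : q - 1 = - (1 - q) by ring.
  rewrite !powRN lef_pV2 ?posrE ?powR_gt0//.
  apply: ge0_ler_powR; rewrite ?nnegrE//; [lra|exact: ltW|exact: ltW].
rewrite -(mulr_powRB1 (ltW ab0) q0) mulrDl lerD// aux//; lra.
Qed.

Lemma powR_superadditive p a b : 1 <= p -> 0 <= a -> 0 <= b ->
  a `^ p + b `^ p <= (a + b) `^ p.
Proof.
move=> p1 a0 b0; have p0 : 0 < p by lra.
rewrite -(mulr_powRB1 a0 p0) -(mulr_powRB1 b0 p0).
rewrite -(@mulr_powRB1 _ (a + b) p) ?addr_ge0// mulrDl.
by apply: lerD; apply: ler_wpM2l => //; apply: ge0_ler_powR;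
  rewrite ?nnegrE; lra.
Qed.

Lemma powR_dist_le q a b : 0 < q <= 1 -> 0 <= a -> 0 <= b ->
  `|a `^ q - b `^ q| <= `|a - b| `^ q.
Proof.
move=> q01 a0 b0; wlog ab : a b a0 b0 / b <= a.
  move=> h; have [/h|/ltW/h] := leP b a; first exact.
  by rewrite distrC [`|b - a|]distrC; exact.
have q0 : 0 <= q by have /andP[/ltW] := q01.
rewrite !ger0_norm ?subr_ge0//; last exact: ge0_ler_powR.
by rewrite lerBlDr -{1}(subrK b a) powR_subadditive// subr_ge0.
Qed.

Lemma powR_sum_le (I : Type) (l : seq I) (P : pred I) (f : I -> R) q :
  0 < q <= 1 -> (forall i, 0 <= f i) ->
  (\sum_(i <- l | P i) f i) `^ q <= \sum_(i <- l | P i) f i `^ q.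
Proof.
move=> q01 f0.
suff [//] : 0 <= \sum_(i <- l | P i) f i /\
  (\sum_(i <- l | P i) f i) `^ q <= \sum_(i <- l | P i) f i `^ q.
apply: (big_ind2 (fun u v => 0 <= u /\ u `^ q <= v)) => [|u v u' v'|i _] //.
- by split=> //; rewrite powR0// gt_eqF//; have /andP[] := q01.
- move=> [u0 uv] [u'0 uv']; split; first exact: addr_ge0.
  by rewrite (le_trans (powR_subadditive _ _ _))// lerD.
Qed.

Lemma sum_powR_le (I : Type) (l : seq I) (P : pred I) (f : I -> R) p :
  1 <= p -> (forall i, 0 <= f i) ->
  \sum_(i <- l | P i) f i `^ p <= (\sum_(i <- l | P i) f i) `^ p.
Proof.
move=> p1 f0.
suff [//] : 0 <= \sum_(i <- l | P i) f i /\
  \sum_(i <- l | P i) f i `^ p <= (\sum_(i <- l | P i) f i) `^ p.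
apply: (big_ind2 (fun u v => 0 <= u /\ v <= u `^ p)) => [|u v u' v'|i _] //.
- move=> [u0 uv] [u'0 uv']; split; first exact: addr_ge0.
  by rewrite (le_trans _ (powR_superadditive _ _ _))// lerD.
Qed.

(** The tangent at [t], evaluated at [1].  The factor [t `^ (p - 1) - 1] is
    kept because it is estimated differently for [p <= 2] and for [p > 2]. *)
Lemma powR_remainder p t : 1 < p -> 0 <= t ->
  t `^ p - 1 - p * (t - 1) <= p * ((t - 1) * (t `^ (p - 1) - 1)).
Proof.
move=> p1 t0; have := powR_tangent p1 ler01 t0.
by rewrite powR1 -(powR_mulB1 t0 p1); nra.
Qed.

(** Mean value inequality, obtained from the tangent at the larger of [t] and
    [1]. *)
Lemma powR_dist1_le q c t : 1 < q -> 0 <= t -> 1 <= c -> t <= c ->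
  `|t `^ q - 1| <= q * `|t - 1| * c `^ (q - 1).
Proof.
move=> q1 t0 c1 tc.
have c1q : 1 <= c `^ (q - 1).
  by have := @ler_powR _ c c1 0 (q - 1); rewrite powRr0; apply; lra.
have [t1|t1] := leP 1 t.
- rewrite !ger0_norm ?subr_ge0//; last first.
    by have := @ler_powR _ t t1 0 q; rewrite powRr0; apply; lra.
  apply: (@le_trans _ _ (q * (t - 1) * t `^ (q - 1))).
    have := powR_tangent q1 ler01 t0.
    by rewrite powR1 -(powR_mulB1 t0 q1); nra.
  apply: ler_wpM2l; first by nra.
  by apply: ge0_ler_powR; rewrite ?nnegrE//; lra.
- rewrite !ltr0_norm ?subr_lt0//; last first.
    have q0 : 0 < q by lra.
    by have := gt0_ltr_powR q0 t0 ler01 t1; rewrite powR1.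
  have := powR_tangent q1 t0 ler01; rewrite !powR1 => h.
  apply: (@le_trans _ _ (q * - (t - 1))); first by lra.
  by apply: ler_peMr => //; apply: mulr_ge0; lra.
Qed.

Lemma powR_add1_le p s : 1 < p -> 0 <= s ->
  (1 + s) `^ p <= 2 `^ p * (1 + s `^ p).
Proof.
move=> p1 s0; have p0 : 0 <= p by lra.
have sp := powR_ge0 s p; have tp := powR_ge0 2 p.
have [s1|s1] := leP s 1.
- apply: (@le_trans _ _ (2 `^ p)); last by nra.
  by apply: ge0_ler_powR; rewrite ?nnegrE//; lra.
- apply: (@le_trans _ _ ((2 * s) `^ p)); last by rewrite powRM//; nra.
  by apply: ge0_ler_powR; rewrite ?nnegrE//; lra.
Qed.

(** The remainder is of order [r `^ p] when [p <= 2], and then [k = 1] works.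
    When [p > 2] it is of order [r ^+ 2], which is interpolated between [r] and
    [r `^ p]: the two regimes [r <= y `^ k] and [r > y `^ k] give the two terms
    of the bound, and matching them forces [k = (p - 1)^-1]. *)
Lemma fragmentation_powR_unit p : 1 < p ->
  exists C k : R, [/\ 0 <= C, 0 < k <= 1 &
  forall r s y, 0 <= r <= 1 -> 0 <= s -> 0 < y <= 1 ->
    (1 + r * (s - 1)) `^ p + p * r <=
    1 + p * r * s + C * (1 + s `^ p) * (y `^ k * r + y `^ (k - 1) * r `^ p)].
Proof.
move=> p1; have p0 : 0 <= p by lra.
have tp := powR_ge0 (2 : R) p.
have key r s : 0 <= r <= 1 -> 0 <= s ->
   (1 + r * (s - 1)) `^ p + p * r <= 1 + p * r * s +
    p * (r * (s - 1) * ((1 + r * (s - 1)) `^ (p - 1) - 1)).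
  move=> /andP[r0 r1] s0.
  have t0 : 0 <= 1 + r * (s - 1) by nra.
  by have := powR_remainder p1 t0; rewrite [_ + _ - 1]addrAC subrr add0r; lra.
have sd s : 0 <= s -> `|s - 1| <= 1 + s.
  by move=> s0; rewrite ler_norml; apply/andP; split; lra.
have [p2|p2] := leP p 2.
(* The power [p - 1 <= 1] is Hoelder continuous, so the remainder is at most
   [p * `|r * (s - 1)| `^ p]. *)
- exists (p * 2 `^ p), 1; split; [exact: mulr_ge0|by rewrite ltr01 lexx|].
  move=> r s y r01 s0 y01; rewrite (le_trans (key _ _ r01 s0))// lerD2l.
  have /andP[r0 r1] := r01; have /andP[y0 y1] := y01.
  have t0 : 0 <= 1 + r * (s - 1) by nra.
  rewrite subrr powRr0 mul1r powRr1 ?(ltW y0)// -!mulrA ler_wpM2l//.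
  apply: (@le_trans _ _ (r `^ p * (1 + s) `^ p)); last first.
    have := powR_add1_le p1 s0; have := powR_ge0 r p; have := powR_ge0 s p.
    set A := r `^ p; set B := s `^ p; set D := 2 `^ p in tp *.
    move=> B0 A0 h.
    apply: (@le_trans _ _ (A * (D * (1 + B)))); first exact: ler_wpM2l.
    have -> : A * (D * (1 + B)) = D * ((1 + B) * A) by ring.
    rewrite ler_wpM2l// ler_wpM2l; [by []|by rewrite addr_ge0|].
    by rewrite lerDr mulr_ge0// ltW.
  rewrite (le_trans (ler_norm _))// mulrA normrM.
  have q01 : 0 < p - 1 <= 1 by apply/andP; split; lra.
  have := powR_dist_le q01 t0 ler01; rewrite powR1 [_ + _ - 1]addrAC subrr add0r => h.
  rewrite (le_trans (ler_wpM2l _ h))// powR_mulB1// normrM (ger0_norm r0) powRM//.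
  rewrite ler_wpM2l ?powR_ge0//.
  apply: ge0_ler_powR; rewrite ?nnegrE ?addr_ge0//; exact: sd.
- have p1n0 : p - 1 != 0 by lra.
  exists (p * (p - 1) * 2 `^ p), (p - 1)^-1; split.
  + by rewrite !mulr_ge0//; lra.
  + by apply/andP; split; [rewrite invr_gt0|rewrite invf_le1]; lra.
  move=> r s y r01 s0 y01; rewrite (le_trans (key _ _ r01 s0))// lerD2l.
  have /andP[r0 r1] := r01; have /andP[y0 y1] := y01.
  have t0 : 0 <= 1 + r * (s - 1) by nra.
  set k := (p - 1)^-1; rewrite -!mulrA ler_wpM2l//.
  (* If [r > y `^ k] then [r `^ (p - 2) >= y `^ (1 - k)]. *)
  have r2 : r ^+ 2 <= y `^ k * r + y `^ (k - 1) * r `^ p.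
    have yk0 : 0 < y `^ k by exact: powR_gt0.
    have [ryk|ykr] := leP r (y `^ k).
      apply: (@le_trans _ _ (y `^ k * r)); first by rewrite expr2 ler_wpM2r.
      by rewrite lerDl mulr_ge0// powR_ge0.
    apply: (@le_trans _ _ (y `^ (k - 1) * r `^ p)); last first.
      by rewrite lerDr mulr_ge0// powR_ge0.
    have -> : k - 1 = - (1 - k) by ring.
    rewrite powRN mulrC ler_pdivlMr ?powR_gt0//.
    have -> : r `^ p = r ^+ 2 * r `^ (p - 2).
      rewrite -powR_mulrn// -powRD; first by congr (_ `^ _); ring.
      by rewrite (gt_eqF (lt_trans yk0 ykr)) implybT.
    rewrite ler_wpM2l ?exprn_ge0//.
    have -> : 1 - k = k * (p - 2) by rewrite /k; field.
    by rewrite powRrM; apply: ge0_ler_powR; rewrite ?nnegrE ?powR_ge0//; lra.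
  have c1 : 1 <= 1 + s by lra.
  have tc : 1 + r * (s - 1) <= 1 + s by nra.
  have q1 : 1 < p - 1 by lra.
  have := powR_dist1_le q1 t0 c1 tc; rewrite [_ + _ - 1]addrAC subrr add0r => h.
  rewrite (le_trans (ler_norm _))// mulrA normrM (le_trans (ler_wpM2l _ h))//.
  have -> : p - 1 - 1 = p - 2 by ring.
  have -> : `|r * (s - 1)| * ((p - 1) * `|r * (s - 1)| * (1 + s) `^ (p - 2)) =
    (p - 1) * (r ^+ 2 * (`|s - 1| ^+ 2 * (1 + s) `^ (p - 2))).
    by rewrite normrM (ger0_norm r0); ring.
  rewrite ler_wpM2l; [by []|lra|].
  apply: (@le_trans _ _ (r ^+ 2 * (2 `^ p * (1 + s `^ p)))).
    rewrite ler_wpM2l ?exprn_ge0//.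
    rewrite (le_trans _ (powR_add1_le p1 s0))//.
    apply: (@le_trans _ _ ((1 + s) ^+ 2 * (1 + s) `^ (p - 2))).
      rewrite ler_wpM2r ?powR_ge0//.
      by rewrite lerXn2r ?nnegrE ?normr_ge0//; [lra|exact: sd].
    rewrite -powR_mulrn; last by lra.
    rewrite -powRD; last by rewrite (_ : (1 + s == 0) = false) ?implybT//; apply: gt_eqF; lra.
    by rewrite le_eqVlt; apply/orP; left; apply/eqP; congr (_ `^ _); ring.
  rewrite mulrC -!mulrA ler_wpM2l// ler_wpM2l// addr_ge0// powR_ge0//.
Qed.

(** Expansion of the [p]-th power of the total weight [x] when the piece of
    weight [b] is replaced by two pieces of joint weight [b * s].  The
    first-order term [p * (x `^ (p - 1) * b) * (s - 1)], which averages to zero,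
    is split over both sides so that all functions to be integrated are
    nonnegative.  The parameter [y] is to be chosen as a bound on the mean of
    the sum of the [p]-th powers: the two error terms then have the same size
    [y `^ k].  The estimate follows from the case [x = 1] by homogeneity. *)
Lemma fragmentation_powR p : 1 < p ->
  exists C k : R, [/\ 0 <= C, 0 < k <= 1 &
  forall x b s y, 0 <= b <= x -> 0 <= s -> 0 < y <= 1 ->
    (x + b * (s - 1)) `^ p + p * (x `^ (p - 1) * b) <=
    x `^ p + p * (x `^ (p - 1) * b) * s +
    C * (1 + s `^ p) * (y `^ k * (x `^ (p - 1) * b) + y `^ (k - 1) * b `^ p)].
Proof.
move=> p1; have [C [k [C0 k01 H]]] := fragmentation_powR_unit p1.
exists C, k; split=> // x b s y /andP[b0 bx] s0 y01.
have [x0|x0] := ltP 0 x; last first.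
  have -> : x = 0 by lra.
  have -> : b = 0 by lra.
  have -> : (0 : R) `^ p = 0 by rewrite powR0//; lra.
  by rewrite !(mul0r, mulr0, addr0) powR0//; lra.
set r := b / x.
have bE : b = r * x by rewrite /r mulfVK// gt_eqF.
have r01 : 0 <= r <= 1.
  by rewrite divr_ge0 ?(ltW x0)//= ler_pdivrMr// mul1r.
have := H r s y r01 s0 y01; rewrite -(ler_pM2l (powR_gt0 p x0)).
have -> : x + b * (s - 1) = x * (1 + r * (s - 1)) by rewrite bE; ring.
rewrite powRM ?(ltW x0)//; last by have /andP[? ?] := r01; nra.
have -> : b `^ p = r `^ p * x `^ p.
  by rewrite bE powRM ?(ltW x0)//; have /andP[] := r01.
have -> : x `^ (p - 1) * b = x `^ p * r.
  by rewrite bE -(powR_mulB1 (ltW x0) p1); ring.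
by move=> h; rewrite (le_trans (le_trans _ h)); [by []|lra|lra].
Qed.

(** Bernoulli's inequality for an exponent below [1], read off the tangent at
    [1] of the convex function with the inverse exponent. *)
Lemma powR_bernoulli k t : 0 < k <= 1 -> 0 <= t <= 1 -> (1 - t) `^ k <= 1 - k * t.
Proof.
move=> /andP[k0 k1] /andP[t0 t1].
have [->|kn1] := eqVneq k 1; first by rewrite powRr1 ?mul1r// subr_ge0.
have k1' : k < 1 by rewrite lt_neqAle kn1.
have kV1 : 1 < k^-1 by rewrite invf_gt1.
have kVk : k^-1 * k = 1 by rewrite mulVf ?gt_eqF.
have := powR_tangent kV1 (powR_ge0 (1 - t) k) ler01.
rewrite !powR1 -powRrM mulfV ?gt_eqF// powRr1 ?subr_ge0//.
rewrite -(ler_pM2l k0).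
set a := (1 - t) `^ k; set v := k^-1 in kVk *.
have kva : k * (v * a) = a by rewrite mulrA (mulrC k) kVk mul1r.
by nra.
Qed.

End PowerInequalities.

Lemma cvgn_powR (R : realType) (u : nat -> R) (l p : R) : 0 < p ->
  (forall n, 0 <= u n) -> u n @[n --> \oo] --> l ->
  u n `^ p @[n --> \oo] --> l `^ p.
Proof.
move=> p0 u0 ul; have l0 : 0 <= l by apply: (cvgr_to_ge ul); exact: nearW.
have [l0'|l0'] := ltP 0 l.
  have [/derivable1_diffP/differentiable_continuous lc _] := is_derive1_powR p l0'.
  exact: (cvg_comp _ _ ul lc).
have -> : l = 0 by apply/eqP; rewrite eq_le l0 l0'.
rewrite powR0 ?gt_eqF//; apply/cvgrPdist_le => e e0.
have ep : 0 < e `^ p^-1 by exact: powR_gt0.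
move/cvgrPdist_le : ul => /(_ _ ep); apply: filterS => n.
have -> : l = 0 by apply/eqP; rewrite eq_le l0 l0'.
rewrite !sub0r !normrN !ger0_norm ?powR_ge0// => une.
apply: (@le_trans _ _ ((e `^ p^-1) `^ p)).
  by apply: ge0_ler_powR; rewrite ?nnegrE//; exact: ltW.
by rewrite -powRrM mulVf ?gt_eqF// powRr1// ltW.
Qed.

Lemma measurable_powR_comp d (T : measurableType d) (R : realType) (h : T -> R) s :
  measurable_fun setT h -> measurable_fun setT (fun w => h w `^ s).
Proof. by move=> mh; exact: measurableT_comp (@measurable_powR R s) mh. Qed.

(** * Independence *)

Section Independence.
Context d (T : measurableType d) (R : realType) (P : probability T R).

(** Dynkin's argument: in [A], both sides are finite measures, and they agree
    on a generating system that is stable under intersection. *)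
Lemma pi_system_product_rule (G : set (set T)) (B : set T) :
  setI_closed G -> G `<=` measurable -> measurable B ->
  (forall A, G A -> P (A `&` B) = (P A * P B)%E) ->
  forall A, <<s G >> A -> P (A `&` B) = (P A * P B)%E.
Proof.
move=> GI Gm mB GB A sGA.
have PB0 : 0 <= fine (P B) by rewrite fine_ge0.
have PBE : P B = (fine (P B))%:E by rewrite fineK// fin_num_measure.
pose m1 := mrestr P mB; pose m2 := mscale (NngNum PB0) P.
have m1E X : m1 X = P (X `&` B) by [].
have m2E X : m2 X = (P B * P X)%E by rewrite PBE.
suff : m1 A = m2 A by rewrite m1E m2E muleC.
have HG : [set X | G X /\ X `<=` setT] = G by apply/seteqP; split => [X []|X].
apply: (@g_sigma_algebra_measure_unique_trace d R T G setT measurableT).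
- by rewrite HG.
- by rewrite HG.
- by change (m1 setT = m2 setT); rewrite m1E m2E setTI probability_setT mule1.
- rewrite HG => X /GB XB; change (m1 X = m2 X).
  by rewrite m1E m2E XB muleC.
- change (m1 setT < +oo)%E; rewrite m1E setTI.
  exact: (le_lt_trans (probability_le1 P mB) (ltry _)).
- by [].
- by rewrite HG.
Qed.

Context (K : eqType) (D : set K) (F : K -> set (set T)).
Hypothesis FI : forall i, setI_closed (F i).
Hypothesis FT : forall i, F i setT.
Hypothesis Fm : forall i, F i `<=` measurable.
Hypothesis indepF : mutually_independent P D F.

Definition finite_intersections (E : set K) : set (set T) :=
  [set A | exists (J : seq K) (B : K -> set T),
     [/\ uniq J, (forall i, i \in J -> E i /\ F i (B i)) &
         A = \bigcap_(i in [set` J]) B i]].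

Lemma finite_intersectionsI E : setI_closed (finite_intersections E).
Proof.
move=> _ _ [J [B [uJ EB ->]]] [J' [B' [uJ' EB' ->]]].
pose C i := (if i \in J then B i else setT) `&` (if i \in J' then B' i else setT).
exists (undup (J ++ J')), C; split; first exact: undup_uniq.
- move=> i; rewrite mem_undup mem_cat => iJJ'; split.
    by case/orP: iJJ' => [/EB[]|/EB'[]].
  by apply: FI; [case: ifPn => [/EB[]|_]|case: ifPn => [/EB'[]|_]].
- apply/seteqP; split=> [w [wB wB'] i /= _|w wC].
    by rewrite /C; split; [case: ifPn => [/wB|_]|case: ifPn => [/wB'|_]].
  split=> i /= iJ.
  + have : i \in undup (J ++ J') by rewrite mem_undup mem_cat iJ.
    by move=> /wC[]; rewrite iJ.
  + have : i \in undup (J ++ J') by rewrite mem_undup mem_cat iJ orbT.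
    by move=> /wC[_]; rewrite iJ.
Qed.

Lemma finite_intersections_measurable E :
  finite_intersections E `<=` measurable.
Proof.
move=> _ [J [B [_ EB ->]]]; apply: fin_bigcap_measurable => [|i /= /EB[_]].
  exact: finite_seq.
exact: Fm.
Qed.

Lemma sub_finite_intersections E :
  \bigcup_(i in E) F i `<=` finite_intersections E.
Proof.
move=> A [i Ei FA]; exists [:: i], (fun=> A); split => //.
  by move=> j; rewrite inE => /eqP ->.
by apply/seteqP; split=> [w Aw j //|w]; apply; exact: mem_head.
Qed.

(** Two sub-families without common index generate independent
    sigma-algebras.  The product rule holds by hypothesis for finite
    intersections, and passes to the generated sigma-algebras one argument at a
    time. *)
Lemma independent_generated (E1 E2 : set K) (A B : set T) :
  E1 `<=` D -> E2 `<=` D -> [disjoint E1 & E2] ->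
  <<s \bigcup_(i in E1) F i >> A -> <<s \bigcup_(i in E2) F i >> B ->
  P (A `&` B) = (P A * P B)%E.
Proof.
move=> E1D E2D /eqP E12 sA sB.
have sub E : <<s \bigcup_(i in E) F i >> `<=` <<s finite_intersections E >>.
  by apply: sub_sigma_algebra2; exact: sub_finite_intersections.
have sm E : <<s finite_intersections E >> `<=` measurable.
  apply: smallest_sub; first exact: sigma_algebra_measurable.
  exact: finite_intersections_measurable.
have mB : measurable B := sm _ _ (sub _ _ sB).
apply: (pi_system_product_rule (@finite_intersectionsI E1) _ mB _ (sub _ _ sA)).
  exact: finite_intersections_measurable.
move=> {A sA} A rA; rewrite setIC muleC.
have mA := finite_intersections_measurable rA.
apply: (pi_system_product_rule (@finite_intersectionsI E2) _ mA _ (sub _ _ sB)).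
  exact: finite_intersections_measurable.
move=> {B sB mB} _ [J2 [B2 [u2 EB2 ->]]].
case: rA => J1 [B1 [u1 EB1 ->]].
have J12 i : i \in J2 -> i \notin J1.
  move=> i2; apply/negP => i1.
  have : (E1 `&` E2) i by split; [exact: (EB1 i i1).1|exact: (EB2 i i2).1].
  by rewrite E12.
pose C i := if i \in J1 then B1 i else B2 i.
have CJ1 i : i \in J1 -> B1 i = C i by rewrite /C => ->.
have CJ2 i : i \in J2 -> B2 i = C i by move=> /J12 /negPf h; rewrite /C h.
have indep J := @indepF J C.
transitivity (P (\bigcap_(i in [set` J2 ++ J1]) C i)).
  congr (P _); apply/seteqP; split=> [w [w2 w1] i /=|w wC].
    rewrite mem_cat => /orP[i2|i1]; first by rewrite -CJ2//; exact: w2.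
    by rewrite -CJ1//; exact: w1.
  split=> i /= iJ; [rewrite CJ2//|rewrite CJ1//]; apply: wC => /=;
    by rewrite mem_cat iJ ?orbT.
rewrite indep; last 2 first.
- by rewrite cat_uniq u1 u2/= andbT; apply/hasPn => i i1; apply/negP => /J12 /negP.
- move=> i; rewrite mem_cat => /orP[i2|i1].
    by rewrite -CJ2//; have [/E2D ? ?] := EB2 _ i2.
  by rewrite -CJ1//; have [/E1D ? ?] := EB1 _ i1.
rewrite big_cat/=; congr (_ * _)%E.
- rewrite -indep//; last first.
    by move=> i i2; rewrite -CJ2//; have [/E2D ? ?] := EB2 _ i2.
  by congr (P _); apply: eq_bigcapr => i /= /CJ2.
- rewrite -indep//; last first.
    by move=> i i1; rewrite -CJ1//; have [/E1D ? ?] := EB1 _ i1.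
  by congr (P _); apply: eq_bigcapr => i /= /CJ1.
Qed.

End Independence.

Section ProductRule.
Context d (T : measurableType d) (R : realType) (P : probability T R).

Definition independent_funs (f g : T -> R) :=
  forall A B : set R, measurable A -> measurable B ->
  P (f @^-1` A `&` g @^-1` B) = (P (f @^-1` A) * P (g @^-1` B))%E.

Variables f g : T -> R.
Hypothesis mf : measurable_fun setT f.
Hypothesis mg : measurable_fun setT g.
Hypothesis fg : independent_funs f g.

Let X : {mfun T >-> R} :=
  MeasurableFun.Pack (MeasurableFun.Class (isMeasurableFun.Build _ _ _ _ _ mf)).
Let Y : {mfun T >-> R} :=
  MeasurableFun.Pack (MeasurableFun.Class (isMeasurableFun.Build _ _ _ _ _ mg)).
Let XY : {mfun T >-> (R * R)%type} :=
  MeasurableFun.Pack (MeasurableFun.Class (isMeasurableFun.Build _ _ _ _ _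
    (measurable_fun_pair mf mg))).

(* Independence says exactly that the joint law is the product of the
   marginal laws, so that Fubini applies. *)
Let joint_law C : measurable C ->
  (distribution P X \x distribution P Y)%E C = distribution P XY C.
Proof.
apply: product_measure_unique => A B mA mB.
exact: fg.
Qed.

Let xy (z : R * R) : \bar R := (z.1 * z.2)%:E.

Let mxy : measurable_fun setT xy.
Proof.
apply/measurable_EFinP; apply: measurable_funM.
  exact: measurable_fst.
exact: measurable_snd.
Qed.

Lemma integral_mul_independent : (forall w, 0 <= f w) -> (forall w, 0 <= g w) ->
  (\int[P]_w (f w * g w)%:E = \int[P]_w (f w)%:E * \int[P]_w (g w)%:E)%E.
Proof.
move=> f0 g0.
pose h (z : R * R) : \bar R := (`|z.1| * `|z.2|)%:E.
have mh : measurable_fun setT h.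
  apply/measurable_EFinP; apply: measurable_funM.
    by apply: measurableT_comp => //; exact: measurable_fst.
  by apply: measurableT_comp => //; exact: measurable_snd.
have h0 z : (0 <= h z)%E by rewrite lee_fin mulr_ge0.
have mn : measurable_fun setT ((fun x : R => `|x|%:E) : R -> \bar R).
  by apply/measurable_EFinP; exact: normr_measurable.
transitivity (\int[distribution P XY]_z h z)%E.
  rewrite ge0_integral_distribution//; apply: eq_integral => w _.
  by rewrite /h/= !ger0_norm.
transitivity (\int[distribution P X \x distribution P Y]_z h z)%E.
  by apply: eq_measure_integral => A mA _; [exact: joint_law || exact: esym (joint_law mA)].
rewrite fubini_tonelli1//= /fubini_F.
under eq_integral => x _.
  rewrite (_ : (fun y => h (x, y)) = (fun y => `|x|%:E * `|y|%:E)%E)//.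
  rewrite ge0_integralZl_EFin//; over.
rewrite ge0_integralZr//; last exact: integral_ge0.
rewrite !ge0_integral_distribution//.
by congr (_ * _)%E; apply: eq_integral => w _ /=; rewrite ger0_norm.
Qed.

Lemma integral_mul_centered : P.-integrable setT (EFin \o f) ->
  P.-integrable setT (EFin \o g) -> (\int[P]_w (g w)%:E = 0)%E ->
  (\int[P]_w (f w * g w)%:E = 0)%E.
Proof.
move=> fi gi g0.
have gi' : (distribution P Y).-integrable setT (EFin \o (fun y : R => y)).
  by apply: integrable_pushforward => //; exact/measurable_EFinP.
have mn : measurable_fun setT ((fun x : R => `|x|%:E) : R -> \bar R).
  by apply/measurable_EFinP; exact: normr_measurable.
have fgi : (distribution P X \x distribution P Y)%E.-integrable setT xy.
  apply/integrable12ltyP => //=.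
  under eq_integral => x _.
    under eq_integral do rewrite /xy normrM EFinM.
    rewrite ge0_integralZl_EFin//; over.
  rewrite ge0_integralZr//; last exact: integral_ge0.
  rewrite !ge0_integral_distribution//.
  move/integrableP : fi => [_ fi]; move/integrableP : gi => [_ gi].
  apply: lte_mul_pinfty; [|rewrite ge0_fin_numE; [exact: fi|]|exact: gi];
    by apply: integral_ge0 => w _ /=; rewrite lee_fin.
transitivity (\int[distribution P XY]_z xy z)%E.
  rewrite integral_distribution//=.
  have : (distribution P XY).-integrable setT xy.
    move/integrableP : fgi => [_ fgi]; apply/integrableP; split => //.
    apply: le_lt_trans fgi; rewrite le_eqVlt; apply/orP; left; apply/eqP.
    by apply: eq_measure_integral => A mA _; [exact: joint_law || exact: esym (joint_law mA)].
  move/integrableP => [_]; rewrite ge0_integral_distribution//; last first.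
    exact: measurableT_comp.
  move=> h; apply/integrableP; split => //; apply/measurable_EFinP.
  exact: measurable_funM.
transitivity (\int[distribution P X \x distribution P Y]_z xy z)%E.
  by apply: eq_measure_integral => A mA _; [exact: joint_law || exact: esym (joint_law mA)].
rewrite -integral12_prod_meas1// /fubini_F.
rewrite integral0_eq// => x _ /=.
under eq_integral do rewrite /xy EFinM.
rewrite integralZl// integral_distribution//=; last exact/measurable_EFinP.
by rewrite g0 mule0.
Qed.

End ProductRule.

(** * Means of real functions *)

Section NonnegativeMeans.
Context d (T : measurableType d) (R : realType) (P : probability T R).
Implicit Types f g : T -> R.

Lemma mean_ge0 f : (forall w, 0 <= f w) -> (0 <= \int[P]_w (f w)%:E)%E.
Proof. by move=> f0; apply: integral_ge0 => w _; rewrite lee_fin. Qed.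

Lemma meanD f g : measurable_fun setT f -> measurable_fun setT g ->
  (forall w, 0 <= f w) -> (forall w, 0 <= g w) ->
  (\int[P]_w (f w + g w)%:E = \int[P]_w (f w)%:E + \int[P]_w (g w)%:E)%E.
Proof.
move=> mf mg f0 g0; rewrite -ge0_integralD//.
- by move=> w _; rewrite lee_fin.
- exact/measurable_EFinP.
- by move=> w _; rewrite lee_fin.
- exact/measurable_EFinP.
Qed.

Lemma meanZ k f : measurable_fun setT f -> (forall w, 0 <= f w) -> 0 <= k ->
  (\int[P]_w (k * f w)%:E = k%:E * \int[P]_w (f w)%:E)%E.
Proof.
move=> mf f0 k0; rewrite -ge0_integralZl_EFin//.
- by move=> w _; rewrite lee_fin.
- exact/measurable_EFinP.
Qed.

Lemma mean_sum (l : seq nat) (f : nat -> T -> R) :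
  (forall k, measurable_fun setT (f k)) -> (forall k w, 0 <= f k w) ->
  (\int[P]_w (\sum_(k <- l) f k w)%:E = \sum_(k <- l) \int[P]_w (f k w)%:E)%E.
Proof.
move=> mf f0; rewrite -ge0_integral_sum//.
- by apply: eq_integral => w _; rewrite sumEFin.
- by move=> k; apply/measurable_EFinP.
- by move=> k w _; rewrite lee_fin.
Qed.

Lemma mean_le f g : measurable_fun setT f -> measurable_fun setT g ->
  (forall w, 0 <= f w <= g w) -> (\int[P]_w (f w)%:E <= \int[P]_w (g w)%:E)%E.
Proof.
move=> mf mg fg; apply: ge0_le_integral => //.
- by move=> w _; rewrite lee_fin; have /andP[] := fg w.
- exact/measurable_EFinP.
- exact/measurable_EFinP.
- by move=> w _; rewrite lee_fin; have /andP[] := fg w.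
Qed.

Lemma mean_cst (k : R) : (\int[P]_w k%:E = k%:E)%E.
Proof. by rewrite -[RHS](expectation_cst P k) unlock. Qed.

Lemma mean_le_cst f (k : R) : measurable_fun setT f ->
  (forall w, 0 <= f w <= k) -> (\int[P]_w (f w)%:E <= k%:E)%E.
Proof. by move=> mf fk; rewrite -[leRHS]mean_cst; exact: mean_le. Qed.

End NonnegativeMeans.

Section LimitsOfMeans.
Context d (T : measurableType d) (R : realType) (P : probability T R).

Lemma mean_ae_eq (f g : T -> R) : measurable_fun setT f -> measurable_fun setT g ->
  {ae P, forall w, f w = g w} ->
  (\int[P]_w (f w)%:E = \int[P]_w (g w)%:E)%E.
Proof.
move=> mf mg fg; apply: ae_eq_integral => //.
- exact/measurable_EFinP.
- exact/measurable_EFinP.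
- by apply: filterS fg => w fgw _; rewrite fgw.
Qed.

Lemma mean_fatou (f_ : nat -> T -> R) (f : T -> R) (c : \bar R) :
  (forall n, measurable_fun setT (f_ n)) -> measurable_fun setT f ->
  (forall n w, 0 <= f_ n w) ->
  {ae P, forall w, f_ n w @[n --> \oo] --> f w} ->
  (\forall n \near \oo, (\int[P]_w (f_ n w)%:E <= c)%E) ->
  (\int[P]_w (f w)%:E <= c)%E.
Proof.
move=> mf_ mf f0 cvgf fc.
have mF n : measurable_fun setT (fun w => (f_ n w)%:E) by exact/measurable_EFinP.
have F0 n w : setT w -> (0 <= (f_ n w)%:E)%E by rewrite lee_fin.
apply: (@le_trans _ _ (\int[P]_w limn_einf (fun n => (f_ n w)%:E))%E).
  rewrite le_eqVlt; apply/orP; left; apply/eqP.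
  apply: ae_eq_integral => //.
  - exact/measurable_EFinP.
  - rewrite /limn_einf; apply: measurableT_comp => //.
    by apply: measurable_fun_limn_esup => n; exact: measurableT_comp.
  - apply: filterS cvgf => w fw _.
    have /cvg_limn_einf_sup[-> _] // : (f_ n w)%:E @[n --> \oo] --> (f w)%:E.
    by apply: cvg_EFin => //; exact: nearW.
apply: (le_trans (fatou P measurableT mF F0)).
apply: (le_trans (limn_einf_sup _)); rewrite limn_esup_lim.
apply: lime_le; first exact: is_cvg_esups.
case: fc => N _ fc; exists N => // n /= Nn.
by apply: ub_ereal_sup => _ [k /= nk <-]; apply: fc => /=; exact: leq_trans Nn nk.
Qed.

Lemma mean_bounded_cvg (f_ : nat -> T -> R) (f : T -> R) (K : R) :
  (forall n, measurable_fun setT (f_ n)) -> measurable_fun setT f ->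
  (forall n w, `|f_ n w| <= K) ->
  {ae P, forall w, f_ n w @[n --> \oo] --> f w} ->
  (\int[P]_w (f_ n w)%:E)%E @[n --> \oo] --> (\int[P]_w (f w)%:E)%E.
Proof.
move=> mf_ mf fK cvgf.
have [] := @dominated_convergence _ _ _ P setT measurableT
  (fun n w => (f_ n w)%:E) (fun w => (f w)%:E) (cst K%:E) => //.
- by move=> n; exact/measurable_EFinP.
- exact/measurable_EFinP.
- apply: filterS cvgf => w fw _; apply: cvg_EFin => //; exact: nearW.
- exact: finite_measure_integrable_cst.
- by apply: aeW => w n _; rewrite lee_fin.
Qed.

(** Dominated convergence along the levels [k%:R], with [f] itself as the
    dominating function. *)
Lemma mean_tail (f : T -> R) (e : R) : measurable_fun setT f ->
  (forall w, 0 <= f w) -> (\int[P]_w (f w)%:E < +oo)%E -> 0 < e ->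
  exists2 A : R, 0 < A & (\int[P]_w (f w - Num.min (f w) A)%:E <= e%:E)%E.
Proof.
move=> mf f0 fin e0.
have fi : P.-integrable setT (fun w => (f w)%:E).
  apply/integrableP; split; first exact/measurable_EFinP.
  by under eq_integral do rewrite gee0_abs ?lee_fin//.
have mk k : measurable_fun setT (fun w => f w - Num.min (f w) k%:R).
  by apply: measurable_funB => //; exact: measurable_minr.
have [] := @dominated_convergence _ _ _ P setT measurableT
  (fun k w => (f w - Num.min (f w) k%:R)%:E) (cst 0%E) (fun w => (f w)%:E) => //.
- by move=> k; exact/measurable_EFinP.
- apply: aeW => w _; apply: cvg_near_cst.
  exists (Num.truncn (f w)).+1 => // k /= fk.
  have fwk : f w <= k%:R.
    by apply: ltW; apply: lt_le_trans (truncnS_gt _) _; rewrite ler_nat.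
  by rewrite (min_idPl fwk) subrr.
- apply: aeW => w k _; rewrite gee0_abs lee_fin.
    by rewrite gerBl le_min f0 ler0n.
  by rewrite subr_ge0 ge_min lexx.
move=> _ _; rewrite integral_cst//= mul0e => cvg0.
have : (\int[P]_w (f w - Num.min (f w) k%:R)%:E)%E @[k --> \oo] --> 0%E by [].
move/fine_cvgP => [fi2 /cvgrPdist_le /(_ _ e0)].
move=> /(filterI fi2) [N _ HN].
exists N.+1%:R; first by rewrite ltr0n.
have [/= ffin] := HN N.+1 (leqnSn N).
rewrite sub0r normrN => h; rewrite -(fineK ffin) lee_fin.
exact: le_trans (ler_norm _) h.
Qed.

Lemma bounded_integrable (f : T -> R) (K : R) : measurable_fun setT f ->
  (forall w, `|f w| <= K) -> P.-integrable setT (EFin \o f).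
Proof.
move=> mf fK.
have iK : P.-integrable setT (EFin \o (cst K : T -> R)).
  exact: finite_measure_integrable_cst.
apply: (le_integrable measurableT _ _ iK).
  exact/measurable_EFinP.
move=> w _ /=; rewrite lee_fin (le_trans (fK w))//.
exact: ler_norm.
Qed.

End LimitsOfMeans.

Section EqualLaws.
Context d1 (T1 : measurableType d1) d2 (T2 : measurableType d2) (R : realType).
Context (P1 : probability T1 R) (P2 : probability T2 R).
Context (Y1 : {RV P1 >-> R}) (Y2 : {RV P2 >-> R}).

(** The half-lines [`]-oo, x]] are stable under intersection and generate the
    Borel sets. *)
Lemma cdf_determines_law : cdf Y1 =1 cdf Y2 -> same_law Y1 Y2.
Proof.
move=> YY A mA.
pose G : set (set R) := [set B | exists x : R, B = `]-oo, x]%classic].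
have GI : setI_closed G.
  move=> _ _ [x ->] [y ->]; exists (Num.min x y).
  by apply/seteqP; split=> z /=; rewrite !in_itv/= le_min; [move=> [-> ->]|move=> /andP[]].
have mG : G `<=` measurable by move=> _ [x ->]; exact: measurable_itv.
have sG : <<s G >> A.
  have : (@ocitv R).-sigma.-measurable A := mA.
  rewrite RGenOInfty.measurableE; apply: smallest_sub.
    exact: smallest_sigma_algebra.
  move=> _ [x ->]; rewrite -setCitvl.
  have [_ GC _] := smallest_sigma_algebra setT G.
  by rewrite -setTD; apply: GC; apply: sub_sigma_algebra; exists x.
have HG : [set B | G B /\ B `<=` setT] = G by apply/seteqP; split => [B []|B].
apply: (@g_sigma_algebra_measure_unique_trace _ R _ G setT measurableT) => //.
- by rewrite HG.
- by rewrite HG.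
- exact: etrans (probability_setT (distribution P1 Y1))
    (esym (probability_setT (distribution P2 Y2))).
- by rewrite HG => _ [x ->]; exact: YY.
- exact: le_lt_trans (probability_le1 (distribution P1 Y1) measurableT) (ltry _).
- by rewrite HG.
Qed.

Lemma same_law_mean (h : R -> R) : same_law Y1 Y2 -> measurable_fun setT h ->
  (forall x, 0 <= h x) ->
  (\int[P1]_w (h (Y1 w))%:E = \int[P2]_w (h (Y2 w))%:E)%E.
Proof.
move=> YY mh h0.
have mh' : measurable_fun setT (fun x => (h x)%:E) by exact/measurable_EFinP.
have h0' x : (0 <= (h x)%:E)%E by rewrite lee_fin.
transitivity (\int[distribution P1 Y1]_x (h x)%:E)%E.
  by rewrite ge0_integral_distribution.
transitivity (\int[distribution P2 Y2]_x (h x)%:E)%E.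
  by apply: eq_measure_integral => A mA _; exact: YY.
by rewrite ge0_integral_distribution.
Qed.

Lemma same_law_bounded_mean (h : R -> R) (K : R) : same_law Y1 Y2 ->
  measurable_fun setT h -> (forall x, `|h x| <= K) ->
  (\int[P1]_w (h (Y1 w))%:E = \int[P2]_w (h (Y2 w))%:E)%E.
Proof.
move=> YY mh hK.
have mh' : measurable_fun setT (fun x => (h x)%:E) by exact/measurable_EFinP.
transitivity (\int[distribution P1 Y1]_x (h x)%:E)%E.
  rewrite integral_distribution//.
  by apply: (@bounded_integrable _ _ _ _ _ K) => //; exact: measurableT_comp.
transitivity (\int[distribution P2 Y2]_x (h x)%:E)%E.
  by apply: eq_measure_integral => A mA _; exact: YY.
rewrite integral_distribution//.
by apply: (@bounded_integrable _ _ _ _ _ K) => //; exact: measurableT_comp.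
Qed.

End EqualLaws.

Lemma cvgn_minl (R : realType) (u : nat -> R) (l A : R) :
  u n @[n --> \oo] --> l -> Num.min (u n) A @[n --> \oo] --> Num.min l A.
Proof.
move=> /cvgrPdist_le ul; apply/cvgrPdist_le => e /ul; apply: filterS => n.
apply: le_trans; have h1 := ler_norm (l - u n).
have h2 := ler_norm (u n - l); rewrite distrC in h2.
by case: (leP l A) => lA; case: (leP (u n) A) => uA;
  rewrite ler_norml; apply/andP; split; lra.
Qed.

(** * Tools for the law of large numbers *)

Section OrthogonalSums.
Context d (T : measurableType d) (R : realType) (P : probability T R).

(** The [C j] are centred, and each is independent of the coefficients and of
    the earlier terms, so the cross terms vanish when the square is expanded
    one term at a time.  Independence is required of the single product that
    occurs in the cross term. *)
Lemma orthogonal_sum_second_moment (c C : nat -> T -> R) (eta k : R) :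
  (forall j, measurable_fun setT (c j)) -> (forall j, measurable_fun setT (C j)) ->
  (forall j w, `|c j w| <= eta) -> (forall j w, `|C j w| <= k) ->
  (forall j, (0 < j)%N -> (\int[P]_w (C j w)%:E = 0)%E) ->
  (forall m, independent_funs P
    (fun w => (\sum_(1 <= j < m.+1) c j w * C j w) * c m.+1 w) (C m.+1)) ->
  forall m, (\int[P]_w ((\sum_(1 <= j < m.+1) c j w * C j w) ^+ 2)%:E <=
    (k ^+ 2)%:E * \sum_(1 <= j < m.+1) \int[P]_w (c j w ^+ 2)%:E)%E.
Proof.
move=> mc mC ceta Ck C0 ind m.
have eta0 : 0 <= eta by exact: le_trans (normr_ge0 _) (ceta 0%N point).
have k0 : 0 <= k by exact: le_trans (normr_ge0 _) (Ck 0%N point).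
pose S m w := \sum_(1 <= j < m.+1) c j w * C j w.
have mS n : measurable_fun setT (S n).
  by apply: measurable_sum => j; exact: measurable_funM.
have SB n w : `|S n w| <= n%:R * (eta * k).
  rewrite /S (le_trans (ler_norm_sum _ _ _))//.
  apply: (@le_trans _ _ (\sum_(1 <= j < n.+1) eta * k)).
    by apply: ler_sum => j _; rewrite normrM ler_pM.
  by rewrite sumr_const_nat subn1/= mulr_natl.
have cC2 j : (\int[P]_w ((c j w * C j w) ^+ 2)%:E <= (k ^+ 2)%:E * \int[P]_w (c j w ^+ 2)%:E)%E.
  have mc2 : measurable_fun setT (fun w => c j w ^+ 2) by exact: measurable_funX.
  rewrite -meanZ; [|exact: mc2|by move=> w; exact: sqr_ge0|exact: sqr_ge0].
  apply: mean_le => [||w].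
  - by apply: measurable_funX; exact: measurable_funM.
  - exact: measurable_funM.
  rewrite sqr_ge0/= exprMn mulrC ler_wpM2r ?sqr_ge0//.
  by rewrite -(real_normK (num_real (C j w))) lerXn2r ?nnegrE.
rewrite -/(S m); elim: m => [|m IH].
  rewrite big_geq// mule0 (eq_integral (cst 0%E)) ?integral_cst//= ?mul0e//.
  by move=> w _; rewrite /S big_geq// expr0n.
have SS w : S m.+1 w ^+ 2 = S m w ^+ 2 + ((c m.+1 w * C m.+1 w) ^+ 2 +
    2 * (S m w * c m.+1 w * C m.+1 w)).
  by rewrite /S big_nat_recr//=; ring.
have mf : measurable_fun setT (fun w => S m w * c m.+1 w) by exact: measurable_funM.
have fB w : `|S m w * c m.+1 w| <= m%:R * (eta * k) * eta.
  by rewrite normrM ler_pM.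
have cross : (\int[P]_w (S m w * c m.+1 w * C m.+1 w)%:E = 0)%E.
  apply: (integral_mul_centered mf (mC _) (ind m)); last exact: C0.
  - exact: bounded_integrable mf fB.
  - exact: bounded_integrable (mC _) (Ck _).
have mcr : measurable_fun setT (fun w => S m w * c m.+1 w * C m.+1 w).
  exact: measurable_funM.
have icr : P.-integrable setT (EFin \o (fun w => S m w * c m.+1 w * C m.+1 w)).
  apply: (@bounded_integrable _ _ _ _ _ (m%:R * (eta * k) * eta * k)) => //.
  by move=> w; rewrite normrM ler_pM.
have i2cr : P.-integrable setT (EFin \o (fun w => 2 * (S m w * c m.+1 w * C m.+1 w))).
  apply: (@bounded_integrable _ _ _ _ _ (2 * (m%:R * (eta * k) * eta * k))).
    exact: measurable_funM.
  by move=> w; rewrite normrM ger0_norm// ler_pM2l// normrM ler_pM.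
have icc : P.-integrable setT (EFin \o (fun w => (c m.+1 w * C m.+1 w) ^+ 2)).
  apply: (@bounded_integrable _ _ _ _ _ ((eta * k) ^+ 2)).
    by apply: measurable_funX; exact: measurable_funM.
  move=> w; rewrite ger0_norm ?sqr_ge0// -(real_normK (num_real (c _ _ * _))).
  by rewrite lerXn2r ?nnegrE ?mulr_ge0// normrM ler_pM.
have iS2 : P.-integrable setT (EFin \o (fun w => S m w ^+ 2)).
  apply: (@bounded_integrable _ _ _ _ _ ((m%:R * (eta * k)) ^+ 2)).
    exact: measurable_funX.
  move=> w; rewrite ger0_norm ?sqr_ge0// -(real_normK (num_real (S m w))).
  by rewrite lerXn2r ?nnegrE ?mulr_ge0.
rewrite (eq_integral (fun w => (S m w ^+ 2)%:E + (((c m.+1 w * C m.+1 w) ^+ 2)%:E +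
    (2 * (S m w * c m.+1 w * C m.+1 w))%:E))%E); last by move=> w _; rewrite SS.
rewrite integralD//; last exact: (integrableD measurableT icc i2cr).
rewrite integralD//.
have -> : (\int[P]_w (2 * (S m w * c m.+1 w * C m.+1 w))%:E = 0)%E.
  under eq_integral do rewrite EFinM.
  by rewrite integralZl// cross mule0.
rewrite adde0 big_nat_recr//= ge0_muleDr; last 2 first.
- by apply: sume_ge0 => j _; apply: mean_ge0 => w; exact: sqr_ge0.
- by apply: mean_ge0 => w; exact: sqr_ge0.
by apply: leeD.
Qed.

End OrthogonalSums.

Section Clipping.
Context {R : realType}.
Implicit Types K x : R.

Definition clip K x : R := Num.max (- K) (Num.min x K).

Lemma clip_le K x : 0 <= K -> `|clip K x| <= K.
Proof.
move=> K0; rewrite ler_norml /clip le_max lexx/= ge_max.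
by rewrite ge_min lexx orbT andbT; lra.
Qed.

(** The clipped-off part of [x] is the tail of [`|x|] above [K], whose mean is
    controlled by [mean_tail]. *)
Lemma clip_dist K x : 0 <= K -> `|x - clip K x| = `|x| - Num.min `|x| K.
Proof.
move=> K0; rewrite /clip.
have [x0|x0] := leP 0 x.
- rewrite (ger0_norm x0); have [xK|Kx] := leP x K.
    have -> : Num.max (- K) x = x by apply/max_idPr; lra.
    by rewrite !subrr normr0.
  have -> : Num.max (- K) K = K by apply/max_idPr; lra.
  by rewrite ger0_norm//; lra.
- have xK : x <= K by lra.
  rewrite (min_idPl xK) (ltr0_norm x0); have [h|h] := leP (- x) K.
    have -> : Num.max (- K) x = x by apply/max_idPr; lra.
    by rewrite !subrr normr0.
  have -> : Num.max (- K) x = - K by apply/max_idPl; lra.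
  by rewrite ler0_norm//; lra.
Qed.

Lemma measurable_clip K : measurable_fun setT (clip K).
Proof. by apply: measurable_maxr => //; exact: measurable_minr. Qed.

End Clipping.

Section Selection.
Context d (T : measurableType d) d' (T' : measurableType d').

Lemma measurable_fun_select (i : T -> nat) (u : nat -> T -> T') :
  measurable_fun setT i -> (forall k, measurable_fun setT (u k)) ->
  measurable_fun setT (fun w => u (i w) w).
Proof.
move=> mi mu _ A mA; rewrite setTI.
rewrite (_ : _ @^-1` A = \bigcup_k (i @^-1` [set k] `&` u k @^-1` A)).
  apply: bigcup_measurable => k _; apply: measurableI.
    by rewrite -[X in measurable X]setTI; exact: mi.
  by rewrite -[X in measurable X]setTI; exact: mu.
by apply/seteqP; split=> [w Aw|w [k _ [/= <-]]]//; exists (i w).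
Qed.

End Selection.

Section RandomIndex.
Context d (T : measurableType d) (R : realType) (P : probability T R).

(** Splitting according to the value of [N], the indices from [n0] on
    contribute at most [c] altogether, because their probabilities sum to at
    most [1]; the others are bounded by [C]. *)
Lemma random_index_mean_le (N : {RV P >-> nat}) (phi : nat -> T -> R) (c C : R)
    (n0 : nat) :
  (forall n, measurable_fun setT (phi n)) -> (forall n w, 0 <= phi n w <= C) ->
  (forall n, independent_funs P (phi n) (fun w => (N w == n)%:R)) ->
  0 <= c -> (forall n, (n0 <= n)%N -> (\int[P]_w (phi n w)%:E <= c%:E)%E) ->
  (\int[P]_w (phi (N w) w)%:E <=
   c%:E + C%:E * \sum_(0 <= n < n0) \int[P]_w ((N w == n)%:R)%:E)%E.
Proof.
move=> mphi phiC ind c0 phic.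
have C0 : 0 <= C by have /andP[h1 h2] := phiC 0%N point; exact: le_trans h1 h2.
have mN : measurable_fun setT (N : T -> nat) by exact: measurable_funP.
have mind n : measurable_fun setT (fun w => (N w == n)%:R : R).
  exact: (measurableT_comp (f := fun k : nat => (k == n)%:R : R)).
pose F n := N @^-1` [set n].
have mF n : measurable (F n) by exact: measurable_funPTI.
have tF : trivIset setT F by move=> m n _ _ [w [/= <- <-]].
have UF : \bigcup_n F n = setT by apply/seteqP; split=> // w _; exists (N w).
have mphiN : measurable_fun setT (fun w => phi (N w) w) by exact: measurable_fun_select.
pose g w : R := c + C * (N w < n0)%N%:R.
have mlt : measurable_fun setT (fun w => (N w < n0)%N%:R : R).
  exact: (measurableT_comp (f := fun k : nat => (k < n0)%N%:R : R)).
have mg : measurable_fun setT g.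
  by apply: measurable_funD => //; exact: measurable_funM.
have g0 w : 0 <= g w by rewrite addr_ge0// mulr_ge0.
have on_piece (h : T -> R) (k : T -> R) n : (forall w, F n w -> h w = k w) ->
    (\int[P]_(w in F n) (h w)%:E = \int[P]_w (k w * (N w == n)%:R)%:E)%E.
  move=> hk; rewrite integral_mkcond; apply: eq_integral => w _.
  rewrite patchE; case: ifPn => [/set_mem Fw|/negP Fw].
    by rewrite hk// (Fw : N w = n) eqxx mulr1.
  case: eqP => [Nw|_]; last by rewrite mulr0.
  by exfalso; apply: Fw; exact/mem_set.
apply: (@le_trans _ _ (\int[P]_w (g w)%:E)%E); last first.
  rewrite meanD//; last 2 first.
  - exact: measurable_funM.
  - by move=> w; rewrite mulr_ge0.
  rewrite mean_cst leeD2l// meanZ// lee_wpmul2l// -mean_sum//.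
  rewrite le_eqVlt; apply/orP; left; apply/eqP; apply: eq_integral => w _.
  congr EFin; have [Nn|Nn] := ltnP (N w) n0.
    rewrite (bigD1_seq (N w)) ?iota_uniq ?mem_index_iota//= eqxx big1 ?addr0//.
    by move=> j /negPf; rewrite eq_sym => ->.
  rewrite big_nat big1// => j /andP[_ jn]; case: eqP => // Nj.
  by move: jn; rewrite -Nj ltnNge Nn.
rewrite -UF !ge0_integral_bigcup//; last 4 first.
- by rewrite UF; exact/measurable_EFinP.
- by move=> w _; rewrite lee_fin.
- by rewrite UF; exact/measurable_EFinP.
- by move=> w _; rewrite lee_fin; have /andP[] := phiC (N w) w.
apply: lee_nneseries => [n _ _|n _].
  by apply: integral_ge0 => w _; rewrite lee_fin; have /andP[] := phiC (N w) w.
rewrite (on_piece _ (phi n)) => [|w <-//].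
rewrite (on_piece _ (fun=> c + C * (n < n0)%N%:R)) => [|w <-//].
have phi0 w : 0 <= phi n w by have /andP[] := phiC n w.
rewrite integral_mul_independent//.
rewrite meanZ ?addr_ge0 ?mulr_ge0// lee_wpmul2r//; first exact: mean_ge0.
have [nn|nn] := ltnP n n0; last by rewrite mulr0 addr0; exact: phic.
by rewrite mulr1; apply: mean_le_cst => // w; have /andP[-> h] := phiC n w;
  rewrite ler_wpDl.
Qed.

End RandomIndex.

(** Uniform continuity with only [v] confined to the segment: [u] may leave it
    by at most [rho].  This asymmetric form is what the comparison of
    [W_n] with the controlled quantity [m0 * M_n] needs. *)
Lemma continuous_uniform_on_segment (R : realType) (f : R -> R) (Q e : R) :
  continuous f -> 0 < e ->
  exists2 rho : R, 0 < rho & forall u v, `|v| <= Q -> `|u - v| <= rho ->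
    `|f u - f v| <= e.
Proof.
move=> cf e0.
have /compact_near_coveringP cov : compact `[- Q, Q]%classic.
  exact: segment_compact.
have e20 : 0 < e / 2 by rewrite divr_gt0.
have [|r /= r0 Hr] := cov R (0^'+)
    (fun rho v => forall u, `|u - v| <= rho -> `|f u - f v| <= e) _.
  move=> x _; have /cvgrPdist_le/(_ _ e20) := cf x.
  move=> /nbhs_ballP[r /= r0 xr].
  have r20 : 0 < r / 2 by rewrite divr_gt0.
  exists (ball x (r / 2), [set rho : R | rho < r / 2]) => /=.
    split; first exact: nbhsx_ballx.
    exact: nbhs_right_lt.
  move=> [v rho] /= [xv rhor] u uv.
  have fxv : `|f x - f v| <= e / 2.
    by apply: xr; apply: lt_trans xv _; lra.
  have fxu : `|f x - f u| <= e / 2.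
    apply: xr; rewrite /ball/= -(subrKA v) (le_lt_trans (ler_normD _ _))//.
    by rewrite (distrC v); move: xv; rewrite /ball/=; lra.
  rewrite -(subrKA (f x)) (le_trans (ler_normD _ _))//.
  by rewrite distrC; lra.
exists (r / 2) => [|u v vQ uv]; first by rewrite divr_gt0.
apply: (Hr (r / 2)) uv; [|by rewrite divr_gt0|].
  by rewrite /ball_/= sub0r normrN gtr0_norm ?divr_gt0//; lra.
by rewrite /= in_itv/= -ler_norml.
Qed.

(** * A decaying product *)

Section DecayingProduct.
Context {R : realType}.
Variable c : R.
Hypothesis c01 : 0 < c < 1.

(** For [c = 1 - E[L^s + R^s] > 0] this is the mean of the sum of the [s]-th
    powers of the [n] weights. *)
Definition decay (n : nat) : R := \prod_(1 <= k < n) (1 - c / k%:R).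

Lemma decayS n : (0 < n)%N -> decay n.+1 = decay n * (1 - c / n%:R).
Proof. by move=> n0; rewrite /decay big_nat_recr. Qed.

Lemma decay1 : decay 1 = 1.
Proof. by rewrite /decay big_geq. Qed.

Lemma decay_factor n : (0 < n)%N -> 0 < 1 - c / n%:R <= 1.
Proof.
move=> n0; have /andP[c0 c1] := c01; apply/andP; split.
  rewrite subr_gt0 ltr_pdivrMr ?ltr0n// mul1r (lt_le_trans c1)//.
  by rewrite ler1n.
by rewrite gerBl divr_ge0// ltW.
Qed.

Lemma decay_gt0 n : 0 < decay n.
Proof.
rewrite /decay big_seq; apply: prodr_gt0 => k.
by rewrite mem_index_iota => /andP[k0 _]; have /andP[] := decay_factor k0.
Qed.

Lemma decay_nonincreasing n : (0 < n)%N -> decay n.+1 <= decay n.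
Proof.
move=> n0; rewrite decayS// ger_pMr ?decay_gt0//.
by have /andP[] := decay_factor n0.
Qed.

Lemma decay_le1 n : (0 < n)%N -> decay n <= 1.
Proof.
elim: n => [//|[|n] IH _]; first by rewrite decay1.
by rewrite (le_trans (decay_nonincreasing _))// IH.
Qed.

(** Induction on [n], by [(1 - t) * (a + t) <= a] for [a >= 1] and
    [0 <= t <= 1]; together with the divergence of the harmonic series this
    makes the product vanish. *)
Lemma decay_harmonic n : decay n.+1 * (1 + c * series harmonic n) <= 1.
Proof.
have /andP[c0 c1] := c01.
elim: n => [|n IH].
  by rewrite decay1 /series/= big_geq// mulr0 addr0 mulr1.
rewrite decayS// seriesSr/= -mulrA; apply: le_trans IH.
rewrite ler_pM2l ?decay_gt0// /harmonic.
have H0 : 0 <= series harmonic n :> R.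
  by apply: sumr_ge0 => k _; exact: harmonic_ge0.
have t0 : 0 <= (n.+1%:R^-1 : R) by [].
rewrite (mulrDr c); set t := c / _.
have : 0 <= t by rewrite /t mulr_ge0// ltW.
have : 0 <= c * series harmonic n by rewrite mulr_ge0// ltW.
set u := c * _; nra.
Qed.

Lemma decay_cvg0 : decay n @[n --> \oo] --> 0.
Proof.
have /andP[c0 c1] := c01.
apply/cvgrPdist_le => e e0.
have [N [N0 Ne]] : exists N, (0 < N)%N /\ decay N <= e.
  apply: contrapT => H; apply: (@dvg_harmonic R).
  apply: nondecreasing_is_cvgn.
    by apply: nondecreasing_series => k _ _; exact: harmonic_ge0.
  exists (e^-1 / c) => _ [n _ <-].
  rewrite ler_pdivlMr// mulrC.
  have h1 : 1 + c * series harmonic n <= (decay n.+1)^-1.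
    by rewrite -[leRHS]mul1r ler_pdivlMr ?decay_gt0// mulrC decay_harmonic.
  have : (decay n.+1)^-1 <= e^-1.
    rewrite lef_pV2 ?posrE ?decay_gt0// leNgt; apply/negP => h.
    by apply: H; exists n.+1; split => //; exact: ltW.
  by lra.
exists N => // n /= Nn; rewrite sub0r normrN gtr0_norm ?decay_gt0//.
apply: le_trans Ne; rewrite -(subnKC Nn); elim: (n - N)%N => [|k IH].
  by rewrite addn0.
by rewrite addnS (le_trans (decay_nonincreasing _))// addn_gt0 N0.
Qed.

(** Summing over [n] telescopes the right-hand side: the series of the
    [decay n `^ k / n%:R] converges even though the harmonic series does not,
    and by Bernoulli's inequality it is at most [1 / (c * k)]. *)
Lemma powR_decay_telescope (k : R) n : 0 < k <= 1 -> (0 < n)%N ->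
  decay n `^ k / n%:R <= (decay n `^ k - decay n.+1 `^ k) / (c * k).
Proof.
move=> k01 n0; have /andP[c0 c1] := c01; have /andP[k0 k1] := k01.
have /andP[f0 f1] := decay_factor n0.
have d0 := powR_ge0 (decay n) k.
rewrite decayS// powRM ?(ltW (decay_gt0 _)) ?(ltW f0)//.
have t01 : 0 <= c / n%:R <= 1.
  by apply/andP; split; [rewrite divr_ge0// ltW|lra].
have := powR_bernoulli k01 t01; set a := (1 - _) `^ k; set z := decay n `^ k.
move=> ak; rewrite ler_pdivlMr ?mulr_gt0//.
have -> : z / n%:R * (c * k) = z * (k * (c / n%:R)) by ring.
have -> : z - z * a = z * (1 - a) by ring.
by rewrite ler_wpM2l//; lra.
Qed.

End DecayingProduct.

(** * Weights of a fragmentation *)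

Section Fragmentation.
Context {R : realType}.
Implicit Types (lr : nat -> R * R) (i : nat -> nat).

(** One recursion for all [n > 0]: the first step, which the definition treats
    separately, is the general one with [i 1 = 1]. *)
Lemma beta_coefS lr i n j : (0 < n)%N -> (1 <= i n <= n)%N ->
  beta_coef lr i n.+1 j =
  if (j < i n)%N then beta_coef lr i n j
  else if j == i n then (lr n).1 * beta_coef lr i n (i n)
  else if j == (i n).+1 then (lr n).2 * beta_coef lr i n (i n)
  else beta_coef lr i n j.-1.
Proof.
case: n => [//|[|n]] _ /=; last by [].
move=> /andP[i1 i1']; have -> : i 1%N = 1%N by apply/eqP; rewrite eqn_leq i1' i1.
by case: j => [|[|[|j]]] //=; rewrite mulr1.
Qed.

#[local] Arguments beta_coef : simpl never.

Lemma beta_coef_ge0 lr i n j : (forall k, 0 <= (lr k).1 /\ 0 <= (lr k).2) ->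
  (forall k, (0 < k)%N -> (1 <= i k <= k)%N) -> 0 <= beta_coef lr i n j.
Proof.
move=> lr0 i1; elim: n j => [//|n IH j].
case: n IH => [_|n IH]; first by rewrite /beta_coef; case: ifP.
rewrite beta_coefS ?i1//; have [l0 r0] := lr0 n.+1.
by do 3 (case: ifP => _; rewrite ?mulr_ge0//).
Qed.

(** One fragmentation trades the term of the chosen piece for those of its two
    children.  The old term is moved to the left-hand side so that the identity
    involves sums only and can be integrated without subtraction. *)
Lemma sum_beta_coefS lr i n (phi : R -> R) : (0 < n)%N -> (1 <= i n <= n)%N ->
  \sum_(1 <= j < n.+2) phi (beta_coef lr i n.+1 j) + phi (beta_coef lr i n (i n)) =
  \sum_(1 <= j < n.+1) phi (beta_coef lr i n j) +
  (phi ((lr n).1 * beta_coef lr i n (i n)) +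
   phi ((lr n).2 * beta_coef lr i n (i n))).
Proof.
move=> n0 i1n; have /andP[i1 ilen] := i1n.
rewrite (@big_cat_nat _ _ _ (i n) 1 n.+2)//=; last by lia.
rewrite (@big_cat_nat _ _ _ (i n) 1 n.+1)//=; last by lia.
rewrite [X in _ + X + _ = _](@big_ltn _ _ _ (i n))//; last by lia.
rewrite [X in _ + (_ + X) + _ = _](@big_ltn _ _ _ (i n).+1)//.
rewrite [X in _ = _ + X + _](@big_ltn _ _ _ (i n))//.
rewrite (@big_add1 _ _ _ (i n).+1)/=.
have -> : \sum_(1 <= j < i n) phi (beta_coef lr i n.+1 j) =
    \sum_(1 <= j < i n) phi (beta_coef lr i n j).
  by apply: eq_big_nat => j /andP[_ ji]; rewrite beta_coefS// ji.
have -> : \sum_((i n).+1 <= j < n.+1) phi (beta_coef lr i n.+1 j.+1) =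
    \sum_((i n).+1 <= j < n.+1) phi (beta_coef lr i n j).
  apply: eq_big_nat => j /andP[ij _]; rewrite beta_coefS//.
  rewrite (_ : (j.+1 < i n)%N = false); last by lia.
  rewrite (_ : (j.+1 == i n) = false); last by lia.
  by rewrite (_ : (j.+1 == (i n).+1) = false)//; lia.
rewrite !beta_coefS// ltnn eqxx ltnNge leqnSn/=.
rewrite (_ : ((i n).+1 == i n) = false) ?eqxx; last by lia.
ring.
Qed.

End Fragmentation.

Lemma beta_coef_ext (R : realType) (lr lr' : nat -> R * R) (i i' : nat -> nat) :
  (forall k, (0 < k)%N -> lr k = lr' k) ->
  (forall k, (0 < k)%N -> (1 <= i k <= k)%N) ->
  (forall k, (0 < k)%N -> i k = i' k) ->
  forall n j, beta_coef lr i n j = beta_coef lr' i' n j.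
Proof.
move=> lrE i1 iE; elim=> [//|n IH] j; case: n IH => [//|n] IH.
have i1' : (1 <= i' n.+1 <= n.+1)%N by rewrite -iE// i1.
rewrite (beta_coefS lr j (ltn0Sn n) (i1 n.+1 isT)) (beta_coefS lr' j (ltn0Sn n) i1').
by rewrite -(iE n.+1 isT) (lrE n.+1 isT) !IH.
Qed.

(** The hypotheses control [(L_n, R_n)] and [I_n] only up to null sets.
    Replacing them by [abs_pair] and [clampn] changes nothing almost surely
    and makes every pointwise statement about the weights (nonnegativity, the
    recursion) hold at all sample points. *)
Definition abs_pair (R : realType) (z : R * R) : R * R := (`|z.1|, `|z.2|).

Definition clampn (n i : nat) : nat := if (1 <= i <= n)%N then i else 1%N.

Lemma clampnP n i : (0 < n)%N -> (1 <= clampn n i <= n)%N.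
Proof. by rewrite /clampn; case: ifP => // _ ->. Qed.

Lemma measurable_abs_pair (R : realType) : measurable_fun setT (@abs_pair R).
Proof.
by apply: measurable_fun_pair; apply: measurableT_comp.
Qed.

Section Weights.
Context (T : Type) (R : realType) (LR : nat -> T -> R * R) (I : nat -> T -> nat).

Definition split_index (n : nat) (w : T) : nat := clampn n (I n w).

Definition weight (n j : nat) (w : T) : R :=
  beta_coef (fun k => abs_pair (LR k w)) (fun k => split_index k w) n j.

Definition split_weight (n : nat) (w : T) : R := weight n (split_index n w) w.

Definition total_weight (n : nat) (w : T) : R := \sum_(1 <= j < n.+1) weight n j w.

Definition weight_power (n : nat) (s : R) (w : T) : R :=
  \sum_(1 <= j < n.+1) weight n j w `^ s.

Lemma weight_ge0 n j w : 0 <= weight n j w.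
Proof.
apply: beta_coef_ge0 => k; first by rewrite /=; split; exact: normr_ge0.
exact: clampnP.
Qed.

Lemma weight_le_total n j w : (1 <= j <= n)%N -> weight n j w <= total_weight n w.
Proof.
move=> jn; rewrite /total_weight (@big_cat_nat _ _ _ j 1 n.+1)//=; last 2 first.
  by lia.
  by lia.
rewrite (@big_ltn _ _ _ j)//; last by lia.
rewrite addrCA lerDl addr_ge0// sumr_ge0// => k _; exact: weight_ge0.
Qed.

Lemma total_weight_ge0 n w : 0 <= total_weight n w.
Proof. by apply: sumr_ge0 => j _; exact: weight_ge0. Qed.

Lemma weight_power_ge0 n s w : 0 <= weight_power n s w.
Proof. by apply: sumr_ge0 => j _; exact: powR_ge0. Qed.

Lemma split_weight_ge0 n w : 0 <= split_weight n w.
Proof. exact: weight_ge0. Qed.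

Lemma split_weight_le_total n w : (0 < n)%N -> split_weight n w <= total_weight n w.
Proof. by move=> n0; apply: weight_le_total; exact: clampnP. Qed.

Lemma total_weightS n w : (0 < n)%N ->
  total_weight n.+1 w + split_weight n w = total_weight n w +
  split_weight n w * ((abs_pair (LR n w)).1 + (abs_pair (LR n w)).2).
Proof.
move=> n0; rewrite /total_weight /split_weight /weight.
rewrite (@sum_beta_coefS _ _ _ _ (fun x => x))//; last exact: clampnP.
by congr (_ + _); ring.
Qed.

Lemma weight_powerS n s w : (0 < n)%N ->
  weight_power n.+1 s w + split_weight n w `^ s = weight_power n s w +
  split_weight n w `^ s * ((abs_pair (LR n w)).1 `^ s + (abs_pair (LR n w)).2 `^ s).
Proof.
move=> n0; rewrite /weight_power /split_weight /weight.
rewrite (@sum_beta_coefS _ _ _ _ (fun x => x `^ s))//; last exact: clampnP.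
rewrite -/(weight n (split_index n w) w).
rewrite !powRM ?weight_ge0 ?normr_ge0//.
by congr (_ + _); ring.
Qed.

Lemma total_weight1 w : total_weight 1 w = 1.
Proof. by rewrite /total_weight big_nat1. Qed.

Lemma weight_power1 s w : weight_power 1 s w = 1.
Proof. by rewrite /weight_power big_nat1 /weight /= powR1. Qed.

End Weights.

(** Only the variables of index below [n] enter the [n]-th generation; this
    is what makes the weights depend on the past alone. *)
Lemma measurable_beta_coef d (T : measurableType d) (R : realType)
    (lr : nat -> T -> R * R) (i : nat -> T -> nat) n j :
  (forall k, (0 < k < n)%N -> measurable_fun setT (lr k)) ->
  (forall k, (0 < k < n)%N -> measurable_fun setT (i k)) ->
  measurable_fun setT (fun w => beta_coef (lr ^~ w) (i ^~ w) n j).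
Proof.
elim: n j => [|n IH] j mlr mi; first exact: measurable_cst.
have ml k : (0 < k < n.+1)%N -> measurable_fun setT (fun w => (lr k w).1).
  by move=> /mlr mlrk; apply: measurableT_comp mlrk; exact: measurable_fst.
have mr k : (0 < k < n.+1)%N -> measurable_fun setT (fun w => (lr k w).2).
  by move=> /mlr mlrk; apply: measurableT_comp mlrk; exact: measurable_snd.
case: n IH mlr mi ml mr => [|[|n]] IH mlr mi ml mr.
- exact: measurable_cst.
- rewrite /=; case: (j == 1)%N; first exact: ml.
  by case: (j == 2)%N; [exact: mr|exact: measurable_cst].
have {}IH k : measurable_fun setT (fun w => beta_coef (lr ^~ w) (i ^~ w) n.+2 k).
  by apply: IH => m /andP[m0 mn]; [apply: mlr|apply: mi]; rewrite m0/= ltnW.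
pose G k : T -> R := if (j < k)%N then fun w => beta_coef (lr ^~ w) (i ^~ w) n.+2 j
  else if j == k then
    fun w => (lr n.+2 w).1 * beta_coef (lr ^~ w) (i ^~ w) n.+2 k
  else if j == k.+1 then
    fun w => (lr n.+2 w).2 * beta_coef (lr ^~ w) (i ^~ w) n.+2 k
  else fun w => beta_coef (lr ^~ w) (i ^~ w) n.+2 j.-1.
have n2 : (0 < n.+2 < n.+3)%N by rewrite /=.
rewrite (_ : (fun w => _) = fun w => G (i n.+2 w) w); last first.
  by apply/funext => w; rewrite /G !if_arg.
apply: measurable_fun_select (mi _ n2) _ => k.
rewrite /G; case: ifP => _; first exact: IH.
case: ifP => _; first by apply: measurable_funM; [exact: ml|exact: IH].
case: ifP => _; last exact: IH.
by apply: measurable_funM; [exact: mr|exact: IH].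
Qed.

(** * The sigma-algebras of the driving variables *)

Section VariableSigmaAlgebras.
Context d (T : measurableType d) (R : realType) (P : probability T R).
Context (X : nat -> {RV P >-> R}) (LR : nat -> {RV P >-> (R * R)%type})
  (I : nat -> {RV P >-> nat}) (nu : R -> {RV P >-> nat}).

Let positive : set nat := [set n | (1 <= n)%N].

(** All driving variables are put into a single family, so that its mutual
    independence covers every later use: [(0, j)] stands for [X_j], [(1, j)] for
    [(L_j, R_j)], [(2, j)] for [I_j], and [(3, 0)] for the whole process [nu],
    within which nothing is assumed independent. *)
Definition var_sigma (v : nat * nat) : set (set T) :=
  match v.1 with
  | 0 => sigma_rv (X v.2)
  | 1 => sigma_rv (LR v.2)
  | 2 => sigma_rv (I v.2)
  | _ => sigma_family [set t : R | 0 <= t] nu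
  end.

Definition var_index : set (nat * nat) :=
  [set v | ((v.1 < 3) && (0 < v.2))%N \/ v = (3, 0)%N].

Lemma sigma_rv_algebra d' (T' : measurableType d') (Y : {RV P >-> T'}) :
  sigma_algebra setT (sigma_rv Y).
Proof. by apply: sigma_algebra_preimage; exact: sigma_algebra_measurable. Qed.

Lemma sigma_rv_measurable d' (T' : measurableType d') (Y : {RV P >-> T'}) :
  sigma_rv Y `<=` measurable.
Proof. by move=> _ [B mB <-]; rewrite setTI; exact: measurable_funPTI. Qed.

Lemma sigma_family_measurable d' (T' : measurableType d') (J : Type)
  (D : set J) (Y : J -> {RV P >-> T'}) : sigma_family D Y `<=` measurable.
Proof.
apply: smallest_sub; first exact: sigma_algebra_measurable.
by apply: bigcup_sub => j _; exact: sigma_rv_measurable.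
Qed.

Lemma sub_sigma_family d' (T' : measurableType d') (J : Type)
  (D : set J) (Y : J -> {RV P >-> T'}) j : D j -> sigma_rv (Y j) `<=` sigma_family D Y.
Proof. by move=> Dj A YA; apply: sub_sigma_algebra; exists j. Qed.

Lemma var_sigma_algebra v : sigma_algebra setT (var_sigma v).
Proof.
case: v => [[|[|[|c]]] j]; rewrite /var_sigma/=; try exact: sigma_rv_algebra.
exact: smallest_sigma_algebra.
Qed.

Lemma sigma_algebraI (F : set (set T)) : sigma_algebra setT F -> setI_closed F.
Proof.
move=> [F0 FC FU] A B FA FB.
have FC' C : F C -> F (~` C) by rewrite -setTD; exact: FC.
rewrite -(setCK (A `&` B)) setCI; apply: (FC' _).
rewrite -bigcup2E; apply: FU => -[|[|k]]/=; [exact: FC'|exact: FC'|exact: F0].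
Qed.

Lemma var_sigmaI v : setI_closed (var_sigma v).
Proof. exact: sigma_algebraI (var_sigma_algebra v). Qed.

Lemma sigma_algebra_setT (F : set (set T)) : sigma_algebra setT F -> F setT.
Proof. by move=> [F0 FC _]; rewrite -setC0 -setTD; exact: FC. Qed.

Lemma var_sigmaT v : var_sigma v setT.
Proof. exact: sigma_algebra_setT (var_sigma_algebra v). Qed.

Lemma var_sigma_measurable v : var_sigma v `<=` measurable.
Proof.
case: v => [[|[|[|c]]] j]; rewrite /var_sigma/=; try exact: sigma_rv_measurable.
exact: sigma_family_measurable.
Qed.

Hypothesis X_indep : independent_rvs positive X.
Hypothesis LR_indep : independent_rvs positive LR.
Hypothesis I_indep : independent_rvs positive I.
Hypothesis families_indep : mutually_independent P `I_4
    (nth set0 [:: sigma_family positive X; sigma_family positive LR;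
                  sigma_family positive I;
                  sigma_family [set t : R | 0 <= t] nu]).

Lemma family_product_rule d' (T' : measurableType d') (Y : nat -> {RV P >-> T'})
    (c : nat) (J : seq (nat * nat)) (A : nat * nat -> set T) :
  independent_rvs positive Y -> uniq J ->
  (forall v, v \in J -> v.1 = c /\ positive v.2 /\ sigma_rv (Y v.2) (A v)) ->
  sigma_family positive Y (\bigcap_(v in [set` J]) A v) /\
  P (\bigcap_(v in [set` J]) A v) = (\prod_(v <- J) P (A v))%E.
Proof.
move=> indepY uJ JA; split.
  rewrite bigcap_seq; have sY := smallest_sigma_algebra setT
    (\bigcup_(j in positive) sigma_rv (Y j)).
  rewrite big_seq; elim/big_rec: _ => [|v B vJ sB]; first exact: sigma_algebra_setT sY.
  apply: (sigma_algebraI sY) => //; have [_ [v0 YA]] := JA _ vJ.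
  exact: (sub_sigma_family v0).
have JE v : v \in J -> v = (c, v.2) by move=> /JA[<- _]; case: v.
have -> : \bigcap_(v in [set` J]) A v =
    \bigcap_(j in [set` map snd J]) A (c, j).
  apply/seteqP; split=> [w wA j /= /mapP[v vJ ->]|w wA v /= vJ].
    by rewrite -JE//; exact: wA.
  by rewrite (JE _ vJ); apply: wA; apply: map_f.
rewrite indepY.
- rewrite big_map big_seq [RHS]big_seq; apply: eq_bigr => v vJ.
  by rewrite -JE.
- rewrite map_inj_in_uniq// => v v' vJ v'J vv'.
  by rewrite (JE _ vJ) (JE _ v'J) vv'.
- by move=> j /mapP[v vJ ->]; rewrite -JE//; have [_] := JA _ vJ.
Qed.

(** The indices are grouped by family: the families are independent of one
    another, and within each of the first three the product rule holds again. *)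
Lemma var_indep : mutually_independent P var_index var_sigma.
Proof.
move=> J A uJ JA.
pose part c := [seq v <- J | v.1 == c].
have upart c : uniq (part c) by exact: filter_uniq.
have partP c v : v \in part c -> [/\ v \in J, v.1 = c, var_index v & var_sigma v (A v)].
  by rewrite mem_filter => /andP[/eqP vc vJ]; have [] := JA _ vJ.
have posP c v : (c < 3)%N -> v \in part c -> positive v.2.
  move=> c3 /partP[_ vc [/andP[_ //]|v3] _].
  by move: c3; rewrite -vc v3.
pose B c := \bigcap_(v in [set` part c]) A v.
have [s0 p0] : sigma_family positive X (B 0%N) /\ P (B 0%N) = (\prod_(v <- part 0%N) P (A v))%E.
  apply: (@family_product_rule _ _ X 0%N) => // v vp.
  have := posP 0%N v isT vp; have [_] := partP _ _ vp.
  by rewrite /var_sigma; case: (v) => [? ?] /= ->.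
have [s1 p1] : sigma_family positive LR (B 1%N) /\ P (B 1%N) = (\prod_(v <- part 1%N) P (A v))%E.
  apply: (@family_product_rule _ _ LR 1%N) => // v vp.
  have := posP 1%N v isT vp; have [_] := partP _ _ vp.
  by rewrite /var_sigma; case: (v) => [? ?] /= ->.
have [s2 p2] : sigma_family positive I (B 2%N) /\ P (B 2%N) = (\prod_(v <- part 2%N) P (A v))%E.
  apply: (@family_product_rule _ _ I 2%N) => // v vp.
  have := posP 2%N v isT vp; have [_] := partP _ _ vp.
  by rewrite /var_sigma; case: (v) => [? ?] /= ->.
have p3E v : v \in part 3%N -> v = (3, 0)%N.
  by move=> /partP[_ v3 [/andP[v3' _]|//] _]; rewrite v3 in v3'.
have [s3 p3] : sigma_family [set t : R | 0 <= t] nu (B 3%N) /\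
    P (B 3%N) = (\prod_(v <- part 3%N) P (A v))%E.
  have sT : sigma_family [set t : R | 0 <= t] nu setT.
    by apply: sigma_algebra_setT; exact: smallest_sigma_algebra.
  rewrite /B; case E : (part 3%N) (upart 3%N) => [|v [|v' l]] up.
  - by rewrite big_nil set_nil bigcap_set0 probability_setT.
  - rewrite big_seq1 (_ : \bigcap_(u in [set` [:: v]]) A u = A v); last first.
      apply/seteqP; split=> [w /(_ v)|w Aw u /=]; first by apply; exact: mem_head.
      by rewrite inE => /eqP ->.
    have : v \in part 3%N by rewrite E mem_head.
    move=> /[dup] /p3E -> /partP[_ _ _]; by [].
  - exfalso; move: up => /= /andP[/negP up _]; apply: up.
    have vE : v = (3, 0)%N by apply: p3E; rewrite E mem_head.
    have v'E : v' = (3, 0)%N by apply: p3E; rewrite E !inE eqxx orbT.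
    by rewrite vE v'E mem_head.
have Jsplit : perm_eq J (part 0 ++ part 1 ++ part 2 ++ part 3)%N.
  apply: uniq_perm => //.
    rewrite !cat_uniq !upart/= andbT.
    have disj c c' v : c != c' -> v \in part c -> v \in part c' -> False.
      by move=> /eqP cc' /partP[_ vc _ _] /partP[_ vc' _ _]; apply: cc'; rewrite -vc.
    apply/and3P; split; apply/hasPn => v; rewrite ?mem_cat => vp; apply/negP.
    - by move=> v0; case/or3P : vp => vp; exact: (disj _ _ _ _ v0 vp).
    - by move=> v0; case/orP : vp => vp; exact: (disj _ _ _ _ v0 vp).
    - by move=> v0; exact: (disj _ _ _ _ v0 vp).
  move=> v; rewrite !mem_cat !mem_filter.
  case vJ : (v \in J); rewrite ?andbF// !andbT.
  have [[/andP[v3 _]|->] _] := JA _ vJ; last by [].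
  by case: (v.1) v3 => [|[|[|]]].
rewrite (perm_big _ Jsplit)/= !big_cat/= -p0 -p1 -p2 -p3.
have -> : \bigcap_(v in [set` J]) A v = \bigcap_(c in [set` [:: 0; 1; 2; 3]%N]) B c.
  apply/seteqP; split=> [w wA c /= _ v /= vp|w wB v /= vJ].
    by apply: wA => /=; have [] := partP _ _ vp.
  have : v \in (part 0 ++ part 1 ++ part 2 ++ part 3)%N by rewrite -(perm_mem Jsplit).
  by rewrite !mem_cat => /or4P[vp|vp|vp|vp]; [apply: (wB 0%N)|apply: (wB 1%N)|
    apply: (wB 2%N)|apply: (wB 3%N)].
rewrite families_indep//.
  by rewrite !big_cons big_nil mule1.
by move=> c; rewrite !inE => /or4P[] /eqP ->; split.
Qed.

Definition var_generated (E : set (nat * nat)) : set (set T) :=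
  \bigcup_(v in E) var_sigma v.

(** Being determined by the variables with index in [E], phrased as
    measurability for the sigma-algebra they generate, so that the
    general measurability lemmas apply to it. *)
Definition adapted d' (T' : measurableType d') (E : set (nat * nat)) (f : T -> T') :=
  @measurable_fun _ _ (g_sigma_algebraType (var_generated E)) T' setT f.

Lemma adapted_sub d' (T' : measurableType d') E E' (f : T -> T') :
  E `<=` E' -> adapted E f -> adapted E' f.
Proof.
move=> EE' fE _ A mA.
have := fE measurableT A mA; apply: sub_sigma_algebra2.
by apply: bigcup_subset.
Qed.

Lemma adapted_measurable d' (T' : measurableType d') E (f : T -> T') :
  adapted E f -> measurable_fun setT f.
Proof.
move=> fE _ A mA; have := fE measurableT A mA; apply: smallest_sub.
  exact: sigma_algebra_measurable.
by apply: bigcup_sub => v _; exact: var_sigma_measurable.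
Qed.

Lemma adapted_comp d1 (T1 : measurableType d1) d2 (T2 : measurableType d2)
    E (f : T1 -> T2) (g : T -> T1) :
  measurable_fun setT f -> adapted E g -> adapted E (fun w => f (g w)).
Proof.
move=> mf gE _ A mA; have := gE measurableT (f @^-1` A).
by apply; rewrite -[X in measurable X]setTI; exact: mf.
Qed.

Lemma adapted_X (E : set (nat * nat)) j : E (0, j)%N -> adapted E (X j).
Proof.
move=> Ej _ A mA; apply: sub_sigma_algebra; exists (0, j)%N => //.
by exists A.
Qed.

Lemma adapted_LR (E : set (nat * nat)) j : E (1, j)%N -> adapted E (LR j).
Proof.
move=> Ej _ A mA; apply: sub_sigma_algebra; exists (1, j)%N => //.
by exists A.
Qed.

Lemma adapted_I (E : set (nat * nat)) j : E (2, j)%N -> adapted E (I j).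
Proof.
move=> Ej _ A mA; apply: sub_sigma_algebra; exists (2, j)%N => //.
by exists A.
Qed.

Lemma adapted_nu (E : set (nat * nat)) t : E (3, 0)%N -> 0 <= t ->
  adapted E (nu t).
Proof.
move=> Ej t0 _ A mA; apply: sub_sigma_algebra; exists (3, 0)%N => //.
by apply: (sub_sigma_family (D := [set t : R | 0 <= t]) t0); exists A.
Qed.

Lemma adapted_independent (E1 E2 : set (nat * nat)) (f g : T -> R) :
  E1 `<=` var_index -> E2 `<=` var_index -> [disjoint E1 & E2] ->
  adapted E1 f -> adapted E2 g -> independent_funs P f g.
Proof.
move=> E1v E2v E12 fE gE A B mA mB.
apply: (independent_generated var_sigmaI var_sigmaT var_sigma_measurable var_indep
  E1v E2v E12).
- by rewrite -[f @^-1` A]setTI; exact: fE.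
- by rewrite -[g @^-1` B]setTI; exact: gE.
Qed.

End VariableSigmaAlgebras.

(** The weights of generation [n] are functions of the [(L_k, R_k)] and [I_k]
    with [0 < k < n]. *)
Definition past (n : nat) : set (nat * nat) :=
  [set v | (1 <= v.1 <= 2)%N && (0 < v.2 < n)%N].

Lemma past_var_index n : past n `<=` var_index.
Proof.
move=> [c j]; rewrite /past/= => /andP[/andP[_ c2] /andP[j0 _]].
by left; rewrite j0 andbT.
Qed.

Lemma past_sub m n : (m <= n)%N -> past m `<=` past n.
Proof.
move=> mn [c j]; rewrite /past/= => /andP[-> /andP[-> jm]]; exact: leq_trans jm mn.
Qed.

(** * The fragmentation process *)

(** Independence, and the laws of the [(L_n, R_n)] and [I_n], bundled so that
    they can be carried as one hypothesis; the laws of the [X_n] and of [nu]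
    enter only the law of large numbers and the convergence. *)
Record is_fragmentation d0 (T0 : measurableType d0) (R : realType)
    (P0 : probability T0 R) d (T : measurableType d) (P : probability T R)
    (LR0 : {RV P0 >-> (R * R)%type}) (X : nat -> {RV P >-> R})
    (LR : nat -> {RV P >-> (R * R)%type}) (I : nat -> {RV P >-> nat})
    (nu : R -> {RV P >-> nat}) : Prop := {
  frag_LR0_ge0 : forall w, 0 <= (LR0 w).1 /\ 0 <= (LR0 w).2 ;
  frag_LR_law : forall n, (1 <= n)%N -> same_law (LR n) LR0 ;
  frag_I_law : forall n k, (1 <= k <= n)%N ->
    P [set w | I n w = k] = (n%:R^-1)%:E ;
  frag_X_indep : independent_rvs [set n | (1 <= n)%N] X ;
  frag_LR_indep : independent_rvs [set n | (1 <= n)%N] LR ;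
  frag_I_indep : independent_rvs [set n | (1 <= n)%N] I ;
  frag_families_indep : mutually_independent P `I_4
    (nth set0 [:: sigma_family [set n | (1 <= n)%N] X;
                  sigma_family [set n | (1 <= n)%N] LR;
                  sigma_family [set n | (1 <= n)%N] I;
                  sigma_family [set t : R | 0 <= t] nu]) }.

(** This is [S(s) + 1] for [s > 0]; the two conventions for [0^0] differ at
    [s = 0] only. *)
Definition moment d0 (T0 : measurableType d0) (R : realType) (P0 : probability T0 R)
    (LR0 : {RV P0 >-> (R * R)%type}) (s : R) : \bar R :=
  (\int[P0]_w ((LR0 w).1 `^ s + (LR0 w).2 `^ s)%:E)%E.

Lemma calS_moment d0 (T0 : measurableType d0) (R : realType)
    (P0 : probability T0 R) (LR0 : {RV P0 >-> (R * R)%type}) s : 0 < s ->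
  (calS P0 LR0 s < 0)%E = (moment LR0 s < 1)%E.
Proof.
move=> s0; rewrite /calS unlock /moment.
have pE (x : R) : pow00 x s = x `^ s.
  by rewrite /pow00; case: eqP => // ->; rewrite powR0 ?gt_eqF.
rewrite (eq_integral (fun w => ((LR0 w).1 `^ s + (LR0 w).2 `^ s)%:E)); last first.
  by move=> w _; rewrite !pE.
by rewrite lteBlDr// add0e.
Qed.

Lemma moment_lt1_gap d0 (T0 : measurableType d0) (R : realType)
    (P0 : probability T0 R) (LR0 : {RV P0 >-> (R * R)%type}) s :
  (moment LR0 s < 1)%E ->
  exists2 c : R, 0 < c < 1 & (moment LR0 s <= (1 - c)%:E)%E.
Proof.
move=> mp.
have m0 : (0 <= moment LR0 s)%E.
  by apply: mean_ge0 => w; rewrite addr_ge0// powR_ge0.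
have mfin : moment LR0 s \is a fin_num.
  by rewrite ge0_fin_numE// (lt_trans mp)// ltry.
move: (mp) m0; rewrite -(fineK mfin) !lte_fin lee_fin; set m := fine _ => m1 m0.
exists ((1 - m) / 2); first by apply/andP; split; lra.
by rewrite lee_fin; lra.
Qed.

Section FragmentationProcess.

Context d0 (T0 : measurableType d0) (R : realType) (P0 : probability T0 R).
Context d (T : measurableType d) (P : probability T R).
Context (LR0 : {RV P0 >-> (R * R)%type}).
Context (X : nat -> {RV P >-> R}) (LR : nat -> {RV P >-> (R * R)%type})
  (I : nat -> {RV P >-> nat}) (nu : R -> {RV P >-> nat}).

Local Notation adapted := (@adapted _ T R P X LR I nu _ _).
Local Notation i_ := (split_index (I : nat -> T -> nat)).
Local Notation b_ := (weight (LR : nat -> T -> R * R) (I : nat -> T -> nat)).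
Local Notation bI := (split_weight (LR : nat -> T -> R * R) (I : nat -> T -> nat)).
Local Notation M_ := (total_weight (LR : nat -> T -> R * R) (I : nat -> T -> nat)).
Local Notation S_ := (weight_power (LR : nat -> T -> R * R) (I : nat -> T -> nat)).

Lemma adapted_split_index E n : E (2, n)%N -> adapted E (i_ n).
Proof.
move=> En; have := @adapted_I _ _ _ P X LR I nu E n En.
exact: (adapted_comp (f := clampn n)).
Qed.

Lemma adapted_abs_pair E n : E (1, n)%N -> adapted E (fun w => abs_pair (LR n w)).
Proof.
move=> En; have := @adapted_LR _ _ _ P X LR I nu E n En.
by apply: (adapted_comp (f := @abs_pair R)); exact: measurable_abs_pair.
Qed.

Lemma adapted_weight n j : adapted (past n) (b_ n j).
Proof.
apply: measurable_beta_coef => k /andP[k0 kn].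
  by apply: adapted_abs_pair; rewrite /past/= k0.
by apply: adapted_split_index; rewrite /past/= k0.
Qed.

Lemma adapted_sum E (l : seq nat) (h : nat -> T -> R) :
  (forall j, adapted E (h j)) -> adapted E (fun w => \sum_(j <- l) h j w).
Proof. by move=> hE; apply: measurable_sum => j; exact: hE. Qed.

Lemma adapted_total_weight n : adapted (past n) (M_ n).
Proof. by apply: adapted_sum => j; exact: adapted_weight. Qed.

Lemma adapted_weight_power n s : adapted (past n) (S_ n s).
Proof.
apply: adapted_sum => j.
apply: (adapted_comp (f := fun x : R => x `^ s)); first exact: measurable_powR.
exact: adapted_weight.
Qed.

Lemma measurable_abs_pair_LR n : measurable_fun setT (fun w => abs_pair (LR n w)).
Proof. exact: measurableT_comp (@measurable_abs_pair R) _. Qed.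

Lemma measurable_split_index n : measurable_fun setT (i_ n).
Proof. exact: (measurableT_comp (f := clampn n)). Qed.

Lemma measurable_weight n j : measurable_fun setT (b_ n j).
Proof.
by apply: measurable_beta_coef => k _;
  [exact: measurable_abs_pair_LR|exact: measurable_split_index].
Qed.

Lemma measurable_total_weight n : measurable_fun setT (M_ n).
Proof. by apply: measurable_sum => j; exact: measurable_weight. Qed.

Lemma measurable_split_weight n : measurable_fun setT (bI n).
Proof.
apply: measurable_fun_select; first exact: measurable_split_index.
exact: measurable_weight.
Qed.

Lemma measurable_weight_power n s : measurable_fun setT (S_ n s).
Proof.
by apply: measurable_sum => j; apply: measurable_powR_comp; exact: measurable_weight.
Qed.

Hypothesis proc : is_fragmentation LR0 X LR I nu.

Let LR0_ge0 := frag_LR0_ge0 proc.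
Let LR_law := frag_LR_law proc.
Let I_law := frag_I_law proc.

Lemma fragmentation_independent (E1 E2 : set (nat * nat)) (f g : T -> R) :
  E1 `<=` var_index -> E2 `<=` var_index -> [disjoint E1 & E2] ->
  adapted E1 f -> adapted E2 g -> independent_funs P f g.
Proof.
by case: proc => _ _ _ h1 h2 h3 h4; exact: (adapted_independent h1 h2 h3 h4).
Qed.

(** The [n] prescribed probabilities already sum to [1]. *)
Lemma ae_split_range n : (0 < n)%N -> {ae P, forall w, (1 <= I n w <= n)%N}.
Proof.
move=> n0; pose A := [set w | (1 <= I n w <= n)%N].
have mI (C : set nat) : measurable (I n @^-1` C) by exact: measurable_funPTI.
have mA : measurable A by exact: (mI [set k | (1 <= k <= n)%N]).
have PA : P A = 1%E.
  pose F k := I n @^-1` [set k.+1].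
  have AF : A = \big[setU/set0]_(k < n) F k.
    rewrite -bigcup_mkord; apply/seteqP; split=> [w /= Aw|w [k /= kn Fk]]; last first.
      by rewrite /A/= (Fk : I n w = k.+1).
    have /andP[i1 iln] : (1 <= I n w <= n)%N := Aw.
    by exists (I n w).-1; rewrite /F/=; [rewrite prednK|rewrite prednK].
  rewrite AF measure_semi_additive_ord_I//; last 3 first.
  - by move=> k _; exact: mI.
  - by move=> k k' _ _ [w []]; rewrite /F/= => -> [].
  - by rewrite -AF.
  rewrite (eq_bigr (fun=> (n%:R^-1)%:E)) => [|k _]; last first.
    by rewrite /F -(@I_law n k.+1)// ltn_ord.
  rewrite sumEFin sumr_const card_ord -[X in X%:E]mulr_natl mulfV//.
  by rewrite pnatr_eq0 -lt0n.
exists (~` A); split; first exact: measurableC.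
  by rewrite probability_setC// PA subee.
by [].
Qed.

Lemma ae_LR_ge0 n : (0 < n)%N ->
  {ae P, forall w, 0 <= (LR n w).1 /\ 0 <= (LR n w).2}.
Proof.
move=> n0; pose B := [set z : R * R | 0 <= z.1 /\ 0 <= z.2].
have mB : measurable B.
  rewrite (_ : B = (fst @^-1` `[0, +oo[%classic) `&` (snd @^-1` `[0, +oo[%classic)).
    apply: measurableI; rewrite -[X in measurable X]setTI.
      by apply: measurable_fst => //; exact: measurable_itv.
    by apply: measurable_snd => //; exact: measurable_itv.
  by apply/seteqP; split=> z /=; rewrite !in_itv/= !andbT.
exists (LR n @^-1` (~` B)); split.
- by apply: measurable_funPTI; exact: measurableC.
- have := LR_law n0 (measurableC mB); rewrite /distribution/= /pushforward/= => ->.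
  rewrite (_ : _ @^-1` _ = set0) ?measure0//.
  by apply/seteqP; split=> // w; apply; exact: LR0_ge0.
- by [].
Qed.

Lemma integral_LR (psi : R * R -> R) n : (0 < n)%N ->
  measurable_fun setT psi -> (forall z, 0 <= psi (abs_pair z)) ->
  (\int[P]_w (psi (abs_pair (LR n w)))%:E = \int[P0]_w (psi (LR0 w))%:E)%E.
Proof.
move=> n0 mpsi psi0.
pose h : R * R -> \bar R := fun z => (psi (abs_pair z))%:E.
have mh : measurable_fun setT h.
  by apply/measurable_EFinP; apply: measurableT_comp => //; exact: measurable_abs_pair.
have h0 z : (0 <= h z)%E by rewrite lee_fin.
transitivity (\int[distribution P (LR n)]_z h z)%E.
  by rewrite ge0_integral_distribution.
transitivity (\int[distribution P0 LR0]_z h z)%E.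
  by apply: eq_measure_integral => A mA _; exact: LR_law.
rewrite ge0_integral_distribution//; apply: eq_integral => w _.
rewrite /h/= /abs_pair; have [l0 r0] := LR0_ge0 w.
by rewrite !ger0_norm//; case: (LR0 w).
Qed.

(** The chosen index is uniform and independent of the past, so averaging over
    it amounts to averaging over all pieces. *)
Lemma integral_select n (u : nat -> T -> R) : (0 < n)%N ->
  (forall k, adapted (past n) (u k)) -> (forall k w, 0 <= u k w) ->
  (\int[P]_w (u (i_ n w) w)%:E =
   (n%:R^-1)%:E * \sum_(1 <= k < n.+1) \int[P]_w (u k w)%:E)%E.
Proof.
move=> n0 mu u0.
have mu' k : measurable_fun setT (u k) := adapted_measurable (mu k).
pose e k w : R := (i_ n w == k)%:R.
have me k : adapted [set (2, n)%N] (e k).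
  have mi : adapted [set (2, n)%N] (i_ n) by exact: adapted_split_index.
  exact: (adapted_comp (f := fun j : nat => (j == k)%:R : R)) mi.
have me' k : measurable_fun setT (e k) := adapted_measurable (me k).
transitivity (\int[P]_w \sum_(1 <= k < n.+1) (u k w * e k w)%:E)%E.
  apply: eq_integral => w _; rewrite sumEFin; congr EFin.
  have /andP[i1 ilen] : (1 <= i_ n w <= n)%N by exact: clampnP.
  rewrite (bigD1_seq (i_ n w)) ?iota_uniq//=; last by rewrite mem_index_iota i1.
  rewrite /e eqxx mulr1 big1 ?addr0// => k ki.
  by rewrite eq_sym (negPf ki) mulr0.
rewrite ge0_integral_sum//; last 2 first.
- by move=> k; apply/measurable_EFinP; exact: measurable_funM.
- by move=> k w _; rewrite lee_fin mulr_ge0// /e.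
rewrite ge0_sume_distrr; last by move=> k _; apply: integral_ge0 => w _; rewrite lee_fin.
rewrite big_seq [RHS]big_seq; apply: eq_bigr => k; rewrite mem_index_iota ltnS => kn.
rewrite integral_mul_independent//; last first.
  apply: (fragmentation_independent (@past_var_index n) _ _ (mu k) (me k)).
    by move=> _ ->; left; rewrite /= n0.
  apply/eqP; apply/seteqP; split=> // v [].
  by rewrite /past/= => /andP[_ /andP[_ vn]] vE; move: vn; rewrite vE/= ltnn.
rewrite muleC; congr (_ * _)%E.
rewrite -(I_law kn).
have mI (C : set nat) : measurable (I n @^-1` C) by exact: measurable_funPTI.
transitivity (\int[P]_w (\1_[set w | I n w = k] w)%:E)%E; last first.
  by rewrite integral_indic ?setIT//; exact: (mI [set k]).
apply: ae_eq_integral => //.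
- exact/measurable_EFinP.
- apply/measurable_EFinP; apply: measurable_indic; exact: (mI [set k]).
- apply: filterS (ae_split_range n0) => w In _.
  rewrite /e /split_index /clampn In indicE.
  suff -> : (w \in [set w | I n w = k]) = (I n w == k) by [].
  by apply/idP/eqP => [/set_mem//|h]; exact/mem_set.
Qed.

(** The basic computation of every one-step estimate: the chosen index and
    [(L_n, R_n)] are independent of the past and of each other. *)
Lemma integral_split n (u : nat -> T -> R) (psi : R * R -> R) : (0 < n)%N ->
  (forall k, adapted (past n) (u k)) -> (forall k w, 0 <= u k w) ->
  measurable_fun setT psi -> (forall z, 0 <= psi (abs_pair z)) ->
  (\int[P]_w (u (i_ n w) w * psi (abs_pair (LR n w)))%:E =
   (n%:R^-1)%:E * (\sum_(1 <= k < n.+1) \int[P]_w (u k w)%:E) *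
   \int[P0]_w (psi (LR0 w))%:E)%E.
Proof.
move=> n0 mu u0 mpsi psi0.
pose E : set (nat * nat) := past n `|` [set (2, n)%N].
have mui : adapted E (fun w => u (i_ n w) w).
  apply: measurable_fun_select => [|k].
    by apply: adapted_split_index; right.
  by apply: adapted_sub (mu k); left.
have mp : adapted [set (1, n)%N] (fun w => psi (abs_pair (LR n w))).
  by apply: adapted_comp mpsi _; exact: adapted_abs_pair.
rewrite (integral_mul_independent (f := fun w => u (i_ n w) w)
  (g := fun w => psi (abs_pair (LR n w))))//; last 3 first.
- exact: adapted_measurable mui.
- exact: adapted_measurable mp.
- apply: (fragmentation_independent _ _ _ mui mp).
  + by move=> v [/past_var_index//|->]; left; rewrite /= n0.
  + by move=> _ ->; left; rewrite /= n0.
  + apply/eqP; apply/seteqP; split=> // v [[|->]//].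
    by rewrite /past/= => /andP[_ /andP[_ vn]] vE; move: vn; rewrite vE/= ltnn.
by rewrite integral_select// integral_LR.
Qed.

Lemma ae_weight : {ae P, forall w, forall n j, rbeta LR I n j w = b_ n j w}.
Proof.
have Hlr : {ae P, forall w, forall k, 0 <= (LR k.+1 w).1 /\ 0 <= (LR k.+1 w).2}.
  by apply: ae_foralln => k; exact: ae_LR_ge0.
have HI : {ae P, forall w, forall k, (1 <= I k.+1 w <= k.+1)%N}.
  by apply: ae_foralln => k; exact: ae_split_range.
apply: filterS2 Hlr HI => w Hlr HI n j.
apply: beta_coef_ext => -[//|k] _.
- have [l0 r0] := Hlr k.
  by rewrite /abs_pair !ger0_norm//; case: (LR k.+1 w).
- exact: HI.
- by rewrite /split_index /clampn HI.
Qed.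

Lemma ae_M1 : {ae P, forall w, forall n, M1 LR I n w = M_ n w}.
Proof.
apply: filterS ae_weight => w H n.
by rewrite /M1 /total_weight; apply: eq_bigr => j _; rewrite H.
Qed.

Lemma ae_W : {ae P, forall w, forall n,
  W LR I X n w = \sum_(1 <= j < n.+1) b_ n j w * X j w}.
Proof.
apply: filterS ae_weight => w H n.
by rewrite /W; apply: eq_bigr => j _; rewrite H.
Qed.

(** * Power sums of the weights *)

Let psi (s : R) (z : R * R) : R := z.1 `^ s + z.2 `^ s.

Let measurable_psi s : measurable_fun setT (psi s).
Proof.
apply: measurable_funD.
  by apply: measurableT_comp (@measurable_powR R s) _; exact: measurable_fst.
by apply: measurableT_comp (@measurable_powR R s) _; exact: measurable_snd.
Qed.

Let psi_ge0 s z : 0 <= psi s z.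
Proof. by rewrite addr_ge0// powR_ge0. Qed.

(** The recursion behind [E S_(n+1)(s) = (1 + S(s) / n) E S_n(s)], written
    without subtraction so that it also holds for infinite means. *)
Lemma integral_weight_powerS n s : (0 < n)%N ->
  (\int[P]_w (S_ n.+1 s w)%:E + (n%:R^-1)%:E * \int[P]_w (S_ n s w)%:E =
   \int[P]_w (S_ n s w)%:E + (n%:R^-1)%:E * \int[P]_w (S_ n s w)%:E * moment LR0 s)%E.
Proof.
move=> n0.
have sumb : (\sum_(1 <= k < n.+1) \int[P]_w (b_ n k w `^ s)%:E = \int[P]_w (S_ n s w)%:E)%E.
  rewrite -ge0_integral_sum//; last 2 first.
  - by move=> k; apply/measurable_EFinP/measurable_powR_comp/measurable_weight.
  - by move=> k w _; rewrite lee_fin powR_ge0.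
  by apply: eq_integral => w _; rewrite sumEFin.
have au k : adapted (past n) (fun w => b_ n k w `^ s).
  apply: (adapted_comp (f := fun x : R => x `^ s)); first exact: measurable_powR.
  exact: adapted_weight.
have h0 k w : 0 <= b_ n k w `^ s by exact: powR_ge0.
have := integral_select n0 au h0; rewrite sumb => E1.
have := integral_split n0 au h0 (measurable_psi s) (fun=> psi_ge0 s _).
rewrite sumb -/(moment LR0 s) => E2.
rewrite -E2 -E1 -!ge0_integralD//.
- apply: eq_integral => w _; rewrite -!EFinD; congr EFin.
  exact: weight_powerS.
- by move=> w _; rewrite lee_fin weight_power_ge0.
- exact/measurable_EFinP/measurable_weight_power.
- by move=> w _; rewrite lee_fin mulr_ge0// powR_ge0.
- apply/measurable_EFinP/measurable_funM.
    exact/measurable_powR_comp/measurable_split_weight.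
  exact: measurableT_comp (measurable_psi s) (measurable_abs_pair_LR n).
- by move=> w _; rewrite lee_fin weight_power_ge0.
- exact/measurable_EFinP/measurable_weight_power.
- by move=> w _; rewrite lee_fin powR_ge0.
- exact/measurable_EFinP/measurable_powR_comp/measurable_split_weight.
Qed.

(** Each step multiplies the mean by [1 + S(s) / n], which is at most
    [1 - c / n]. *)
Lemma weight_power_decay s c n : 0 < c < 1 -> (0 < n)%N ->
  (moment LR0 s <= (1 - c)%:E)%E ->
  (\int[P]_w (S_ n s w)%:E <= (decay c n)%:E)%E.
Proof.
move=> c01 n0 mc; elim: n n0 => [//|[|n] IH] _.
  under eq_integral do rewrite weight_power1.
  by rewrite mean_cst decay1.
have {}IH := IH isT.
have S0 : (0 <= \int[P]_w (S_ n.+1 s w)%:E)%E.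
  by apply: mean_ge0 => w; exact: weight_power_ge0.
have Sfin : (\int[P]_w (S_ n.+1 s w)%:E)%E \is a fin_num.
  by rewrite ge0_fin_numE// (le_lt_trans IH)// ltry.
have := integral_weight_powerS s (ltn0Sn n).
move: IH S0; rewrite -(fineK Sfin); set u := fine _ => IH S0 E.
rewrite !lee_fin in IH S0.
have t0 : 0 <= n.+1%:R^-1 :> R by [].
rewrite -(@leeD2rE _ (n.+1%:R^-1%:E * u%:E)%E)//.
rewrite E; apply: (@le_trans _ _ (u%:E + (n.+1%:R^-1)%:E * u%:E * (1 - c)%:E)%E).
  by rewrite leeD2l// lee_wpmul2l// lee_fin mulr_ge0.
rewrite -!EFinM -!EFinD lee_fin decayS//.
have /andP[f0 f1] := decay_factor c01 (ltn0Sn n).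
have -> : u + n.+1%:R^-1 * u * (1 - c) = u * (1 - c / n.+1%:R) + n.+1%:R^-1 * u.
  by ring.
by rewrite lerD2r ler_wpM2r// ltW.
Qed.

(** For [S(s) >= 0] the means do not decrease in [n], starting from
    [1].  Finiteness is needed to cancel the subtracted term of the recursion. *)
Lemma weight_power_ge1 s : (1 <= moment LR0 s)%E ->
  (forall n, (0 < n)%N -> (\int[P]_w (S_ n s w)%:E < +oo)%E) ->
  forall n, (0 < n)%N -> (1 <= \int[P]_w (S_ n s w)%:E)%E.
Proof.
move=> m1 fin; elim => [//|[|n] IH] _.
  under eq_integral do rewrite weight_power1.
  by rewrite mean_cst.
apply: (le_trans (IH isT)).
have S0 : (0 <= \int[P]_w (S_ n.+1 s w)%:E)%E.
  by apply: mean_ge0 => w; exact: weight_power_ge0.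
have Sfin : (\int[P]_w (S_ n.+1 s w)%:E)%E \is a fin_num.
  by rewrite ge0_fin_numE// fin.
have := integral_weight_powerS s (ltn0Sn n).
move: S0; rewrite -(fineK Sfin); set u := fine _; rewrite lee_fin => u0 E.
have nu0 : 0 <= n.+1%:R^-1 * u by rewrite mulr_ge0.
rewrite -(@leeD2rE _ (n.+1%:R^-1%:E * u%:E)%E)// E leeD2l//.
by rewrite -[leLHS]mule1 lee_wpmul2l// -EFinM lee_fin.
Qed.

(** * The total weight as a martingale *)

Hypothesis mean1 : (\int[P0]_w ((LR0 w).1 + (LR0 w).2)%:E = 1)%E.

Let measurable_sum2 : measurable_fun setT (fun z : R * R => z.1 + z.2).
Proof. by apply: measurable_funD; [exact: measurable_fst|exact: measurable_snd]. Qed.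

Let sum2_ge0 (z : R * R) : 0 <= (abs_pair z).1 + (abs_pair z).2.
Proof. by rewrite addr_ge0// normr_ge0. Qed.

(** The factor [h], determined by the past, makes this a statement on the
    conditional mean of [M_(n+1)]. *)
Lemma integral_total_weight_split n (h : T -> R) : (0 < n)%N ->
  adapted (past n) h -> (forall w, 0 <= h w) ->
  (\int[P]_w (h w * bI n w)%:E = (n%:R^-1)%:E * \int[P]_w (h w * M_ n w)%:E)%E /\
  (\int[P]_w (h w * bI n w * ((abs_pair (LR n w)).1 + (abs_pair (LR n w)).2))%:E =
   (n%:R^-1)%:E * \int[P]_w (h w * M_ n w)%:E)%E.
Proof.
move=> n0 ah h0.
have mh := adapted_measurable ah.
have au k : adapted (past n) (fun w => h w * b_ n k w).
  by apply: measurable_funM ah _; exact: adapted_weight.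
have u0 k w : 0 <= h w * b_ n k w by rewrite mulr_ge0// weight_ge0.
have sumE : (\sum_(1 <= k < n.+1) \int[P]_w (h w * b_ n k w)%:E =
    \int[P]_w (h w * M_ n w)%:E)%E.
  rewrite -mean_sum//; last by move=> k; exact: adapted_measurable (au k).
  by apply: eq_integral => w _; rewrite /total_weight mulr_sumr.
split.
  by rewrite -sumE -integral_select.
have := integral_split n0 au u0 measurable_sum2 sum2_ge0.
by rewrite mean1 mule1 sumE.
Qed.

Lemma martingale_step n (h : T -> R) : (0 < n)%N ->
  adapted (past n) h -> (forall w, 0 <= h w) ->
  (\int[P]_w (h w * M_ n w)%:E < +oo)%E ->
  (\int[P]_w (h w * M_ n.+1 w)%:E = \int[P]_w (h w * M_ n w)%:E)%E.
Proof.
move=> n0 ah h0 fin.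
have [E1 E2] := integral_total_weight_split n0 ah h0.
have mh := adapted_measurable ah.
have mM k := measurable_total_weight k.
have mb := measurable_split_weight n.
have mlr : measurable_fun setT
    (fun w => (abs_pair (LR n w)).1 + (abs_pair (LR n w)).2).
  exact: measurableT_comp measurable_sum2 (measurable_abs_pair_LR n).
have : (\int[P]_w (h w * M_ n.+1 w)%:E + \int[P]_w (h w * bI n w)%:E =
  \int[P]_w (h w * M_ n w)%:E + \int[P]_w (h w * bI n w *
    ((abs_pair (LR n w)).1 + (abs_pair (LR n w)).2))%:E)%E.
  rewrite -!meanD//; last first.
  - by move=> w; rewrite mulr_ge0// split_weight_ge0.
  - by move=> w; rewrite mulr_ge0// total_weight_ge0.
  - exact: measurable_funM.
  - exact: measurable_funM.
  - by move=> w; rewrite !mulr_ge0// split_weight_ge0.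
  - by move=> w; rewrite mulr_ge0// total_weight_ge0.
  - by apply: measurable_funM => //; exact: measurable_funM.
  - exact: measurable_funM.
  apply: eq_integral => w _; congr EFin.
  by rewrite -mulrDr total_weightS// mulrDr mulrA.
rewrite E1 E2.
have f : (\int[P]_w (h w * M_ n w)%:E)%E \is a fin_num.
  by rewrite ge0_fin_numE//; apply: mean_ge0 => w; rewrite mulr_ge0// total_weight_ge0.
have nf : ((n%:R^-1)%:E * \int[P]_w (h w * M_ n w)%:E)%E \is a fin_num.
  by rewrite fin_numM.
move=> /(congr1 (fun z => z - (n%:R^-1)%:E * \int[P]_w (h w * M_ n w)%:E)%E).
by rewrite !addeK.
Qed.

Lemma mean_total_weight n : (0 < n)%N -> (\int[P]_w (M_ n w)%:E = 1)%E.
Proof.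
elim: n => [//|[|n] IH] _.
  under eq_integral do rewrite total_weight1.
  exact: mean_cst.
have IH' := IH isT.
have e k : (\int[P]_w (1 * M_ k w)%:E = \int[P]_w (M_ k w)%:E)%E.
  by apply: eq_integral => w _; rewrite mul1r.
have := @martingale_step n.+1 (fun=> 1) isT (measurable_cst _) (fun=> ler01).
by rewrite !e IH'; apply; exact: ltry.
Qed.

(** The martingale property, tested against bounded nonnegative functions of
    the past instead of stated through conditional expectations. *)
Lemma martingale m n (h : T -> R) (K : R) : (0 < n <= m)%N ->
  adapted (past n) h -> (forall w, 0 <= h w <= K) ->
  (\int[P]_w (h w * M_ m w)%:E = \int[P]_w (h w * M_ n w)%:E)%E.
Proof.
move=> /andP[n0 nm] ah hK; have mh := adapted_measurable ah.
have h0 w : 0 <= h w by have /andP[] := hK w.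
have mM k := measurable_total_weight k.
have K0 : 0 <= K.
  by have /andP[? ?] := hK point; exact: le_trans (h0 point) _.
have fin k : (0 < k)%N -> (\int[P]_w (h w * M_ k w)%:E < +oo)%E.
  move=> k0; apply: (@le_lt_trans _ _ (\int[P]_w (K * M_ k w)%:E)%E).
    apply: mean_le; [exact: measurable_funM|exact: measurable_funM|move=> w].
    have /andP[? ?] := hK w.
    by rewrite mulr_ge0 ?total_weight_ge0//= ler_wpM2r ?total_weight_ge0.
  by rewrite meanZ// ?mean_total_weight ?mule1 ?ltry// => w; exact: total_weight_ge0.
rewrite -(subnKC nm); elim: (m - n)%N => [|k IH]; first by rewrite addn0.
have nk0 : (0 < n + k)%N by rewrite addn_gt0 n0.
rewrite addnS (martingale_step nk0)//; last exact: fin.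
by apply: adapted_sub ah; apply: past_sub; exact: leq_addr.
Qed.

Let pair_power (C p : R) (z : R * R) : R := C * (1 + (z.1 + z.2) `^ p).

Let measurable_pair_power C p : measurable_fun setT (pair_power C p).
Proof.
apply: measurable_funM; first exact: measurable_cst.
apply: measurable_funD; first exact: measurable_cst.
apply: measurableT_comp (@measurable_powR R p) _.
by apply: measurable_funD; [exact: measurable_fst|exact: measurable_snd].
Qed.

Let pair_power_ge0 C p z : 0 <= C -> 0 <= pair_power C p z.
Proof. by move=> C0; rewrite mulr_ge0// addr_ge0// powR_ge0. Qed.

Let mean_pair_power C p : 0 <= C -> 1 < p -> (moment LR0 p <= 1)%E ->
  (\int[P0]_w (pair_power C p (LR0 w))%:E <= (C * (1 + 2 `^ p))%:E)%E.
Proof.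
move=> C0 p1 mp; have p0 : 0 <= p by lra.
have m1 : measurable_fun setT (fun w => (LR0 w).1).
  by apply: measurableT_comp => //; exact: measurable_fst.
have m2 : measurable_fun setT (fun w => (LR0 w).2).
  by apply: measurableT_comp => //; exact: measurable_snd.
have mS : measurable_fun setT (fun w => (LR0 w).1 `^ p + (LR0 w).2 `^ p).
  by apply: measurable_funD; exact: measurable_powR_comp.
have S0 w : 0 <= (LR0 w).1 `^ p + (LR0 w).2 `^ p by rewrite addr_ge0// powR_ge0.
have tp : 0 <= 2 `^ p :> R by exact: powR_ge0.
apply: (@le_trans _ _ (\int[P0]_w (C * (1 + 2 `^ p * ((LR0 w).1 `^ p + (LR0 w).2 `^ p)))%:E)%E).
  apply: mean_le.
  - exact: measurableT_comp (measurable_pair_power C p) _.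
  - apply: measurable_funM => //; apply: measurable_funD => //.
    exact: measurable_funM.
  move=> w; rewrite pair_power_ge0//= /pair_power ler_wpM2l// lerD2l.
  have [l0 r0] := frag_LR0_ge0 proc w; set l := (LR0 w).1 in l0 *; set r := (LR0 w).2 in r0 *.
  have [lr|rl] := leP l r.
  - apply: (@le_trans _ _ ((2 * r) `^ p)).
      by apply: ge0_ler_powR; rewrite ?nnegrE//; lra.
    by rewrite powRM// ler_wpM2l// lerDr powR_ge0.
  - apply: (@le_trans _ _ ((2 * l) `^ p)).
      by apply: ge0_ler_powR; rewrite ?nnegrE//; lra.
    by rewrite powRM// ler_wpM2l// lerDl powR_ge0.
rewrite meanZ//; last 2 first.
- by apply: measurable_funD => //; exact: measurable_funM.
- by move=> w; rewrite addr_ge0// mulr_ge0.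
rewrite meanD//; last 2 first.
- exact: measurable_funM.
- by move=> w; rewrite mulr_ge0.
rewrite mean_cst meanZ// EFinM lee_wpmul2l// EFinD leeD2l//.
by rewrite -[leRHS]mule1 lee_wpmul2l.
Qed.

(** Mean of the expansion [fragmentation_powR] at the [n]-th step: the
    first-order terms on the two sides cancel because [E[L + R] = 1], and the
    hypothesis on the power sum turns [y `^ (k - 1)] times that sum into
    [y `^ k]. *)
Lemma total_weight_powR_step p n (C k y : R) : 1 < p -> (0 < n)%N ->
  (moment LR0 p <= 1)%E -> 0 <= C -> 0 < y <= 1 ->
  (forall x b s, 0 <= b <= x -> 0 <= s ->
    (x + b * (s - 1)) `^ p + p * (x `^ (p - 1) * b) <=
    x `^ p + p * (x `^ (p - 1) * b) * s +
    C * (1 + s `^ p) * (y `^ k * (x `^ (p - 1) * b) + y `^ (k - 1) * b `^ p)) ->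
  (\int[P]_w (M_ n w `^ p)%:E < +oo)%E ->
  (\int[P]_w (S_ n p w)%:E <= y%:E)%E ->
  (\int[P]_w (M_ n.+1 w `^ p)%:E <= \int[P]_w (M_ n w `^ p)%:E +
   (C * (1 + 2 `^ p) * (y `^ k / n%:R))%:E * (\int[P]_w (M_ n w `^ p)%:E + 1))%E.
Proof.
move=> p1 n0 mp C0 y01 ineq fin Sy; have /andP[y0 y1] := y01.
have p0 : 0 <= p by lra.
pose g1 j w := M_ n w `^ (p - 1) * b_ n j w.
pose g2 j w := y `^ k * g1 j w + y `^ (k - 1) * b_ n j w `^ p.
have aM : adapted (past n) (fun w => M_ n w `^ (p - 1)).
  apply: (adapted_comp (f := fun x : R => x `^ (p - 1))).
    exact: measurable_powR.
  exact: adapted_total_weight.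
have M10 w : 0 <= M_ n w `^ (p - 1) by exact: powR_ge0.
have a1 j : adapted (past n) (g1 j).
  by apply: measurable_funM aM _; exact: adapted_weight.
have ab j : adapted (past n) (fun w => b_ n j w `^ p).
  apply: (adapted_comp (f := fun x : R => x `^ p)); first exact: measurable_powR.
  exact: adapted_weight.
have a2 j : adapted (past n) (g2 j).
  by apply: measurable_funD; apply: measurable_funM => //;
    [exact: a1|exact: ab].
have g10 j w : 0 <= g1 j w by rewrite mulr_ge0// ?powR_ge0// weight_ge0.
have yk0 : 0 <= y `^ k by exact: powR_ge0.
have yk10 : 0 <= y `^ (k - 1) by exact: powR_ge0.
have g20 j w : 0 <= g2 j w by rewrite addr_ge0// mulr_ge0// powR_ge0.
have mM j := measurable_total_weight j.
have mMp j := measurable_powR_comp p (mM j).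
have m1 j := adapted_measurable (a1 j).
have m2 j := adapted_measurable (a2 j).
have mi := measurable_split_index n.
have mg1 : measurable_fun setT (fun w => g1 (i_ n w) w).
  exact: measurable_fun_select.
have mg2 : measurable_fun setT (fun w => g2 (i_ n w) w).
  exact: measurable_fun_select.
have mlr : measurable_fun setT
    (fun w => (abs_pair (LR n w)).1 + (abs_pair (LR n w)).2).
  apply: (@measurableT_comp _ _ _ _ _ _ (fun z : R * R => z.1 + z.2)).
    by apply: measurable_funD; [exact: measurable_fst|exact: measurable_snd].
  exact: measurable_abs_pair_LR.
have mpp : measurable_fun setT (fun w => pair_power C p (abs_pair (LR n w))).
  exact: measurableT_comp (measurable_pair_power C p) (measurable_abs_pair_LR n).
have lr0 w : 0 <= (abs_pair (LR n w)).1 + (abs_pair (LR n w)).2.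
  by rewrite addr_ge0// normr_ge0.
have pw w : M_ n.+1 w `^ p + p * g1 (i_ n w) w <= M_ n w `^ p +
    p * (g1 (i_ n w) w * ((abs_pair (LR n w)).1 + (abs_pair (LR n w)).2)) +
    g2 (i_ n w) w * pair_power C p (abs_pair (LR n w)).
  have bx : 0 <= bI n w <= M_ n w.
    by rewrite split_weight_ge0//= split_weight_le_total.
  have := ineq _ _ _ bx (lr0 w).
  have -> : M_ n w + bI n w * ((abs_pair (LR n w)).1 + (abs_pair (LR n w)).2 - 1) =
      M_ n.+1 w.
    have := total_weightS (LR : nat -> T -> R * R) (I : nat -> T -> nat) w n0.
    by move=> h; rewrite mulrBr mulr1 addrA -h addrK.
  move=> h; apply: (le_trans h); rewrite le_eqVlt; apply/orP; left; apply/eqP.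
  by rewrite /g2 /g1 /pair_power /split_weight; ring.
have sum1 : (\sum_(1 <= j < n.+1) \int[P]_w (g1 j w)%:E =
    \int[P]_w (M_ n w `^ p)%:E)%E.
  rewrite -mean_sum//; apply: eq_integral => w _; congr EFin.
  rewrite /g1 -mulr_sumr -/(M_ n w) mulrC powR_mulB1//.
  exact: total_weight_ge0.
have sum2 : (\sum_(1 <= j < n.+1) \int[P]_w (g2 j w)%:E =
    (y `^ k)%:E * \int[P]_w (M_ n w `^ p)%:E +
    (y `^ (k - 1))%:E * \int[P]_w (S_ n p w)%:E)%E.
  have mS := measurable_weight_power n p.
  have S0 w : 0 <= S_ n p w by exact: weight_power_ge0.
  have U0 w : 0 <= M_ n w `^ p by exact: powR_ge0.
  rewrite -mean_sum// -!meanZ// -meanD; [|exact: measurable_funM|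
    exact: measurable_funM|by move=> w; exact: mulr_ge0|
    by move=> w; exact: mulr_ge0].
  apply: eq_integral => w _; congr EFin.
  rewrite /g2 big_split/= -!mulr_sumr -/(M_ n w).
  rewrite -/(S_ n p w) (mulrC (M_ n w `^ (p - 1))) powR_mulB1//.
  exact: total_weight_ge0.
have e1 : (\int[P]_w (g1 (i_ n w) w)%:E =
    (n%:R^-1)%:E * \int[P]_w (M_ n w `^ p)%:E)%E.
  by rewrite integral_select// sum1.
have e1' : (\int[P]_w (g1 (i_ n w) w *
      ((abs_pair (LR n w)).1 + (abs_pair (LR n w)).2))%:E =
    (n%:R^-1)%:E * \int[P]_w (M_ n w `^ p)%:E)%E.
  by rewrite (integral_split n0 a1 g10 measurable_sum2 sum2_ge0) sum1 mean1 mule1.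
have e2 := integral_split n0 a2 g20 (measurable_pair_power C p)
  (fun z => pair_power_ge0 p (abs_pair z) C0).
have : (\int[P]_w (M_ n.+1 w `^ p + p * g1 (i_ n w) w)%:E <=
  \int[P]_w (M_ n w `^ p +
    p * (g1 (i_ n w) w * ((abs_pair (LR n w)).1 + (abs_pair (LR n w)).2)) +
    g2 (i_ n w) w * pair_power C p (abs_pair (LR n w)))%:E)%E.
  apply: mean_le => [||w].
  - by apply: measurable_funD => //; exact: measurable_funM.
  - apply: measurable_funD; last exact: measurable_funM.
    apply: measurable_funD => //; apply: measurable_funM => //.
    exact: measurable_funM.
  - by rewrite pw andbT addr_ge0 ?powR_ge0// mulr_ge0.
have mlg : measurable_fun setT (fun w => g1 (i_ n w) w *
    ((abs_pair (LR n w)).1 + (abs_pair (LR n w)).2)) by exact: measurable_funM.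
have lg0 w : 0 <= g1 (i_ n w) w *
    ((abs_pair (LR n w)).1 + (abs_pair (LR n w)).2) by exact: mulr_ge0.
have mplg : measurable_fun setT (fun w => p * (g1 (i_ n w) w *
    ((abs_pair (LR n w)).1 + (abs_pair (LR n w)).2))) by exact: measurable_funM.
have plg0 w : 0 <= p * (g1 (i_ n w) w *
    ((abs_pair (LR n w)).1 + (abs_pair (LR n w)).2)) by exact: mulr_ge0.
have Mp0 j w : 0 <= M_ j w `^ p by exact: powR_ge0.
rewrite meanD; [|exact: mMp|exact: measurable_funM|exact: Mp0|
  by move=> w; exact: mulr_ge0].
rewrite meanZ; [|exact: mg1|by move=> w|exact: p0].
rewrite [X in (_ <= X)%E]meanD; [|exact: measurable_funD|exact: measurable_funM|
  by move=> w; exact: addr_ge0|by move=> w; rewrite mulr_ge0// pair_power_ge0].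
rewrite [X in (_ <= X + _)%E]meanD; [|exact: mMp|exact: mplg|exact: Mp0|exact: plg0].
rewrite meanZ; [|exact: mlg|exact: lg0|exact: p0].
rewrite e1 e1' e2 sum2.
have U0 : (0 <= \int[P]_w (M_ n w `^ p)%:E)%E.
  by apply: mean_ge0 => w; exact: powR_ge0.
have Ufin : (\int[P]_w (M_ n w `^ p)%:E)%E \is a fin_num by rewrite ge0_fin_numE.
have S0 : (0 <= \int[P]_w (S_ n p w)%:E)%E.
  by apply: mean_ge0 => w; exact: weight_power_ge0.
have pp0 : (0 <= \int[P0]_w (pair_power C p (LR0 w))%:E)%E.
  by apply: mean_ge0 => w; exact: pair_power_ge0.
have := mean_pair_power C0 p1 mp.
move: pp0 Sy S0 U0; rewrite -(fineK Ufin); set u := fine _.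
set s := (\int[P]_w (S_ n p w)%:E)%E; set q := (\int[P0]_w _)%E.
move=> q0 Sy s0 u0 qC h.
rewrite -(@leeD2rE _ (p%:E * ((n%:R^-1)%:E * u%:E))%E)//.
apply: (le_trans h); rewrite addeAC leeD2r//; rewrite leeD2l//.
have n10 : 0 <= n%:R^-1 :> R by [].
apply: (@le_trans _ _ ((n%:R^-1)%:E * ((y `^ k)%:E * u%:E +
   (y `^ (k - 1))%:E * y%:E) * (C * (1 + 2 `^ p))%:E)%E).
  apply: lee_pmul => //.
    by rewrite mule_ge0// adde_ge0// mule_ge0.
  by rewrite lee_wpmul2l// leeD2l// lee_wpmul2l.
suff : n%:R^-1 * (y `^ k * u + y `^ (k - 1) * y) * (C * (1 + 2 `^ p)) <=
    C * (1 + 2 `^ p) * (y `^ k / n%:R) * (u + 1) by rewrite -lee_fin.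
have -> : y `^ (k - 1) * y = y `^ k.
  by rewrite -{2}(powRr1 (ltW y0)) -powRD ?subrK// (gt_eqF y0) implybT.
by rewrite le_eqVlt; apply/orP; left; apply/eqP; ring.
Qed.

(** With [z n = decay c n `^ k], the step multiplies [E[M_n^p] + 1] by at most
    [1 + D * (z n - z n.+1)].  The product of these factors is at most the
    exponential of a telescoping sum, hence bounded. *)
Lemma total_weight_moment_bounded p : 1 < p -> (moment LR0 p < 1)%E ->
  exists B : R, forall n, (0 < n)%N -> (\int[P]_w (M_ n w `^ p)%:E <= B%:E)%E.
Proof.
move=> p1 mp; have [c c01 mc] := moment_lt1_gap mp.
have [C [k [C0 k01 ineq]]] := fragmentation_powR p1.
have /andP[c0 c1] := c01; have /andP[k0 k1] := k01.
pose z n := decay c n `^ k.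
pose D := C * (1 + 2 `^ p) / (c * k).
have D0 : 0 <= D.
  apply: divr_ge0; last by apply: mulr_ge0; exact: ltW.
  by apply: mulr_ge0 => //; rewrite addr_ge0// powR_ge0.
suff H n : (0 < n)%N ->
    (\int[P]_w (M_ n w `^ p)%:E + 1 <= (2 * expR (D * (1 - z n)))%:E)%E.
  exists (2 * expR D) => n n0.
  apply: (@le_trans _ _ (\int[P]_w (M_ n w `^ p)%:E + 1)%E).
    by rewrite leeDl.
  apply: (le_trans (H n n0)); rewrite lee_fin ler_pM2l// ler_expR.
  by apply: ler_piMr => //; rewrite gerBl; exact: powR_ge0.
elim: n => [//|[|n] IH] _.
  under eq_integral do rewrite total_weight1 powR1.
  rewrite mean_cst -EFinD lee_fin.
  have z1 : z 1%N = 1 by rewrite /z decay1 powR1.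
  by rewrite z1 subrr mulr0 expR0; lra.
have {}IH := IH isT.
have U0 : (0 <= \int[P]_w (M_ n.+1 w `^ p)%:E)%E.
  by apply: mean_ge0 => w; exact: powR_ge0.
have Ufin : (\int[P]_w (M_ n.+1 w `^ p)%:E < +oo)%E.
  apply: (@le_lt_trans _ _ (\int[P]_w (M_ n.+1 w `^ p)%:E + 1)%E).
    by rewrite leeDl.
  by apply: (le_lt_trans IH); rewrite ltry.
have y01 : 0 < decay c n.+1 <= 1 by rewrite decay_gt0//= decay_le1.
have := total_weight_powR_step p1 (ltn0Sn n) (ltW mp) C0 y01
  (fun x b s hb hs => ineq x b s _ hb hs y01) Ufin
  (weight_power_decay c01 (ltn0Sn n) mc).
have Ufin' : (\int[P]_w (M_ n.+1 w `^ p)%:E)%E \is a fin_num by rewrite ge0_fin_numE.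
move: IH U0; rewrite -(fineK Ufin').
set u := fine _; rewrite -EFinD !lee_fin => IH u0.
set U' := (\int[P]_w (M_ n.+2 w `^ p)%:E)%E; rewrite -EFinM -EFinD => h.
apply: (@le_trans _ _ ((u + C * (1 + 2 `^ p) * (decay c n.+1 `^ k / n.+1%:R) *
   (u + 1))%:E + 1)%E); first by rewrite leeD2r.
rewrite -EFinD lee_fin.
apply: (@le_trans _ _ ((u + 1) * (1 + D * (z n.+1 - z n.+2)))).
  have := powR_decay_telescope c01 k01 (ltn0Sn n); rewrite -/(z n.+1) -/(z n.+2).
  set t := z n.+1 / _; set v := z n.+1 - z n.+2 => tv.
  have CC0 : 0 <= C * (1 + 2 `^ p) by rewrite mulr_ge0// addr_ge0// powR_ge0.
  have : C * (1 + 2 `^ p) * t <= D * v.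
    rewrite /D [leRHS]mulrAC -[leRHS]mulrA; exact: ler_wpM2l.
  by set a := _ * t; set b := D * v; nra.
apply: (@le_trans _ _ (2 * expR (D * (1 - z n.+1)) * expR (D * (z n.+1 - z n.+2)))).
  apply: ler_pM => //.
  - by lra.
  - rewrite addr_ge0// mulr_ge0// subr_ge0.
    apply: ge0_ler_powR; rewrite ?nnegrE ?(ltW (decay_gt0 c01 _))//; first exact: ltW.
    exact: decay_nonincreasing.
  - exact: expR_ge1Dx.
rewrite -mulrA -expRD le_eqVlt; apply/orP; left; apply/eqP.
by congr (_ * expR _); ring.
Qed.

(** * The limit of the total weight *)

Variable Minf : {RV P >-> R}.
Hypothesis Minf_lim : {ae P, forall w, M_ n w @[n --> \oo] --> Minf w}.

Let mabs : measurable_fun setT (fun w => `|Minf w|).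
Proof. exact: measurableT_comp. Qed.

Lemma ae_limit_mass_ge0 : {ae P, forall w, 0 <= Minf w}.
Proof.
apply: filterS Minf_lim => w Mw; apply: (cvgr_to_ge Mw).
by apply: nearW => n; exact: total_weight_ge0.
Qed.

(** The limit is nonnegative only almost surely; its absolute value is a
    version that is nonnegative everywhere, as the means below require. *)
Lemma ae_limit_mass_abs : {ae P, forall w, M_ n w @[n --> \oo] --> `|Minf w|}.
Proof.
by apply: filterS2 Minf_lim ae_limit_mass_ge0 => w Mw M0; rewrite ger0_norm.
Qed.

Lemma limit_mass_moment_le (p : R) (B : \bar R) : 0 < p ->
  (\forall n \near \oo, (\int[P]_w (M_ n w `^ p)%:E <= B)%E) ->
  (\int[P]_w (`|Minf w| `^ p)%:E <= B)%E.
Proof.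
move=> p0; apply: mean_fatou.
- by move=> n; apply: measurable_powR_comp; exact: measurable_total_weight.
- exact: measurable_powR_comp.
- by move=> n w; exact: powR_ge0.
apply: filterS ae_limit_mass_abs => w Mw.
by apply: cvgn_powR => // n; exact: total_weight_ge0.
Qed.

(** For [gamma < 1] the power is subadditive: [M_n^gamma] is dominated by the
    power sum, whose mean tends to [0]. *)
Lemma subcritical_limit_mass0 gamma : 0 < gamma < 1 ->
  (moment LR0 gamma < 1)%E -> {ae P, forall w, Minf w = 0}.
Proof.
move=> /andP[g0 g1] mg.
have [c c01 mc] := moment_lt1_gap mg.
have : (\int[P]_w (`|Minf w| `^ gamma)%:E <= 0)%E.
  apply/lee_addgt0Pr => e e0; rewrite add0e; apply: limit_mass_moment_le => //.
  have /cvgrPdist_le/(_ _ e0)[N _ HN] := decay_cvg0 c01.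
  exists N.+1 => // n /= Nn; have n0 : (0 < n)%N by exact: leq_trans Nn.
  apply: (@le_trans _ _ (\int[P]_w (S_ n gamma w)%:E)%E).
    apply: mean_le => [||w].
    - by apply: measurable_powR_comp; exact: measurable_total_weight.
    - exact: measurable_weight_power.
    - rewrite powR_ge0/=; apply: powR_sum_le; first by rewrite g0 ltW.
      by move=> j; exact: weight_ge0.
  apply: (le_trans (weight_power_decay c01 n0 mc)).
  have := HN n (ltnW Nn); rewrite sub0r normrN lee_fin.
  by apply: le_trans; exact: ler_norm.
have I0 : (0 <= \int[P]_w (`|Minf w| `^ gamma)%:E)%E.
  by apply: mean_ge0 => w; exact: powR_ge0.
move=> Ile; have /eqP : (\int[P]_w (`|Minf w| `^ gamma)%:E)%E == 0%E.
  by rewrite eq_le Ile I0.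
move=> I00.
have mf : measurable_fun setT (fun w => (`|Minf w| `^ gamma)%:E).
  by apply/measurable_EFinP; exact: measurable_powR_comp.
have [H _] := ae_eq_integral_abs P measurableT mf.
have /H : (\int[P]_w `|(`|Minf w| `^ gamma)%:E|)%E = 0%E.
  by rewrite -[RHS]I00; apply: eq_integral => w _; rewrite gee0_abs// lee_fin powR_ge0.
apply: filterS => w /(_ Logic.I)/= [/powR_eq0_eq0/normr0_eq0 //].
Qed.

(** The bound in [L^g] makes the martingale uniformly integrable: above
    a level [A] the mean of [M_m] is at most [A `^ (1 - g) * B], and below it
    bounded convergence applies.  So no mass is lost in the limit, and [M_n] is
    dominated by the conditional mean of the limit. *)
Lemma mean_limit_mass_ge n (h : T -> R) (K B g : R) : (0 < n)%N -> 1 < g ->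
  (forall m, (0 < m)%N -> (\int[P]_w (M_ m w `^ g)%:E <= B%:E)%E) ->
  adapted (past n) h -> (forall w, 0 <= h w <= K) ->
  (\int[P]_w (h w * M_ n w)%:E <= \int[P]_w (h w * `|Minf w|)%:E)%E.
Proof.
move=> n0 g1 MB ah hK; have mh := adapted_measurable ah.
have h0 w : 0 <= h w by have /andP[] := hK w.
have mM k := measurable_total_weight k.
have M0 k w : 0 <= M_ k w by exact: total_weight_ge0.
have K0 : 0 <= K by have /andP[? ?] := hK point; exact: le_trans (h0 point) _.
have B0 : 0 <= B.
  rewrite -lee_fin (le_trans _ (MB 1%N isT))//.
  by apply: mean_ge0 => w; exact: powR_ge0.
apply/lee_addgt0Pr => e e0.
(* The level [A] is such that [K * A `^ (1 - g) * B <= e]. *)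
pose D := (K * B + 1) / e.
have KB1 : 0 < K * B + 1 by rewrite ltr_wpDl// mulr_ge0.
have D0 : 0 < D by rewrite divr_gt0.
pose A := D `^ (g - 1)^-1.
have A0 : 0 < A by exact: powR_gt0.
have AD : A `^ (1 - g) = D^-1.
  rewrite /A -powRrM (_ : _ * _ = -1) ?powR_inv1 ?ltW//.
  rewrite (_ : 1 - g = - (g - 1)); last by ring.
  by rewrite mulrN mulVf// subr_eq0 gt_eqF.
have KBA : K * (A `^ (1 - g) * B) <= e.
  have -> : K * (A `^ (1 - g) * B) = e * (K * B / (K * B + 1)).
    by rewrite AD /D; field; rewrite !gt_eqF.
  apply: ler_piMr; first exact: ltW.
  by rewrite ler_pdivrMr// mul1r lerDl.
have mmin m : measurable_fun setT (fun w => h w * Num.min (M_ m w) A).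
  by apply: measurable_funM => //; exact: measurable_minr.
have mminf : measurable_fun setT (fun w => h w * Num.min `|Minf w| A).
  by apply: measurable_funM => //; exact: measurable_minr.
have min0 (x : R) : 0 <= x -> 0 <= Num.min x A.
  by move=> x0; rewrite le_min x0 ltW.
have cvgmin : (\int[P]_w (h w * Num.min (M_ m w) A)%:E)%E @[m --> \oo] -->
    (\int[P]_w (h w * Num.min `|Minf w| A)%:E)%E.
  apply: (@mean_bounded_cvg _ _ _ _ _ _ (K * A)) => //.
    move=> m w; rewrite ger0_norm ?mulr_ge0 ?min0//.
    have /andP[? hKw] := hK w.
    by apply: ler_pM => //; [exact: min0|rewrite ge_min lexx orbT].
  apply: filterS ae_limit_mass_abs => w Mw; apply: cvgM; first exact: cvg_cst.
  exact: cvgn_minl.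
apply: (@le_trans _ _ (\int[P]_w (h w * Num.min `|Minf w| A)%:E + e%:E)%E); last first.
  rewrite leeD2r//; apply: mean_le => //; first exact: measurable_funM.
  by move=> w; rewrite mulr_ge0 ?min0//= ler_wpM2l// ge_min lexx.
have : (\int[P]_w (h w * Num.min (M_ m w) A)%:E + e%:E)%E @[m --> \oo] -->
    (\int[P]_w (h w * Num.min `|Minf w| A)%:E + e%:E)%E.
  by apply: cvgeD => //; [exact: fin_num_adde_defl|exact: cvg_cst].
move/cvge_to_ge; apply; exists n => // m /= nm.
rewrite -(martingale (m := m) _ ah hK) ?n0//.
have mg : measurable_fun setT (fun w => K * (A `^ (1 - g) * M_ m w `^ g)).
  apply: measurable_funM => //; apply: measurable_funM => //.
  exact: measurable_powR_comp.
apply: (@le_trans _ _ (\int[P]_w (h w * Num.min (M_ m w) A +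
    K * (A `^ (1 - g) * M_ m w `^ g))%:E)%E).
  apply: mean_le => [||w]; [exact: measurable_funM|exact: measurable_funD|].
  rewrite mulr_ge0//=; have /andP[hw0 hKw] := hK w.
  have [MA|AM] := leP (M_ m w) A.
    by rewrite lerDl !mulr_ge0// powR_ge0.
  apply: (@le_trans _ _ (K * (A `^ (1 - g) * M_ m w `^ g))); last first.
    by rewrite lerDr mulr_ge0// ltW.
  apply: ler_pM => //.
  have Mm0 : 0 < M_ m w by exact: lt_trans AM.
  rewrite -{1}(powRr1 (M0 m w)) -{1}(subrK g 1) powRD; last by rewrite (gt_eqF Mm0) implybT.
  rewrite ler_wpM2r ?powR_ge0// (_ : 1 - g = - (g - 1)); last by ring.
  rewrite !powRN lef_pV2 ?posrE ?powR_gt0//.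
  by apply: ge0_ler_powR; rewrite ?nnegrE ?subr_ge0//; exact: ltW.
rewrite meanD//; last 2 first.
- by move=> w; rewrite mulr_ge0 ?min0.
- by move=> w; rewrite !mulr_ge0// powR_ge0.
rewrite leeD2l// meanZ//; last 2 first.
- apply: measurable_funM => //; exact: measurable_powR_comp.
- by move=> w; rewrite mulr_ge0// powR_ge0.
rewrite meanZ//; last 3 first.
- exact: measurable_powR_comp.
- by move=> w; exact: powR_ge0.
- exact: powR_ge0.
apply: (@le_trans _ _ (K%:E * ((A `^ (1 - g))%:E * B%:E))%E).
  rewrite lee_wpmul2l// lee_wpmul2l ?lee_fin ?powR_ge0//.
  by apply: MB; exact: leq_trans nm.
by rewrite -!EFinM lee_fin.
Qed.

Lemma ae_conservative n : (0 < n)%N ->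
  {ae P0, forall w, (LR0 w).1 + (LR0 w).2 = 1} ->
  {ae P, forall w, (LR n w).1 + (LR n w).2 = 1}.
Proof.
move=> n0 [N [mN PN0 subN]].
pose B := [set z : R * R | z.1 + z.2 = 1].
have mB : measurable B.
  have ms : measurable_fun setT (fun z : R * R => z.1 + z.2).
    by apply: measurable_funD; [exact: measurable_fst|exact: measurable_snd].
  rewrite (_ : B = (fun z : R * R => z.1 + z.2) @^-1` [set 1])//.
  by rewrite -[X in measurable X]setTI; apply: ms.
have mBC := measurableC mB.
exists (LR n @^-1` (~` B)); split.
- exact: measurable_funPTI.
- have := frag_LR_law proc n0 mBC; rewrite /distribution/= /pushforward/= => ->.
  apply/eqP; rewrite eq_le measure_ge0 andbT -PN0.
  apply: le_measure; [rewrite inE; exact: measurable_funPTI|by rewrite inE|].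
  exact: subN.
- by [].
Qed.

Lemma conservative_limit_mass : {ae P0, forall w, (LR0 w).1 + (LR0 w).2 = 1} ->
  {ae P, forall w, Minf w = 1}.
Proof.
move=> H0.
have H1 : {ae P, forall w, forall k, (LR k.+1 w).1 + (LR k.+1 w).2 = 1}.
  by apply: ae_foralln => k; exact: ae_conservative.
have H2 : {ae P, forall w, forall k, 0 <= (LR k.+1 w).1 /\ 0 <= (LR k.+1 w).2}.
  by apply: ae_foralln => k; exact: ae_LR_ge0.
have H12 : {ae P, forall w, (forall k, (LR k.+1 w).1 + (LR k.+1 w).2 = 1) /\
    (forall k, 0 <= (LR k.+1 w).1 /\ 0 <= (LR k.+1 w).2)}.
  by apply: filterS2 H1 H2 => w h1 h2; split.
apply: filterS2 H12 Minf_lim => w [h1 h2] Mw.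
have M1 n : M_ n.+1 w = 1.
  elim: n => [|n IH]; first by rewrite total_weight1.
  have := total_weightS (LR : nat -> T -> R * R) (I : nat -> T -> nat) w (ltn0Sn n).
  have [l0 r0] := h2 n.
  by rewrite IH /abs_pair/= !ger0_norm// h1 mulr1 => /addIr.
have cvg1 : M_ n w @[n --> \oo] --> (1 : R).
  by apply: cvg_near_cst; exists 1%N => // -[|n] //= _; rewrite M1.
exact: cvg_unique Mw cvg1.
Qed.

Section FiniteMoments.

Variable gamma : R.
Hypothesis gamma1 : 1 < gamma.
Hypothesis mgamma : (moment LR0 gamma < 1)%E.

Lemma mean_limit_mass_ge1 : (1 <= \int[P]_w (`|Minf w|)%:E)%E.
Proof.
have [B MB] := total_weight_moment_bounded gamma1 mgamma.
have h1 (w : T) : 0 <= (fun=> 1 : R) w <= 1 by rewrite ler01 lexx.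
have := mean_limit_mass_ge (ltn0Sn 0) gamma1 MB
  (measurable_cst (1 : R)) h1.
rewrite (eq_integral (fun w => (M_ 1%N w)%:E)) => [|w _]; last by rewrite mul1r.
rewrite [in leRHS](eq_integral (fun w => `|Minf w|%:E)) => [|w _]; last by rewrite mul1r.
by rewrite (mean_total_weight (ltn0Sn 0)).
Qed.

(** Conditional Jensen inequality on the event [e = 1] of the past.  With [z]
    the truncation of [M_n] at [k], [mean_limit_mass_ge] is applied to
    [z `^ (p - 1) * e], and the tangent inequality
    [p * z `^ (p - 1) * M <= M `^ p + (p - 1) * z `^ p] lets the last term be
    absorbed; the truncation keeps that term finite. *)
Lemma limit_mass_dominates n p (e : T -> R) : (0 < n)%N -> 1 < p ->
  adapted (past n) e -> (forall w, e w = 0 \/ e w = 1) ->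
  (\int[P]_w (M_ n w `^ p * e w)%:E <= \int[P]_w (`|Minf w| `^ p * e w)%:E)%E.
Proof.
move=> n0 p1 ae e01; have p0 : 0 < p by lra.
have me := adapted_measurable ae.
have e0 w : 0 <= e w by case: (e01 w) => ->.
have [B MB] := total_weight_moment_bounded gamma1 mgamma.
have mM := measurable_total_weight n.
have M0 w : 0 <= M_ n w by exact: total_weight_ge0.
set J := (\int[P]_w (`|Minf w| `^ p * e w)%:E)%E.
have absorb (x y : \bar R) : x \is a fin_num ->
    (p%:E * x <= y + (p - 1)%:E * x)%E -> (x <= y)%E.
  case: x => // u _ h; rewrite -(@leeD2rE _ ((p - 1)%:E * u%:E)%E)//.
  by apply: le_trans h; rewrite -!EFinM -EFinD lee_fin; lra.
have key (k : nat) : (\int[P]_w (Num.min (M_ n w) k%:R `^ p * e w)%:E <= J)%E.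
  pose z w := Num.min (M_ n w) k%:R.
  have z0 w : 0 <= z w by rewrite le_min M0/=.
  have az : adapted (past n) z.
    apply: (adapted_comp (f := fun x : R => Num.min x k%:R)).
      exact: measurable_minr.
    exact: adapted_total_weight.
  have ah : adapted (past n) (fun w => z w `^ (p - 1) * e w).
    apply: measurable_funM ae => //.
    apply: (adapted_comp (f := fun x : R => x `^ (p - 1))) az.
    exact: measurable_powR.
  have mz := adapted_measurable az.
  have mh := adapted_measurable ah.
  have mzp : measurable_fun setT (fun w => z w `^ p * e w).
    by apply: measurable_funM => //; exact: measurable_powR_comp.
  have mJ : measurable_fun setT (fun w => `|Minf w| `^ p * e w).
    by apply: measurable_funM => //; exact: measurable_powR_comp.
  have zk w : z w <= k%:R by rewrite ge_min lexx orbT.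
  have hk w : 0 <= z w `^ (p - 1) * e w <= k%:R `^ (p - 1).
    rewrite mulr_ge0 ?powR_ge0//=; case: (e01 w) => ->.
      by rewrite mulr0 powR_ge0.
    rewrite mulr1; apply: ge0_ler_powR; [by lra|exact: z0|exact: ler0n|exact: zk].
  have H := mean_limit_mass_ge n0 gamma1 MB ah hk.
  have h0 w : 0 <= z w `^ (p - 1) * e w by rewrite mulr_ge0 ?powR_ge0.
  have zp0 w : 0 <= z w `^ p * e w by rewrite mulr_ge0 ?powR_ge0.
  set Ik := (\int[P]_w (Num.min (M_ n w) k%:R `^ p * e w)%:E)%E.
  have Ik0 : (0 <= Ik)%E by exact: mean_ge0.
  have Ikfin : Ik \is a fin_num.
    rewrite ge0_fin_numE//; apply: (@le_lt_trans _ _ (k%:R `^ p)%:E); last exact: ltry.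
    apply: mean_le_cst => // w; rewrite zp0/=; case: (e01 w) => ->.
      by rewrite mulr0 powR_ge0.
    rewrite mulr1; apply: ge0_ler_powR; [exact: ltW|exact: z0|exact: ler0n|exact: zk].
  have IkH : (Ik <= \int[P]_w (z w `^ (p - 1) * e w * `|Minf w|)%:E)%E.
    apply: le_trans H; apply: mean_le => //; first exact: measurable_funM.
    move=> w; rewrite zp0/= -/(z w) -(powR_mulB1 (z0 w) p1).
    rewrite [z w * _]mulrC -!mulrA ler_wpM2l ?powR_ge0// mulrC ler_wpM2l//.
    by rewrite ge_min lexx.
  have p1z : 0 <= p - 1 by lra.
  have : (p%:E * Ik <= J + (p - 1)%:E * Ik)%E.
    apply: (@le_trans _ _ (p%:E * \int[P]_w (z w `^ (p - 1) * e w * `|Minf w|)%:E)%E).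
      by rewrite lee_wpmul2l// lee_fin ltW.
    rewrite -meanZ; [|exact: measurable_funM|by move=> w; rewrite mulr_ge0|exact: ltW].
    rewrite -meanZ// -meanD; [|exact: mJ|exact: measurable_funM|
      by move=> w; rewrite mulr_ge0// powR_ge0|
      by move=> w; exact: (mulr_ge0 p1z (zp0 w))].
    apply: mean_le.
    - by apply: measurable_funM => //; exact: measurable_funM.
    - by apply: measurable_funD => //; exact: measurable_funM.
    move=> w; rewrite mulr_ge0 ?(ltW p0) ?mulr_ge0 ?powR_ge0//=.
    have := powR_tangent p1 (normr_ge0 (Minf w)) (z0 w).
    case: (e01 w) => ->; first by rewrite !(mulr0, mul0r, addr0).
    by rewrite !mulr1 -/(z w) mulrA mulrAC.
  exact: absorb.
have mMp k : measurable_fun setT (fun w => Num.min (M_ n w) k%:R `^ p * e w).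
  by apply: measurable_funM => //; apply: measurable_powR_comp; exact: measurable_minr.
apply: (mean_fatou mMp) => //.
- by apply: measurable_funM => //; exact: measurable_powR_comp.
- by move=> k w; rewrite mulr_ge0// powR_ge0.
- apply: aeW => w; apply: cvg_near_cst.
  exists (Num.truncn (M_ n w)).+1 => // k /= fk.
  have Mk : M_ n w <= k%:R.
    by apply: ltW; apply: lt_le_trans (truncnS_gt _) _; rewrite ler_nat.
  by rewrite (min_idPl Mk).
- exact: nearW.
Qed.

(** If [S(p) >= 0] the power sums [S_n(p)] have mean at least [1].  Where
    [S_n(gamma) <= delta] every weight is small, and [S_n(p) <= M_n / 4]; on the
    complement [S_n(p) <= M_n^p], whose mean is dominated there by that of the
    integrable [M^p] and is small since the event becomes improbable.  The
    total is at most [3 / 4] for large [n]. *)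
Lemma finite_moment_subcritical p : 1 < p ->
  (\int[P]_w (`|Minf w| `^ p)%:E < +oo)%E -> (moment LR0 p < 1)%E.
Proof.
move=> p1 fin; rewrite ltNge; apply/negP => mp.
have p0 : 0 < p by lra.
have g0 : 0 < gamma := lt_trans ltr01 gamma1.
have mM n := measurable_total_weight n.
have mS n s := measurable_weight_power n s.
have M0 n w : 0 <= M_ n w by exact: total_weight_ge0.
have mZ : measurable_fun setT (fun w => `|Minf w| `^ p) by exact: measurable_powR_comp.
(* The power sums are dominated by [M_n^p], hence by [M^p] in mean. *)
have Sfin n : (0 < n)%N -> (\int[P]_w (S_ n p w)%:E < +oo)%E.
  move=> n0; apply: le_lt_trans fin.
  have := @limit_mass_dominates n p (cst 1) n0 p1 (measurable_cst (1 : R))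
    (fun=> or_intror erefl).
  under [X in (_ <= X)%E -> _]eq_integral do rewrite mulr1.
  apply: le_trans; apply: mean_le => //.
    by apply: measurable_funM => //; exact: measurable_powR_comp.
  move=> w; rewrite weight_power_ge0/= mulr1; apply: sum_powR_le; first exact: ltW.
  by move=> j; exact: weight_ge0.
have S1 := weight_power_ge1 mp Sfin.
pose q := (p - 1) / gamma.
have q0 : 0 < q by rewrite divr_gt0// subr_gt0.
(* Chosen so that weights with [b `^ gamma <= delta] satisfy
   [b `^ (p - 1) <= 1 / 4]. *)
pose delta : R := 4^-1 `^ q^-1.
have de0 : 0 < delta by exact: powR_gt0.
have deq : delta `^ q = 4^-1 by rewrite /delta -powRrM mulVf ?gt_eqF// powRr1.
pose e n w : R := (delta < S_ n gamma w)%R%:R.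
have ae n : adapted (past n) (e n).
  apply: (adapted_comp (f := fun x : R => (delta < x)%R%:R : R)).
    apply: (@measurableT_comp _ _ _ _ _ _ (fun b : bool => b%:R : R)) => //.
    exact: measurable_fun_ltr.
  exact: adapted_weight_power.
have e01 n w : e n w = 0 \/ e n w = 1.
  by rewrite /e; case: (_ < _); [right|left].
have me n := adapted_measurable (ae n).
have e0 n w : 0 <= e n w by case: (e01 n w) => ->.
have split_S n w : S_ n p w <= 4^-1 * M_ n w + M_ n w `^ p * e n w.
  rewrite /e; have [_|Sd] := ltP delta (S_ n gamma w).
    rewrite mulr1 ler_wpDl ?mulr_ge0//.
    by apply: sum_powR_le; [exact: ltW|move=> j; exact: weight_ge0].
  rewrite mulr0 addr0 /total_weight mulr_sumr /weight_power.
  rewrite big_seq [leRHS]big_seq; apply: ler_sum => j jn.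
  rewrite -(powR_mulB1 (weight_ge0 _ _ _ _ _) p1) mulrC ler_wpM2r ?weight_ge0//.
  have bj : b_ n j w `^ gamma <= delta.
    apply: le_trans Sd; rewrite /weight_power (bigD1_seq j) ?iota_uniq//=.
    by rewrite lerDl sumr_ge0// => k _; exact: powR_ge0.
  rewrite -deq (_ : p - 1 = gamma * q); last by rewrite /q mulrC divfK ?gt_eqF.
  rewrite powRrM; apply: ge0_ler_powR; rewrite ?nnegrE ?powR_ge0//; exact: ltW.
have fourV : 0 < 4^-1 :> R by [].
have [A A0 tail] := mean_tail mZ (fun w => powR_ge0 _ _) fin fourV.
have [c c01 mc] := moment_lt1_gap mgamma.
have eA : 0 < delta * (4^-1 / A) by rewrite mulr_gt0// divr_gt0.
have /cvgrPdist_le/(_ _ eA)[N _ HN] := decay_cvg0 c01.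
pose n := N.+1; have n0 : (0 < n)%N by [].
have dn : decay c n <= delta * (4^-1 / A).
  have := HN n (leqnSn N); rewrite sub0r normrN; apply: le_trans; exact: ler_norm.
have en : (\int[P]_w (e n w)%:E <= (4^-1 / A)%:E)%E.
  have : (\int[P]_w (delta * e n w)%:E <= (delta * (4^-1 / A))%:E)%E.
    apply: (@le_trans _ _ (\int[P]_w (S_ n gamma w)%:E)%E).
      apply: mean_le => [||w]; [exact: measurable_funM|exact: mS|].
      rewrite mulr_ge0 ?(ltW de0)//= /e.
      by have [/ltW|] := ltP delta (S_ n gamma w); rewrite ?mulr1// mulr0 weight_power_ge0.
    by rewrite (le_trans (weight_power_decay c01 n0 mc))// lee_fin.
  by rewrite meanZ ?(ltW de0)// EFinM lee_pmul2l// lte_fin.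
have : (1 <= (4^-1 + (4^-1 + 4^-1) : R)%:E)%E.
  apply: (le_trans (S1 n n0)).
  apply: (@le_trans _ _ (\int[P]_w (4^-1 * M_ n w + M_ n w `^ p * e n w)%:E)%E).
    apply: mean_le => [||w]; first exact: mS.
      by apply: measurable_funD; apply: measurable_funM => //; exact: measurable_powR_comp.
    by rewrite weight_power_ge0/=.
  rewrite meanD//; last 4 first.
  - exact: measurable_funM.
  - by apply: measurable_funM => //; exact: measurable_powR_comp.
  - by move=> w; rewrite mulr_ge0.
  - by move=> w; rewrite mulr_ge0// powR_ge0.
  rewrite EFinD leeD//.
    by rewrite meanZ// (mean_total_weight n0) mule1.
  apply: (le_trans (limit_mass_dominates n0 p1 (ae n) (e01 n))).
  apply: (@le_trans _ _ (\int[P]_w (A * e n w +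
    (`|Minf w| `^ p - Num.min (`|Minf w| `^ p) A))%:E)%E).
    apply: mean_le => [||w].
    - exact: measurable_funM.
    - apply: measurable_funD; first exact: measurable_funM.
      by apply: measurable_funB => //; exact: measurable_minr.
    rewrite mulr_ge0 ?powR_ge0//=; set x := _ `^ p.
    have x0 : 0 <= x by exact: powR_ge0.
    have : Num.min x A <= A by rewrite ge_min lexx orbT.
    have : Num.min x A <= x by rewrite ge_min lexx.
    by case: (e01 n w) => ->; lra.
  rewrite meanD//; last 4 first.
  - exact: measurable_funM.
  - by apply: measurable_funB => //; exact: measurable_minr.
  - by move=> w; rewrite mulr_ge0// ltW.
  - by move=> w; rewrite subr_ge0 ge_min lexx.
  rewrite EFinD leeD// meanZ ?(ltW A0)//.
  apply: (@le_trans _ _ (A%:E * (4^-1 / A)%:E)%E).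
    by rewrite lee_pmul2l// lte_fin.
  by rewrite -EFinM lee_fin mulrC divfK// gt_eqF.
by rewrite lee_fin; lra.
Qed.

End FiniteMoments.

(** * Weighted law of large numbers *)

Variable X0 : {RV P0 >-> R}.
Hypothesis X_law : forall n, (0 < n)%N -> same_law (X n) X0.
Hypothesis X0_int : P0.-integrable [set: T0] (EFin \o X0).
Variable m0 : R.
Hypothesis m0E : (\int[P0]_w (X0 w)%:E = m0%:E)%E.
Variable gamma : R.
Hypothesis gamma0 : 0 < gamma.
Hypothesis mgamma : (moment LR0 gamma < 1)%E.

Definition weighted_sum (n : nat) (w : T) : R := \sum_(1 <= j < n.+1) b_ n j w * X j w.

Definition variables_upto (n m : nat) : set (nat * nat) :=
  past n `|` [set v | v.1 = 0%N /\ (0 < v.2 <= m)%N].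

Lemma variables_upto_index n m : variables_upto n m `<=` var_index.
Proof.
move=> v [/past_var_index//|[v0 /andP[v1 _]]].
by left; rewrite v0 v1.
Qed.

Lemma adapted_weighted_term n m j : (0 < j <= m)%N ->
  adapted (variables_upto n m) (fun w => b_ n j w * X j w).
Proof.
move=> jm; apply: measurable_funM.
  by apply: (adapted_sub _ (@adapted_weight n j)) => v ?; left.
by apply: adapted_X; right.
Qed.

Lemma measurable_weighted_sum n : measurable_fun setT (weighted_sum n).
Proof.
apply: measurable_sum => j; apply: measurable_funM => //.
exact: measurable_weight.
Qed.

(** Three sources of error, each given a third of [e]: the event that
    some weight is large (measured by [S_n(gamma) > delta], improbable since the
    mean of [S_n(gamma)] tends to [0]); the clipped centred variables, an
    orthogonal sum whose second moment is at most [(2 * K) ^+ 2] times the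
    largest weight, as the weights have total mean [1]; and the parts clipped
    off together with the change of mean they cause, at most [2 * e1] in
    mean. *)
Lemma weighted_sum_concentration (e rho : R) : 0 < e -> 0 < rho ->
  exists N : nat, forall n, (N <= n)%N ->
  (\int[P]_w ((rho < `|weighted_sum n w - m0 * M_ n w|)%R%:R)%:E <= e%:E)%E.
Proof.
move=> e0 rho0.
have mX0 : measurable_fun setT (fun w => `|X0 w|) by exact: measurableT_comp.
have X0fin : (\int[P0]_w `|X0 w|%:E < +oo)%E.
  by move/integrableP : X0_int => [_]; apply: le_lt_trans.
(* The constants make [2 / rho * (e1 + e1)] and, below,
   [4 / rho ^+ 2 * ((2 * K) ^+ 2 * eta)] equal to [e / 3]. *)
pose e1 := e * rho / 12.
have e10 : 0 < e1 by rewrite !mulr_gt0.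
have [K K0 tail] := mean_tail mX0 (fun w => normr_ge0 _) X0fin e10.
have K0' := ltW K0.
have mclip := @measurable_clip R K.
have ctail : (\int[P0]_w `|X0 w - clip K (X0 w)|%:E <= e1%:E)%E.
  by under eq_integral do rewrite clip_dist//.
have iclip : P0.-integrable setT (EFin \o (fun w => clip K (X0 w))).
  apply: (@bounded_integrable _ _ _ _ _ K); first exact: measurableT_comp.
  by move=> w; exact: clip_le.
pose mu := fine (\int[P0]_w (clip K (X0 w))%:E)%E.
have muE : (\int[P0]_w (clip K (X0 w))%:E = mu%:E)%E.
  by rewrite fineK//; exact: (integrable_fin_num measurableT iclip).
have m0mu : `|m0 - mu| <= e1.
  rewrite -lee_fin; apply: le_trans ctail.
  have -> : (`|m0 - mu|%:E = `| \int[P0]_w (X0 w - clip K (X0 w))%:E |)%E.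
    rewrite (eq_integral (fun w => (X0 w)%:E - (clip K (X0 w))%:E)%E)//.
    by rewrite (integralB measurableT X0_int iclip) m0E muE.
  apply: le_abse_integral => //; apply/measurable_EFinP.
  by apply: measurable_funB => //; exact: measurableT_comp.
pose C j w := clip K (X j w) - mu.
have muK : `|mu| <= K.
  rewrite -lee_fin -abse_EFin -muE.
  apply: le_trans (le_abse_integral _ _ _) _ => //.
    by apply/measurable_EFinP; exact: measurableT_comp.
  apply: mean_le_cst => [|w]; last by rewrite normr_ge0/= clip_le.
  by apply: measurableT_comp => //; exact: measurableT_comp.
have CK j w : `|C j w| <= 2 * K.
  rewrite (le_trans (ler_normB _ _))// mulr_natl mulr2n lerD//.
  exact: clip_le.
have mC j : measurable_fun setT (C j).
  by apply: measurable_funB => //; exact: measurableT_comp.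
have C0 j : (0 < j)%N -> (\int[P]_w (C j w)%:E = 0)%E.
  move=> j0; rewrite (eq_integral (fun w => (clip K (X j w))%:E - mu%:E)%E)//.
  have ij : P.-integrable setT (EFin \o (fun w => clip K (X j w))).
    apply: (@bounded_integrable _ _ _ _ _ K); first exact: measurableT_comp.
    by move=> w; exact: clip_le.
  have imu : P.-integrable setT (EFin \o (cst mu : T -> R)).
    exact: finite_measure_integrable_cst.
  rewrite (integralB measurableT ij imu)/= mean_cst.
  rewrite (same_law_bounded_mean (X_law j0) mclip (fun x => clip_le x K0')) muE.
  by rewrite subee.
pose eta := e * rho ^+ 2 / (48 * K ^+ 2).
have eta0 : 0 < eta by rewrite divr_gt0 ?mulr_gt0 ?exprn_gt0.
(* A power sum [S_n(gamma) <= delta] forces every weight below [eta]. *)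
pose delta := eta `^ gamma.
have delta0 : 0 < delta by exact: powR_gt0.
have [c c01 mc] := moment_lt1_gap mgamma.
have de0 : 0 < delta * (e / 3) by rewrite mulr_gt0// divr_gt0.
have /cvgrPdist_le/(_ _ de0)[N _ HN] := decay_cvg0 c01.
exists N.+1 => n Nn; have n0 : (0 < n)%N by exact: leq_trans Nn.
have dn : decay c n <= delta * (e / 3).
  have := HN n (ltnW Nn); rewrite sub0r normrN; apply: le_trans; exact: ler_norm.
pose small w : R := (S_ n gamma w <= delta)%R%:R.
have asmall : adapted (past n) small.
  apply: (adapted_comp (f := fun x : R => (x <= delta)%R%:R : R)).
    apply: (@measurableT_comp _ _ _ _ _ _ (fun b : bool => b%:R : R)) => //.
    exact: measurable_fun_ler.
  exact: adapted_weight_power.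
have msmall := adapted_measurable asmall.
have s01 w : 0 <= small w <= 1 by rewrite /small ler0n lern1 leq_b1.
(* The indicator [small] is put into the coefficients, which are then
   bounded by [eta] and still determined by the past. *)
pose cc j : T -> R := if (0 < j <= n)%N then fun w => b_ n j w * small w else cst 0.
have acc j : adapted (past n) (cc j).
  rewrite /cc; case: ifP => _; last exact: measurable_cst.
  by apply: measurable_funM asmall; exact: adapted_weight.
have mcc j := adapted_measurable (acc j).
have cc0 j w : 0 <= cc j w.
  by rewrite /cc; case: ifP => // _; rewrite mulr_ge0 ?weight_ge0.
have cceta j w : `|cc j w| <= eta.
  rewrite ger0_norm// /cc /small; case: ifP => jn; last exact: ltW.
  have [Sd|_] := leP (S_ n gamma w) delta; last by rewrite mulr0 ltW.
  rewrite mulr1 leNgt; apply/negP => etab.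
  suff : delta < S_ n gamma w by rewrite ltNge Sd.
  apply: (@lt_le_trans _ _ (b_ n j w `^ gamma)).
    by apply: gt0_ltr_powR; rewrite ?nnegrE ?weight_ge0//; exact: ltW.
  rewrite /weight_power (bigD1_seq j) ?iota_uniq//=; last first.
    by rewrite mem_index_iota ltnS.
  by rewrite lerDl sumr_ge0// => k _; exact: powR_ge0.
pose S w := \sum_(1 <= j < n.+1) cc j w * C j w.
have mS : measurable_fun setT S.
  by apply: measurable_sum => j; exact: measurable_funM.
have S2 : (\int[P]_w (S w ^+ 2)%:E <= ((2 * K) ^+ 2 * eta)%:E)%E.
  apply: le_trans (orthogonal_sum_second_moment mcc mC cceta CK C0 _ n) _.
    move=> m; apply: (fragmentation_independent (@variables_upto_index n m)
        (E2 := [set (0, m.+1)%N])).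
    - by move=> _ ->; left.
    - apply/eqP; apply/seteqP; split=> // v [[pv|[v0 /andP[_ vm]]] vE].
        by move: pv; rewrite (vE : v = (0, m.+1)%N) /past/=.
      by move: vm; rewrite (vE : v = (0, m.+1)%N)/= ltnn.
    - apply: measurable_funM; last first.
        by apply: adapted_sub (acc m.+1) => v ?; left.
      pose h j : T -> R := if (0 < j <= m)%N then fun w => cc j w * C j w else cst 0.
      rewrite (_ : (fun w => _) = fun w => \sum_(1 <= j < m.+1) h j w); last first.
        by apply/funext => w; apply: eq_big_nat => j; rewrite ltnS /h => ->.
      apply: adapted_sum => j; rewrite /h; case: ifP => jm; last exact: measurable_cst.
      apply: measurable_funM.
        by apply: adapted_sub (acc j) => v ?; left.
      apply: (adapted_comp (f := fun x => clip K x - mu)).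
        by apply: measurable_funB => //; exact: measurable_cst.
      by apply: adapted_X; right.
    - apply: (adapted_comp (f := fun x => clip K x - mu)).
        by apply: measurable_funB => //; exact: measurable_cst.
      exact: adapted_X.
  rewrite (EFinM ((2 * K) ^+ 2) eta); apply: lee_wpmul2l.
    by rewrite lee_fin sqr_ge0.
  rewrite -mean_sum; [|by move=> k; exact: measurable_funX|by move=> k w; exact: sqr_ge0].
  apply: (@le_trans _ _ (\int[P]_w (eta * M_ n w)%:E)%E).
    have mM := measurable_total_weight n.
    apply: mean_le => [||w].
    - by apply: measurable_sum => j; exact: measurable_funX.
    - exact: measurable_funM.
    rewrite sumr_ge0/=; last by move=> j _; exact: sqr_ge0.
    rewrite /total_weight mulr_sumr; apply: ler_sum => j _.
    rewrite expr2; apply: ler_pM => //.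
      by have := cceta j w; rewrite ger0_norm.
    rewrite /cc; case: ifP => _; last exact: weight_ge0.
    by rewrite ler_piMr ?weight_ge0//; have /andP[] := s01 w.
  rewrite meanZ//; last 3 first.
  - exact: measurable_total_weight.
  - by move=> w; exact: total_weight_ge0.
  - exact: ltW.
  by rewrite (mean_total_weight n0) mule1.
pose Z j w := `|X j w - clip K (X j w)|.
have mZ j : measurable_fun setT (Z j).
  apply: measurableT_comp => //; apply: measurable_funB => //.
  exact: measurableT_comp.
have Z0 j w : 0 <= Z j w by exact: normr_ge0.
have meanZ1 j : (0 < j)%N -> (\int[P]_w (Z j w)%:E <= e1%:E)%E.
  move=> j0; apply: le_trans ctail; rewrite le_eqVlt; apply/orP; left; apply/eqP.
  apply: (same_law_mean (h := fun x => `|x - clip K x|) (X_law j0)) => [|x].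
    by apply: measurableT_comp => //; exact: measurable_funB.
  exact: normr_ge0.
pose tails w := \sum_(1 <= j < n.+1) b_ n j w * Z j w.
have mtails : measurable_fun setT tails.
  apply: measurable_sum => j; apply: measurable_funM => //.
  exact: measurable_weight.
have tails0 w : 0 <= tails w.
  by apply: sumr_ge0 => j _; rewrite mulr_ge0// weight_ge0.
have tails_mean : (\int[P]_w (tails w)%:E <= e1%:E)%E.
  rewrite mean_sum; [|by move=> j; apply: measurable_funM => //;
    exact: measurable_weight|by move=> j w; rewrite mulr_ge0// weight_ge0].
  apply: (@le_trans _ _ (\sum_(1 <= j < n.+1) (\int[P]_w (b_ n j w)%:E * e1%:E))%E).
    rewrite big_nat [leRHS]big_nat; apply: lee_sum => j /andP[j0 jn].
    rewrite integral_mul_independent//; last 3 first.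
    - exact: measurable_weight.
    - apply: (fragmentation_independent (@past_var_index n)
        (E2 := [set (0, j)%N])).
      + by move=> _ ->; left.
      + apply/eqP; apply/seteqP; split=> // v [pv vE].
        by move: pv; rewrite (vE : v = (0, j)%N) /past/=.
      + exact: adapted_weight.
      + apply: (adapted_comp (f := fun x : R => `|x - clip K x|) (g := X j)).
          by apply: measurableT_comp => //; exact: measurable_funB.
        exact: adapted_X.
    - by move=> w; exact: weight_ge0.
    rewrite lee_wpmul2l//; last exact: meanZ1.
    by apply: mean_ge0 => w; exact: weight_ge0.
  rewrite -ge0_sume_distrl; last first.
    by move=> j _; apply: mean_ge0 => w; exact: weight_ge0.
  rewrite -mean_sum; [|by move=> j; exact: measurable_weight|
    by move=> j w; exact: weight_ge0].
  by rewrite -/(M_ n) (mean_total_weight n0) mul1e.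
pose far w : R := (delta < S_ n gamma w)%R%:R.
have mfar : measurable_fun setT far.
  apply: (@measurableT_comp _ _ _ _ _ _ (fun b : bool => b%:R : R)) => //.
  by apply: measurable_fun_ltr => //; exact: measurable_weight_power.
have far_mean : (\int[P]_w (far w)%:E <= (e / 3)%:E)%E.
  have : (\int[P]_w (delta * far w)%:E <= (delta * (e / 3))%:E)%E.
    apply: (@le_trans _ _ (\int[P]_w (S_ n gamma w)%:E)%E).
      apply: mean_le => [||w]; [exact: measurable_funM|exact: measurable_weight_power|].
      rewrite mulr_ge0 ?(ltW delta0) ?ler0n//= /far.
      by have [/ltW|] := ltP delta (S_ n gamma w); rewrite ?mulr1// mulr0 weight_power_ge0.
    by rewrite (le_trans (weight_power_decay c01 n0 mc))// lee_fin.
  by rewrite meanZ ?(ltW delta0)// EFinM lee_pmul2l// lte_fin.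
have pointwise w : (rho < `|weighted_sum n w - m0 * M_ n w|)%R%:R <=
    far w + (4 / rho ^+ 2 * S w ^+ 2 + 2 / rho * (tails w + e1 * M_ n w)).
  have M0 := total_weight_ge0 (LR : nat -> T -> R * R) (I : nat -> T -> nat) n w.
  have A0 : 0 <= 4 / rho ^+ 2 * S w ^+ 2.
    by rewrite mulr_ge0 ?sqr_ge0// divr_ge0// sqr_ge0.
  have B0 : 0 <= tails w + e1 * M_ n w by rewrite addr_ge0// mulr_ge0// ltW.
  have B0' : 0 <= 2 / rho * (tails w + e1 * M_ n w).
    by rewrite mulr_ge0// divr_ge0// ltW.
  have f0 : 0 <= far w by rewrite /far ler0n.
  have [far_w|_] := ltP rho `|weighted_sum n w - m0 * M_ n w|; last first.
    by rewrite !addr_ge0.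
  rewrite /far; have [_|Sd] := ltP delta (S_ n gamma w); first by rewrite lerDl addr_ge0.
  rewrite add0r.
  have SE : S w = \sum_(1 <= j < n.+1) b_ n j w * C j w.
    apply: eq_big_nat => j; rewrite ltnS => jn.
    by rewrite /cc jn /small Sd mulr1.
  have dec : weighted_sum n w - m0 * M_ n w = S w +
      (\sum_(1 <= j < n.+1) b_ n j w * (X j w - clip K (X j w)) - (m0 - mu) * M_ n w).
    rewrite SE /weighted_sum /total_weight !mulr_sumr -!sumrB -big_split/=.
    by apply: eq_bigr => j _; rewrite /C; ring.
  have restle : `|\sum_(1 <= j < n.+1) b_ n j w * (X j w - clip K (X j w)) -
      (m0 - mu) * M_ n w| <= tails w + e1 * M_ n w.
    rewrite (le_trans (ler_normB _ _))// lerD//.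
      rewrite (le_trans (ler_norm_sum _ _ _))//; apply: ler_sum => j _.
      by rewrite normrM ger0_norm ?weight_ge0.
    by rewrite normrM (ger0_norm M0) ler_wpM2r.
  move: far_w; rewrite dec => /lt_le_trans/(_ (ler_normD _ _)) far_w.
  have sumlt : rho < `|S w| + (tails w + e1 * M_ n w).
    by apply: lt_le_trans far_w _; rewrite lerD2l.
  move: restle => _; move: B0 B0' sumlt; set B := tails w + _ => B0 B0' sumlt.
  have [hB|hB] := leP (rho / 2) B.
    rewrite ler_wpDl// mulrAC ler_pdivlMr// mul1r; lra.
  rewrite ler_wpDr// mulrAC ler_pdivlMr ?exprn_gt0// mul1r.
  have hS : rho / 2 <= `|S w| by lra.
  rewrite -(real_normK (num_real (S w))).
  have : (rho / 2) ^+ 2 <= `|S w| ^+ 2.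
    by rewrite lerXn2r ?nnegrE ?divr_ge0 ?(ltW rho0).
  by rewrite expr_div_n; lra.
have mM := measurable_total_weight n.
have M0 w : 0 <= M_ n w by exact: total_weight_ge0.
have mW := measurable_weighted_sum n.
have rho20 : 0 <= 4 / rho ^+ 2 by rewrite divr_ge0// sqr_ge0.
have rho10 : 0 <= 2 / rho by rewrite divr_ge0// ltW.
have mS2 : measurable_fun setT (fun w => S w ^+ 2) by exact: measurable_funX.
have me1M : measurable_fun setT (fun w => e1 * M_ n w) by exact: measurable_funM.
have e1M0 w : 0 <= e1 * M_ n w by rewrite mulr_ge0// ltW.
have mtM : measurable_fun setT (fun w => tails w + e1 * M_ n w).
  exact: measurable_funD.
have tM0 w : 0 <= tails w + e1 * M_ n w by rewrite addr_ge0.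
have mA : measurable_fun setT (fun w => 4 / rho ^+ 2 * S w ^+ 2).
  exact: measurable_funM.
have mB : measurable_fun setT (fun w => 2 / rho * (tails w + e1 * M_ n w)).
  exact: measurable_funM.
have A0 w : 0 <= 4 / rho ^+ 2 * S w ^+ 2 by rewrite mulr_ge0// sqr_ge0.
have B0 w : 0 <= 2 / rho * (tails w + e1 * M_ n w) by exact: mulr_ge0.
apply: (@le_trans _ _ (\int[P]_w (far w + (4 / rho ^+ 2 * S w ^+ 2 +
    2 / rho * (tails w + e1 * M_ n w)))%:E)%E).
  apply: mean_le => [||w]; last by rewrite ler0n pointwise.
  - apply: (@measurableT_comp _ _ _ _ _ _ (fun b : bool => b%:R : R)) => //.
    apply: measurable_fun_ltr => //; apply: measurableT_comp => //.
    by apply: measurable_funB => //; exact: measurable_funM.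
  - by apply: measurable_funD => //; exact: measurable_funD.
rewrite meanD; [|exact: mfar|exact: measurable_funD|by move=> w; rewrite /far ler0n|
  by move=> w; exact: addr_ge0].
rewrite meanD; [|exact: mA|exact: mB|exact: A0|exact: B0].
rewrite meanZ; [|exact: mS2|by move=> w; exact: sqr_ge0|exact: rho20].
rewrite meanZ; [|exact: mtM|exact: tM0|exact: rho10].
rewrite meanD; [|exact: mtails|exact: me1M|exact: tails0|exact: e1M0].
rewrite meanZ; [|exact: mM|exact: M0|exact: ltW].
rewrite (mean_total_weight n0) mule1.
apply: (@le_trans _ _ ((e / 3)%:E + ((4 / rho ^+ 2)%:E * ((2 * K) ^+ 2 * eta)%:E +
    (2 / rho)%:E * (e1%:E + e1%:E)))%E).
  apply: leeD => //; apply: leeD.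
    by rewrite lee_wpmul2l// lee_fin.
  by rewrite lee_wpmul2l ?lee_fin// leeD2r.
have h : e / 3 + (4 / rho ^+ 2 * ((2 * K) ^+ 2 * eta) + 2 / rho * (e1 + e1)) = e.
  by rewrite /eta /e1; field; rewrite ?gt_eqF.
rewrite -{2}h; exact: lexx.
Qed.

(** * Convergence in distribution *)

Hypothesis nu_gt0 : forall (t : R) w, 0 <= t -> (1 <= nu t w)%N.
Hypothesis nu_law : forall (t : R) n, 0 <= t -> (1 <= n)%N ->
  P [set w | nu t w = n] = (expR (- t) * (1 - expR (- t)) ^+ n.-1)%:E.

Local Notation W_ := weighted_sum.

Lemma adapted_weighted_sum n : adapted (variables_upto n n) (W_ n).
Proof.
pose h j : T -> R := if (0 < j <= n)%N then fun w => b_ n j w * X j w else cst 0.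
rewrite (_ : W_ n = fun w => \sum_(1 <= j < n.+1) h j w); last first.
  by apply/funext => w; apply: eq_big_nat => j; rewrite ltnS /h => ->.
apply: adapted_sum => j; rewrite /h; case: ifP => jn; last exact: measurable_cst.
exact: adapted_weighted_term.
Qed.

Lemma nu_mass_le t n : 0 <= t ->
  (\int[P]_w ((nu t w == n)%:R)%:E <= (expR (- t))%:E)%E.
Proof.
move=> t0.
have -> : (\int[P]_w ((nu t w == n)%:R)%:E = P [set w | nu t w = n])%E.
  rewrite -[in RHS](setIT [set w | nu t w = n]) -integral_indic//; last first.
    exact: (measurable_funPTI (nu t) (Y := [set n])).
  apply: eq_integral => w _; rewrite indicE.
  suff -> : (w \in [set w | nu t w = n]) = (nu t w == n) by [].
  by apply/idP/eqP => [/set_mem//|h]; exact/mem_set.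
case: n => [|n]; last first.
  rewrite nu_law// lee_fin ler_piMr ?expR_ge0// exprn_ile1 ?subr_ge0 ?gerBl ?expR_ge0//.
  by rewrite -expR0 ler_expR oppr_le0.
rewrite (_ : [set w | nu t w = 0%N] = set0) ?measure0 ?lee_fin ?expR_ge0//.
by apply/seteqP; split=> // w /= h; have := nu_gt0 w t0; rewrite h.
Qed.

(** The limit [m0 * M_n --> m0 * M] holds almost surely, hence for the means of
    [f].  The means at [W_n] and [m0 * M_n] are compared by uniform continuity,
    away from two improbable events: that they are more than [rho] apart, and
    that [m0 * M_n] exceeds [Q], where Markov's inequality uses [E[M_n] = 1]. *)
Lemma mean_weighted_sum_cvg (f : R -> R) (F : R) : continuous f ->
  (forall x, `|f x| <= F) ->
  (\int[P]_w (f (W_ n w))%:E)%E @[n --> \oo] --> (\int[P]_w (f (m0 * Minf w))%:E)%E.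
Proof.
move=> cf fF.
have F0 : 0 <= F by exact: le_trans (normr_ge0 _) (fF 0).
have mf : measurable_fun setT f by exact: continuous_measurable_fun.
have mM n := measurable_total_weight n.
have M0 n w : 0 <= M_ n w by exact: total_weight_ge0.
have mW n := measurable_weighted_sum n.
have mfW n : measurable_fun setT (fun w => f (W_ n w)).
  exact: measurableT_comp mf (mW n).
have mmM n : measurable_fun setT (fun w => m0 * M_ n w) by exact: measurable_funM.
have mfM n : measurable_fun setT (fun w => f (m0 * M_ n w)).
  exact: measurableT_comp mf (mmM n).
have mmMinf : measurable_fun setT (fun w => m0 * Minf w) by exact: measurable_funM.
have mfMinf : measurable_fun setT (fun w => f (m0 * Minf w)).
  exact: measurableT_comp mf mmMinf.
have iW n : P.-integrable setT (EFin \o (fun w => f (W_ n w))).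
  by apply: (@bounded_integrable _ _ _ _ _ F).
have iM n : P.-integrable setT (EFin \o (fun w => f (m0 * M_ n w))).
  by apply: (@bounded_integrable _ _ _ _ _ F).
have iMinf : P.-integrable setT (EFin \o (fun w => f (m0 * Minf w))).
  by apply: (@bounded_integrable _ _ _ _ _ F).
have cvgM : (\int[P]_w (f (m0 * M_ n w))%:E)%E @[n --> \oo] -->
    (\int[P]_w (f (m0 * Minf w))%:E)%E.
  apply: (@mean_bounded_cvg _ _ _ _ _ _ F) => //.
  apply: filterS Minf_lim => w Mw.
  apply: (@cvg_comp _ _ _ (fun n => m0 * M_ n w) f _ _ _ _ (cf (m0 * Minf w))).
  by apply: cvgM => //; exact: cvg_cst.
have close e : 0 < e -> \forall n \near \oo,
    (`| \int[P]_w (f (W_ n w))%:E - \int[P]_w (f (m0 * M_ n w))%:E | <= e%:E)%E.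
  move=> e0.
  (* With this [Q], Markov gives [2 * F * `|m0| / Q <= e / 3]. *)
  pose Q := 6 * (F + 1) * (`|m0| + 1) / e.
  have F10 : 0 < F + 1 by rewrite ltr_wpDl.
  have m10 : 0 < `|m0| + 1 by rewrite ltr_wpDl.
  have Q0 : 0 < Q by rewrite divr_gt0// !mulr_gt0.
  have e30 : 0 < e / 3 by rewrite divr_gt0.
  have [rho rho0 unif] := continuous_uniform_on_segment Q cf e30.
  have e4 : 0 < e / (6 * (F + 1)) by rewrite divr_gt0// mulr_gt0.
  have [N HN] := weighted_sum_concentration e4 rho0.
  exists N.+1 => // n /= Nn; have n0 : (0 < n)%N by exact: leq_trans Nn.
  have {HN} far := HN n (ltnW Nn).
  set q := fun w => (rho < `|W_ n w - m0 * M_ n w|)%R%:R : R in far.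
  have mq : measurable_fun setT q.
    apply: (@measurableT_comp _ _ _ _ _ _ (fun b : bool => b%:R : R)) => //.
    apply: measurable_fun_ltr => //; apply: measurableT_comp => //.
    exact: measurable_funB.
  have q0 w : 0 <= q w by rewrite /q ler0n.
  rewrite -(integralB measurableT (iW n) (iM n)).
  have mD : measurable_fun setT (fun w => f (W_ n w) - f (m0 * M_ n w)).
    exact: measurable_funB.
  apply: le_trans (le_abse_integral _ _ _) _ => //; first exact/measurable_EFinP.
  have mR1 : measurable_fun setT (fun w => 2 * F * q w) by exact: measurable_funM.
  have mR2 : measurable_fun setT (fun w => 2 * F * `|m0| / Q * M_ n w).
    exact: measurable_funM.
  have k20 : 0 <= 2 * F * `|m0| / Q by rewrite divr_ge0 ?(ltW Q0)// !mulr_ge0.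
  apply: (@le_trans _ _ (\int[P]_w (e / 3 + (2 * F * q w +
      2 * F * `|m0| / Q * M_ n w))%:E)%E).
    apply: (@mean_le _ _ _ _ (fun w => `|f (W_ n w) - f (m0 * M_ n w)|)) => [||w].
    - exact: measurableT_comp.
    - by apply: measurable_funD => //; exact: measurable_funD.
    rewrite normr_ge0/=.
    have fF2 : `|f (W_ n w) - f (m0 * M_ n w)| <= 2 * F.
      by rewrite (le_trans (ler_normB _ _))// mulr_natl mulr2n lerD.
    have a0 : 0 <= 2 * F * q w by rewrite !mulr_ge0.
    have b0 : 0 <= 2 * F * `|m0| / Q * M_ n w by rewrite mulr_ge0.
    have [far_w|near_w] := ltP rho `|W_ n w - m0 * M_ n w|.
      have qw : q w = 1 by rewrite /q far_w.
      by rewrite qw mulr1; lra.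
    have [vQ|Qv] := leP `|m0 * M_ n w| Q.
      by have := unif _ _ vQ near_w; lra.
    suff : 2 * F <= 2 * F * `|m0| / Q * M_ n w by lra.
    have -> : 2 * F * `|m0| / Q * M_ n w = 2 * F * (`|m0 * M_ n w| / Q).
      by rewrite normrM (ger0_norm (M0 n w)); ring.
    by rewrite ler_peMr ?mulr_ge0// ler_pdivlMr// mul1r ltW.
  have F20 : 0 <= 2 * F by rewrite mulr_ge0.
  rewrite meanD; [|exact: measurable_cst|exact: measurable_funD|
    by move=> w; exact: ltW|by move=> w; rewrite addr_ge0// mulr_ge0].
  rewrite meanD; [|exact: mR1|exact: mR2|by move=> w; exact: mulr_ge0|
    by move=> w; exact: mulr_ge0].
  rewrite mean_cst meanZ// meanZ// (mean_total_weight n0) mule1.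
  apply: (@le_trans _ _ ((e / 3)%:E + ((2 * F)%:E * (e / (6 * (F + 1)))%:E +
      (2 * F * `|m0| / Q)%:E))%E).
    by rewrite leeD2l// leeD2r// lee_wpmul2l.
  have h1 : 2 * F * (e / (6 * (F + 1))) <= e / 3.
    have -> : 2 * F * (e / (6 * (F + 1))) = e / 3 * (F / (F + 1)).
      by field; rewrite gt_eqF.
    by rewrite ler_piMr ?(ltW e30)// ler_pdivrMr// mul1r lerDl.
  have h2 : 2 * F * `|m0| / Q <= e / 3.
    have -> : 2 * F * `|m0| / Q = e / 3 * (F / (F + 1)) * (`|m0| / (`|m0| + 1)).
      by rewrite /Q; field; rewrite !gt_eqF.
    have l1 : F / (F + 1) <= 1 by rewrite ler_pdivrMr// mul1r lerDl.
    have l2 : `|m0| / (`|m0| + 1) <= 1 by rewrite ler_pdivrMr// mul1r lerDl.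
    have l10 : 0 <= F / (F + 1) by rewrite divr_ge0// ltW.
    rewrite (le_trans (ler_piMr _ l2))//; first by rewrite mulr_ge0// ltW.
    by rewrite ler_piMr// ltW.
  have h : e / 3 + (2 * F * (e / (6 * (F + 1))) + 2 * F * `|m0| / Q) <= e by lra.
  exact: h.
have fW n : (\int[P]_w (f (W_ n w))%:E)%E \is a fin_num.
  exact: (integrable_fin_num measurableT (iW n)).
have fM n : (\int[P]_w (f (m0 * M_ n w))%:E)%E \is a fin_num.
  exact: (integrable_fin_num measurableT (iM n)).
have fMinf : (\int[P]_w (f (m0 * Minf w))%:E)%E \is a fin_num.
  exact: (integrable_fin_num measurableT iMinf).
rewrite -(fineK fMinf); apply/fine_cvgP; split; first exact: nearW.
move: cvgM; rewrite -(fineK fMinf) => /fine_cvgP[_ /cvgrPdist_le cvgM].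
apply/cvgrPdist_le => e e0; have e20 : 0 < e / 2 by rewrite divr_gt0.
apply: filterS2 (cvgM _ e20) (close _ e20) => n.
rewrite -{1}(fineK (fW n)) -{1}(fineK (fM n)) /=.
set a := fine _; set b := fine _; set l := fine _ => h1 h2.
rewrite lee_fin in h2; rewrite -(subrKA b) (le_trans (ler_normD _ _))//.
by rewrite (distrC b); lra.
Qed.

(** One-sided, since [random_index_mean_le] bounds means of nonnegative
    functions from above; it is applied to [F + g].  Using it for [g] and [- g]
    gives the limit. *)
Lemma mean_at_nu_le (g : R -> R) (F l e : R) : measurable_fun setT g ->
  (forall x, `|g x| <= F) ->
  (\int[P]_w (g (W_ n w))%:E)%E @[n --> \oo] --> l%:E -> 0 < e ->
  \forall t \near +oo, (\int[P]_w (g (W_ (nu t w) w))%:E <= (l + e)%:E)%E.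
Proof.
move=> mg gF cvg_g e0.
have F0 : 0 <= F by exact: le_trans (normr_ge0 _) (gF 0).
have mW n := measurable_weighted_sum n.
have mgW n : measurable_fun setT (fun w => g (W_ n w)) by exact: measurableT_comp mg (mW n).
have e20 : 0 < e / 2 by rewrite divr_gt0.
move/fine_cvgP : cvg_g => [_ /cvgrPdist_le/(_ _ e20)[n0 _ Hn0]].
have igW n : P.-integrable setT (EFin \o (fun w => g (W_ n w))).
  by apply: (@bounded_integrable _ _ _ _ _ F).
have iF : P.-integrable setT (EFin \o (cst F : T -> R)).
  exact: finite_measure_integrable_cst.
have gn n : (n0 <= n)%N -> (\int[P]_w (F + g (W_ n w))%:E <= (F + l + e / 2)%:E)%E.
  move=> nn; rewrite (eq_integral (fun w => F%:E + (g (W_ n w))%:E)%E)//.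
  rewrite (integralD measurableT iF (igW n)) mean_cst.
  rewrite -(fineK (integrable_fin_num measurableT (igW n))) -EFinD lee_fin.
  have := Hn0 n nn; rewrite /= ler_norml => /andP[h1 h2].
  by move: h1 h2; set v := fine _; lra.
have Fl0 : 0 <= F + l + e / 2.
  rewrite -lee_fin; apply: le_trans (gn n0 (leqnn _)).
  apply: mean_ge0 => w; have := gF (W_ n0 w); rewrite ler_norml => /andP[]; lra.
(* From [t0] on, the indices below [n0] contribute at most
   [2 * F * n0%:R * expR (- t) <= e / 2]. *)
pose t0 := 4 * F * n0%:R / e.
have t00 : 0 <= t0 by rewrite divr_ge0 ?mulr_ge0// ltW.
exists t0; split; first exact: num_real.
move=> t t0t; have t_ge0 : 0 <= t by rewrite (le_trans t00)// ltW.
have mnu : measurable_fun setT (nu t : T -> nat) by exact: measurable_funP.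
have phiC n w : 0 <= F + g (W_ n w) <= 2 * F.
  by have := gF (W_ n w); rewrite ler_norml => /andP[h1 h2]; apply/andP; split; lra.
have mphi n : measurable_fun setT (fun w => F + g (W_ n w)) by exact: measurable_funD.
have ind n : independent_funs P (fun w => F + g (W_ n w)) (fun w => (nu t w == n)%:R).
  apply: (fragmentation_independent (@variables_upto_index n n)
      (E2 := [set (3, 0)%N])).
  - by move=> _ ->; right.
  - apply/eqP; apply/seteqP; split=> // v [[pv|[v0 _]] vE].
      by move: pv; rewrite (vE : v = (3, 0)%N) /past/=.
    by move: v0; rewrite (vE : v = (3, 0)%N).
  - apply: (adapted_comp (f := fun x : R => F + g x) (g := W_ n)).
      by apply: measurable_funD.
    exact: adapted_weighted_sum.
  - apply: (adapted_comp (f := fun k : nat => (k == n)%:R : R) (g := nu t)) => //.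
    exact: adapted_nu.
have := random_index_mean_le mphi phiC ind Fl0 gn.
have mgnu : measurable_fun setT (fun w => g (W_ (nu t w) w)).
  exact: (measurable_fun_select (u := fun n w => g (W_ n w))).
have ignu : P.-integrable setT (EFin \o (fun w => g (W_ (nu t w) w))).
  by apply: (@bounded_integrable _ _ _ _ _ F).
rewrite (eq_integral (fun w => F%:E + (g (W_ (nu t w) w))%:E)%E)//.
rewrite (integralD measurableT iF ignu) mean_cst.
rewrite -(fineK (integrable_fin_num measurableT ignu)); set v := fine _ => h.
rewrite lee_fin.
have : (F%:E + v%:E <= (F + l + e / 2)%:E + (2 * F)%:E * (n0%:R * expR (- t))%:E)%E.
  apply: (le_trans h); rewrite leeD2l// lee_wpmul2l ?lee_fin ?mulr_ge0//.
  apply: (@le_trans _ _ (\sum_(0 <= n < n0) (expR (- t))%:E)%E).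
    by apply: lee_sum => n _; exact: nu_mass_le.
  by rewrite sumEFin sumr_const_nat subn0 mulr_natl.
rewrite -EFinM -!EFinD lee_fin.
have small : 2 * F * (n0%:R * expR (- t)) <= e / 2.
  have expt : expR (- t) * (1 + t) <= 1.
    have -> : 1 = expR (- t) * expR t by rewrite -expRD addNr expR0.
    by rewrite ler_wpM2l ?expR_ge0// -expRD addNr expR0 expR_ge1Dx.
  have Fn : 4 * F * n0%:R <= e * (1 + t).
    have : t0 * e <= t * e by rewrite ler_wpM2r// ltW// ltW.
    rewrite /t0 divfK ?gt_eqF//; nra.
  have ex0 := expR_ge0 (- t); move: expt Fn ex0; set x := expR _ => expt Fn ex0.
  have : 4 * F * n0%:R * x <= e * (1 + t) * x by rewrite ler_wpM2r.
  have : e * (x * (1 + t)) <= e by rewrite ler_piMr// ltW.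
  by set k := n0%:R; lra.
by lra.
Qed.

Theorem cvg_in_distribution_fragmentation :
  cvg_in_distribution P (V LR I X nu) (fun w => m0 * Minf w).
Proof.
move=> f cf [F fF].
have mf : measurable_fun setT f by exact: continuous_measurable_fun.
have mfMinf : measurable_fun setT (fun w => f (m0 * Minf w)).
  by apply: measurableT_comp mf _; exact: measurable_funM.
have iMinf : P.-integrable setT (EFin \o (fun w => f (m0 * Minf w))).
  by apply: (@bounded_integrable _ _ _ _ _ F).
have lfin := integrable_fin_num measurableT iMinf.
have mW n := measurable_weighted_sum n.
have mfV t : measurable_fun setT (fun w => f (W_ (nu t w) w)).
  apply: (measurable_fun_select (u := fun n w => f (W_ n w))) => // n.
  exact: measurableT_comp mf (mW n).
have ifV t : P.-integrable setT (EFin \o (fun w => f (W_ (nu t w) w))).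
  by apply: (@bounded_integrable _ _ _ _ _ F).
have ifW n : P.-integrable setT (EFin \o (fun w => f (W_ n w))).
  apply: (@bounded_integrable _ _ _ _ _ F) => //.
  exact: measurableT_comp mf (mW n).
have cvgW := mean_weighted_sum_cvg cf fF.
have mrbeta n j : measurable_fun setT (rbeta LR I n j).
  by apply: measurable_beta_coef => k _; exact: measurable_funP.
have VE t : ('E_P[f \o V LR I X nu t] = \int[P]_w (f (W_ (nu t w) w))%:E)%E.
  rewrite unlock; apply: mean_ae_eq => //.
    apply: measurableT_comp mf _.
    apply: (measurable_fun_select (u := W LR I X)) => // n.
    by apply: measurable_sum => j; exact: measurable_funM.
  apply: filterS ae_W => w H /=.
  by rewrite /V H.
rewrite (_ : (fun t => 'E_P[f \o V LR I X nu t]%E) =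
    fun t => \int[P]_w (f (W_ (nu t w) w))%:E)%E; last exact/funext.
rewrite unlock -/(\int[P]_w (f (m0 * Minf w))%:E)%E.
move: cvgW; rewrite -(fineK lfin); set l := fine _ => cvgW.
apply/fine_cvgP; split.
  by apply: nearW => t; exact: (integrable_fin_num measurableT (ifV t)).
apply/cvgrPdist_le => e e0.
have upper := mean_at_nu_le mf fF cvgW e0.
have mNf : measurable_fun setT (fun x => - f x) by exact: measurable_funN.
have NfF x : `|- f x| <= F by rewrite normrN.
have cvgN : (\int[P]_w (- f (W_ n w))%:E)%E @[n --> \oo] --> (- l)%:E.
  rewrite (_ : (fun n => _) = (fun n => - \int[P]_w (f (W_ n w))%:E)%E); last first.
    apply/funext => n; rewrite -integralN//.
    exact: integrable_add_def (ifW n).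
  by rewrite EFinN; exact: cvgeN.
have lower := mean_at_nu_le mNf NfF cvgN e0.
apply: filterS2 upper lower => t.
rewrite (_ : (\int[P]_w (- f (W_ (nu t w) w))%:E)%E =
    (- \int[P]_w (f (W_ (nu t w) w))%:E)%E); last first.
  by rewrite -integralN//; exact: integrable_add_def (ifV t).
rewrite -(fineK (integrable_fin_num measurableT (ifV t))) /=.
set v := fine _; rewrite !lee_fin => h1 h2.
by rewrite ler_norml; apply/andP; split; lra.
Qed.

End FragmentationProcess.

Theorem theorem3p3 (R : realType)
  (* the fixed vector (L, R) and the initial condition *)
  (d0 : measure_display) (T0 : measurableType d0) (P0 : probability T0 R)
  (LR0 : {RV P0 >-> (R * R)%type}) (X0 : {RV P0 >-> R})
  (LR0_ge0 : forall w, 0 <= (LR0 w).1 /\ 0 <= (LR0 w).2)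
  (* the probabilistic representation *)
  (d : measure_display) (T : measurableType d) (P : probability T R)
  (X : nat -> {RV P >-> R})
  (LR : nat -> {RV P >-> (R * R)%type})
  (I : nat -> {RV P >-> nat})
  (nu : R -> {RV P >-> nat})
  (X_law : forall n, (1 <= n)%N -> cdf (X n) =1 cdf X0)
  (LR_law : forall n, (1 <= n)%N -> same_law (LR n) LR0)
  (I_law : forall n k, (1 <= k <= n)%N ->
    P [set w | I n w = k] = (n%:R^-1)%:E)
  (nu_gt0 : forall (t : R) w, 0 <= t -> (1 <= nu t w)%N)
  (nu_law : forall (t : R) n, 0 <= t -> (1 <= n)%N ->
    P [set w | nu t w = n] = (expR (- t) * (1 - expR (- t)) ^+ n.-1)%:E)
  (X_indep : independent_rvs [set n | (1 <= n)%N] X)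
  (LR_indep : independent_rvs [set n | (1 <= n)%N] LR)
  (I_indep : independent_rvs [set n | (1 <= n)%N] I)
  (families_indep : mutually_independent P `I_4
    (nth set0 [:: sigma_family [set n | (1 <= n)%N] X;
                  sigma_family [set n | (1 <= n)%N] LR;
                  sigma_family [set n | (1 <= n)%N] I;
                  sigma_family [set t : R | 0 <= t] nu]))
  (* the almost sure limit of M_n^(1) *)
  (Minf : {RV P >-> R})
  (Minf_lim : {ae P, forall w, M1 LR I n w @[n --> \oo] --> Minf w})
  (* the assumptions of the theorem *)
  (mean1 : ('E_P0[fun w => ((LR0 w).1 + (LR0 w).2)%R] = 1)%E)
  (gamma : R) (gamma_gt0 : 0 < gamma) (S_gamma : (calS P0 LR0 gamma < 0)%E)
  (X0_int : P0.-integrable [set: T0] (EFin \o X0))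
  (m0 : R) (m0E : ('E_P0[X0] = m0%:E)%E) :
  let Vinf := fun w => m0 * Minf w in
  [/\ cvg_in_distribution P (V LR I X nu) Vinf,
      (1 < gamma -> m0 != 0 -> nondegenerate_rv P Vinf) /\
      (gamma < 1 -> {ae P, forall w, Vinf w = 0}),
      {ae P0, forall w, (LR0 w).1 + (LR0 w).2 = 1} ->
        {ae P, forall w, Vinf w = m0} &
      nondegenerate_rv P Vinf -> forall p : R, 1 < p ->
        ('E_P[fun w => (`|Vinf w| `^ p)%R] < +oo)%E <-> (calS P0 LR0 p < 0)%E].
Proof.
move=> Vinf.
have proc : is_fragmentation LR0 X LR I nu by [].
have mean1' : (\int[P0]_w ((LR0 w).1 + (LR0 w).2)%:E = 1)%E.
  by move: mean1; rewrite unlock.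
have m0E' : (\int[P0]_w (X0 w)%:E = m0%:E)%E by move: m0E; rewrite unlock.
have mgamma : (moment LR0 gamma < 1)%E by rewrite -calS_moment.
have X_law' n : (0 < n)%N -> same_law (X n) X0.
  by move=> n0; apply: cdf_determines_law; exact: X_law.
have Minf_lim' : {ae P, forall w,
    total_weight (LR : nat -> T -> R * R) (I : nat -> T -> nat) n w @[n --> \oo]
      --> Minf w}.
  apply: filterS2 (ae_M1 proc) Minf_lim => w H.
  by rewrite (_ : (fun n => M1 LR I n w) = fun n => total_weight LR I n w)//; exact/funext.
(* Excluded because [S(1) = 0]. *)
have gamma_neq1 : gamma != 1.
  apply/eqP => g1; move: mgamma; rewrite g1 /moment.
  rewrite (eq_integral (fun w => ((LR0 w).1 + (LR0 w).2)%:E)) => [|w _].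
    by rewrite mean1' ltxx.
  by have [l0 r0] := LR0_ge0 w; rewrite !powRr1.
have subcritical : gamma < 1 -> {ae P, forall w, Vinf w = 0}.
  move=> g1; have g01 : 0 < gamma < 1 by rewrite gamma_gt0.
  apply: filterS (subcritical_limit_mass0 proc Minf_lim' g01 mgamma) => w Mw.
  by rewrite /Vinf Mw mulr0.
have mabs : measurable_fun setT (fun w => `|Minf w|) by exact: measurableT_comp.
split.
- exact: (cvg_in_distribution_fragmentation proc mean1' Minf_lim' X_law' X0_int m0E'
    gamma_gt0 mgamma nu_gt0 nu_law).
- split=> // g1 m00 Vinf0.
  have : (\int[P]_w `|Minf w|%:E = 0)%E.
    rewrite -[RHS](mean_cst P 0); apply: mean_ae_eq => //.
    apply: filterS Vinf0 => w /eqP; rewrite mulf_eq0 (negPf m00)/= => /eqP ->.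
    by rewrite normr0.
  have := mean_limit_mass_ge1 proc mean1' Minf_lim' g1 mgamma.
  by move=> /[swap] ->; rewrite lee_fin ler10.
- move=> cons; apply: filterS (conservative_limit_mass proc Minf_lim' cons) => w Mw.
  by rewrite /Vinf Mw mulr1.
- move=> nondeg p p1; have p0 : 0 < p by lra.
  rewrite calS_moment// unlock.
  have m00 : m0 != 0.
    by apply/eqP => m00; apply: nondeg; apply: aeW => w; rewrite /Vinf m00 mul0r.
  have g1 : 1 < gamma.
    by rewrite ltNge le_eqVlt negb_or gamma_neq1/=; apply/negP => /subcritical.
  have m0p : 0 < `|m0| `^ p by rewrite powR_gt0// normr_gt0.
  have mMp : measurable_fun setT (fun w => `|Minf w| `^ p).
    exact: measurable_powR_comp.
  have -> : (\int[P]_w (`|Vinf w| `^ p)%:E =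
      (`|m0| `^ p)%:E * \int[P]_w (`|Minf w| `^ p)%:E)%E.
    rewrite -meanZ; [|exact: mMp|by move=> w; exact: powR_ge0|exact: ltW].
    by apply: eq_integral => w _; rewrite /Vinf normrM powRM.
  split=> [fin|mp].
    apply: (finite_moment_subcritical proc mean1' Minf_lim' g1 mgamma p1).
    rewrite ltNge leye_eq; apply/negP => /eqP M; move: fin.
    by rewrite M mulry gtr0_sg// mul1e ltxx.
  have [B MB] := total_weight_moment_bounded proc mean1' p1 mp.
  apply: (@le_lt_trans _ _ ((`|m0| `^ p)%:E * B%:E)%E); last by rewrite -EFinM ltry.
  rewrite lee_wpmul2l ?lee_fin ?(ltW m0p)//.
  by apply: (limit_mass_moment_le Minf_lim' p0); exists 1%N => // n /= n0; exact: MB.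
Qed.
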